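(* Let $m,n$ be positive integers, let $\Omega\subset\mathbb{C}^m$ be a bounded domain, and let $\mathbf{T}=(T_1,\dots,T_m)$ (acting on $\mathcal{H}$) and $\widetilde{\mathbf{T}}=(\widetilde T_1,\dots,\widetilde T_m)$ (acting on $\widetilde{\mathcal{H}}$) be operator tuples in the class $\mathcal{B}_n^m(\Omega)$. For $\mathbf z\in\Omega$ let $K_{\mathbf z}^{IJ}$ and $\widetilde K_{\mathbf z}^{IJ}$ be the operators on $H_{\mathbf z}^1$ and $\widetilde H_{\mathbf z}^1$ defined in the context (formed from localizations of order $n+1$). Then $\mathbf{T}$ and $\widetilde{\mathbf{T}}$ are unitarily equivalent if and only if for every $\mathbf{z}\in\Omega$ the operator tuples $\{K_{\mathbf z}^{IJ}: 1\le|I|,|J|\le n\}$ and $\{\widetilde K_{\mathbf z}^{IJ}: 1\le|I|,|J|\le n\}$ are unitarily equivalent.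
   Context: Hilbert spaces are complex and separable. A commuting $m$-tuple $\mathbf{T}=(T_1,\dots,T_m)$ of bounded operators on a Hilbert space $\mathcal{H}$ belongs to $\mathcal{B}_n^m(\Omega)$ if: (i) for every $\mathbf{z}=(z_1,\dots,z_m)\in\Omega$ the space $\{((T_1-z_1)h,\dots,(T_m-z_m)h) : h\in\mathcal{H}\}$ is closed in $\mathcal{H}\oplus\cdots\oplus\mathcal{H}$ ($m$ copies); (ii) $\dim\bigcap_{i=1}^m\ker(T_i-z_i)=n$ for every $\mathbf{z}\in\Omega$; (iii) the closed linear span of $\bigcup_{\mathbf{z}\in\Omega}\bigcap_{i=1}^m\ker(T_i-z_i)$ is $\mathcal{H}$. For a multi-index $I=(i_1,\dots,i_m)$ of nonnegative integers, $|I|=i_1+\cdots+i_m$ and $(\mathbf{T}-\mathbf{z})^I=(T_1-z_1)^{i_1}\cdots(T_m-z_m)^{i_m}$. For a positive integer $k$, $H_{\mathbf z}^k=\bigcap_{|I|=k}\ker(\mathbf{T}-\mathbf{z})^I$; in particular $H_{\mathbf z}^1=\bigcap_{i=1}^m\ker(T_i-z_i)$. These spaces are finite dimensional and invariant under each $T_i$. Put $N_{\mathbf z}^I=(\mathbf{T}-\mathbf{z})^I|_{H_{\mathbf z}^{n+1}}$, an operator on $H_{\mathbf z}^{n+1}$, with adjoint $(N_{\mathbf z}^I)^*$ taken in $H_{\mathbf z}^{n+1}$. For multi-indices $I,J$ define $K_{\mathbf z}^{IJ}=P_{H_{\mathbf z}^1}\,[N_{\mathbf z}^I(N_{\mathbf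 z}^J)^*]\,|_{H_{\mathbf z}^1}$ on $H_{\mathbf z}^1$, where $P_{H_{\mathbf z}^1}$ is the orthogonal projection onto $H_{\mathbf z}^1$. The objects with tildes are defined in the same way from $\widetilde{\mathbf{T}}$. Two families of operators $\{A_\alpha\}$ on $X$ and $\{\widetilde A_\alpha\}$ on $\widetilde X$ with the same index set are unitarily equivalent if there is a single unitary $U:X\to\widetilde X$ with $UA_\alpha=\widetilde A_\alpha U$ for all $\alpha$. *)

(* Defs.v *)
From HB Require Import structures.
From mathcomp Require Import all_boot all_order all_algebra.
From mathcomp Require Import complex.
From mathcomp Require Import all_classical all_reals all_analysis.

Set Implicit Arguments.
Unset Strict Implicit.
Unset Printing Implicit Defensive.

Import Order.TTheory GRing.Theory Num.Theory.
Import numFieldNormedType.Exports.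

Local Open Scope classical_set_scope.
Local Open Scope ring_scope.

(* The scalars are R[i].  Norms take values in R[i], where they are nonnegative
   reals.  The inner product is linear in its first argument and conjugate
   linear in its second. *)
HB.mixin Record CompleteNormedModule_isHilbert (R : realType) H
    of CompleteNormedModule R[i] H := {
  inner : {dot H for @Num.conj R[i]} ;
  inner_norm : forall x : H, `|x| ^+ 2 = inner x x
}.

#[short(type="hilbertType")]
HB.structure Definition Hilbert (R : realType) :=
  {H of CompleteNormedModule R[i] H & CompleteNormedModule_isHilbert R H}.

Definition separable (X : topologicalType) : Prop :=
  exists D : set X, countable D /\ dense D.

(* The regular module R[i]^o carries the topology of the complex plane;
   'rV[R[i]^o]_m carries the product topology. *)
Definition bounded_domain (R : realType) (m : nat)
    (Omega : set 'rV[R[i]^o]_m) : Prop :=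
  [/\ Omega !=set0, open Omega, connected Omega & bounded_set Omega].

Section Subspaces.
Context {R : realType} {H : hilbertType R}.

Definition lincomb k (e : 'I_k -> H) (c : 'I_k -> R[i]) : H :=
  \sum_(i < k) c i *: e i.

Definition linear_span (S : set H) : set H :=
  [set h | exists k (e : 'I_k -> H) (c : 'I_k -> R[i]),
     (forall i, S (e i)) /\ h = lincomb e c].

(* X has a basis with k elements. *)
Definition has_dim (X : set H) (k : nat) : Prop :=
  exists e : 'I_k -> H, injective (lincomb e) /\ X = range (lincomb e).

Definition bounded_operator (A : {linear H -> H}) : Prop :=
  exists M : R[i], forall h, `|A h| <= M * `|h|.

(* Operators on a subspace X of H are represented by functions H -> H, of which
   only the values on X matter.  Both operations below are uniquely determined
   whenever they exist; they exist for linear A : X -> X and finite dimensional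
   X, the case in which they are used. *)
Definition orth_proj (X : set H) (h : H) : H :=
  xget 0 [set w | X w /\ forall x, X x -> inner (h - w) x = 0].

Definition adjoint_on (X : set H) (A : H -> H) (y : H) : H :=
  xget 0 [set w | X w /\ forall x, X x -> inner (A x) y = inner x w].

End Subspaces.

Section UnitaryEquivalence.
Context {R : realType} {H H' : hilbertType R}.

Definition unitary_between (X : set H) (X' : set H') (U : H -> H') : Prop :=
  [/\ forall (a : R[i]) x y, X x -> X y -> U (a *: x + y) = a *: U x + U y,
      forall x y, X x -> X y -> inner (U x) (U y) = inner x y
    & U @` X = X'].

Definition unitarily_equivalent (K : Type) (D : set K)
    (X : set H) (A : K -> H -> H) (X' : set H') (A' : K -> H' -> H') : Prop :=
  exists U : H -> H', unitary_between X X' U /\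
    forall k, D k -> forall x, X x -> U (A k x) = A' k (U x).

End UnitaryEquivalence.

Notation multi_index m := {ffun 'I_m -> nat}.

Definition mdeg m (I : multi_index m) : nat := (\sum_(i < m) I i)%N.

Section Tuples.
Context {R : realType} {H : hilbertType R} {m : nat}.
Implicit Types (T : 'I_m -> {linear H -> H}) (z : 'rV[R[i]^o]_m).

Definition sub_op T z (i : 'I_m) (h : H) : H := T i h - (z 0 i : R[i]) *: h.

Definition sub_op_pow T z (I : multi_index m) : H -> H :=
  \big[(fun f g : H -> H => f \o g)/idfun]_(i < m) iter (I i) (sub_op T z i).

Definition joint_ker T z : set H := [set h | forall i, sub_op T z i h = 0].

Definition gen_ker T z (k : nat) : set H :=
  [set h | forall I : multi_index m, mdeg I = k -> sub_op_pow T z I h = 0].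

Lemma gen_ker1 T z : gen_ker T z 1 = joint_ker T z.
Proof.
have sub0 i k : iter k (sub_op T z i) 0 = 0.
  by elim: k => //= k ->; rewrite /sub_op linear0 scaler0 subrr.
have comp_id (s : seq 'I_m) (f : 'I_m -> H -> H) (h : H) :
    (forall i, i \in s -> f i h = h) ->
    (\big[(fun f g : H -> H => f \o g)/idfun]_(i <- s) f i) h = h.
  elim: s => [|i s IH] fh; first by rewrite big_nil.
  rewrite big_cons /= IH ?fh ?mem_head// => j js.
  by apply: fh; rewrite inE js orbT.
apply/seteqP; split => h /= hh.
  move=> i; pose I : multi_index m := [ffun j => nat_of_bool (j == i)].
  have degI : mdeg I = 1%N.
    rewrite /mdeg (bigD1 i)//= big1 ?ffunE ?eqxx// => j /negPf.
    by rewrite ffunE => ->.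
  rewrite -(hh _ degI) /sub_op_pow.
  have := mem_index_enum i; have := index_enum_uniq 'I_m.
  elim: (index_enum _) => //= j s IH /andP[js us].
  rewrite big_cons inE /= => /orP[/eqP ij|/[dup] si /(IH us) e].
    rewrite comp_id ?ffunE -?ij ?eqxx// => k ks.
    by rewrite ffunE; case: eqP => // ki; rewrite -ij -ki ks in js.
  by rewrite ffunE; case: eqP => [ji|_ /=]; [rewrite ji si in js|].
move=> I I1; rewrite /sub_op_pow.
have [i Ii] : exists i, I i != 0%N.
  apply/existsP; rewrite -negb_forall; apply/negP => /forallP I0.
  by move: I1; rewrite /mdeg big1// => i _; apply/eqP/I0.
have subh j k : k != 0%N -> iter k (sub_op T z j) h = 0.
  by case: k => // k _; rewrite iterSr hh sub0.
have P (s : seq 'I_m) :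
    let v := (\big[(fun f g : H -> H => f \o g)/idfun]_(i <- s)
                iter (I i) (sub_op T z i)) h in
    (v = 0 \/ v = h) /\ (i \in s -> v = 0).
  elim: s => [|j s [IH1 IH2]] /=; first by rewrite big_nil; split=> //; right.
  rewrite big_cons inE /=; split.
    case: IH1 => ->; first by left; rewrite sub0.
    by have [->|/subh ->] := eqVneq (I j) 0%N; [right|left].
  move=> /orP[/eqP ij|/IH2 ->]; last exact: sub0.
  by case: IH1 => ->; rewrite ?sub0// subh// -ij.
by have [_ ->] := P (index_enum 'I_m); rewrite ?mem_index_enum.
Qed.

(* The direct sum of m copies of H is 'rV[H]_m with the product topology. *)
Record class_B (n : nat) (Omega : set 'rV[R[i]^o]_m) T : Prop := {
  class_B_bounded : forall i, bounded_operator (T i) ;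
  class_B_commute : forall i j h, T i (T j h) = T j (T i h) ;
  class_B_closed : forall z, Omega z ->
    closed (range (fun h : H => \row_(i < m) sub_op T z i h)) ;
  class_B_dim : forall z, Omega z -> has_dim (joint_ker T z) n ;
  class_B_span :
    closure (linear_span (\bigcup_(z in Omega) joint_ker T z)) = setT
}.

Definition local_op (n : nat) T z (I J : multi_index m) (h : H) : H :=
  orth_proj (gen_ker T z 1)
    (sub_op_pow T z I (adjoint_on (gen_ker T z n.+1) (sub_op_pow T z J) h)).

End Tuples.

(* Main.v *)
(* At each point z fix an orthonormal basis of the joint kernel.  It extends to
   a holomorphic frame of the bundle of joint kernels whose components in the
   fibre over z are constant; let jet z I be the Taylor coefficients of this
   frame at z.  They span the generalized kernels, and the operators K^{IJ} are
   the block inverse of the Gram matrices X_{IJ} = <jet I, jet J>.  Hence the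
   local hypothesis says that a unitary U_z conjugates X_{IJ} into its
   counterpart for |I|, |J| <= n.

   A covariant derivative of X_{IJ} is a polynomial in such matrices.  Consider
   the two tuples together, as block diagonal matrices, and let A_k(z) be the
   star algebra generated by the X_{IJ} with |I|, |J| <= k.  By Cayley-Hamilton
   and the conjugation U_z, a self-adjoint element of A_k(z) with k <= n has at
   most n distinct eigenvalues; so for generic z the maximal number of
   eigenvalues is the same for some k < n and for k + 1.  Then the spectral
   projections of a maximal element of A_k cut A_{k+1} into scalar corners, and
   this makes an algebra between A_k and A_{k+1} closed under covariant
   differentiation.  It therefore contains all X_{IJ}, and at one point z the
   unitary U_z conjugates all of them.  Since the domain is connected, the jets
   at z span a dense subspace, on which U_z defines the required unitary. *)

Require Import Defs.
From HB Require Import structures.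
From mathcomp Require Import all_boot all_order all_algebra.
From mathcomp Require Import complex ring lra zify.
From mathcomp Require Import all_classical all_reals all_analysis.

Set Implicit Arguments.
Unset Strict Implicit.
Unset Printing Implicit Defensive.

Import Order.TTheory GRing.Theory Num.Theory.
Import numFieldNormedType.Exports.

Local Open Scope classical_set_scope.
Local Open Scope ring_scope.
Local Open Scope sesquilinear_scope.

(** The value of a word in the Gram coefficients at one point does not determine its covariant
    derivative there, so differentiation acts on formal words. It descends to values, modulo the
    intermediate algebra [B], only where the dimension of [B] is locally constant: there a word that
    vanishes at the point and has values in [B] nearby has its derivative in [B]. This is why the
    open set is shrunk twice, for the eigenvalue counts and for this dimension.

    [B] is generated by the letters of [notched_box k]. A letter with first degree [k.+1] would be
    raised to degree [k + 2], outside the algebra whose corners are scalar; such letters are reached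
    only as adjoints.

    Order [n] suffices by counting: the maximal numbers of eigenvalues for degrees 0 to [n] do not
    decrease, start at 1 or more and end at [n] or less, so two neighbours agree.

    No function theory enters. Closed range bounds a vector by its defect and its pairings with the
    joint kernel; applied to differences of frames, this bound yields the jets, their first
    derivatives along real rays and the convergence of Taylor expansions. The directions 1 and ['i]
    separate complex linear from conjugate linear parts. *)

Section MatrixLimits.
Context {K : numFieldType} {X : Type} (F : set_system X) {FF : Filter F}.

Definition mx_lim a b (f : X -> 'M[K]_(a, b)) (l : 'M[K]_(a, b)) : Prop :=
  forall i j, (fun x => f x i j : K^o) @ F --> (l i j : K^o).

Lemma scalar_lim_sum I (r : seq I) (P : pred I) (f : I -> X -> K) (l : I -> K) :
  (forall i, (fun x => f i x : K^o) @ F --> (l i : K^o)) ->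
  (fun x => \sum_(i <- r | P i) f i x : K^o) @ F --> (\sum_(i <- r | P i) l i : K^o).
Proof.
move=> h; elim: r => [|i r IH].
  under eq_fun do rewrite big_nil; rewrite big_nil; exact: cvg_cst.
under eq_fun do rewrite big_cons; rewrite big_cons.
by case: (P i) => //; apply: (@cvgD K K^o) => //; exact: h.
Qed.

Lemma scalar_lim_prod I (r : seq I) (P : pred I) (f : I -> X -> K) (l : I -> K) :
  (forall i, (fun x => f i x : K^o) @ F --> (l i : K^o)) ->
  (fun x => \prod_(i <- r | P i) f i x : K^o) @ F --> (\prod_(i <- r | P i) l i : K^o).
Proof.
move=> h; elim: r => [|i r IH].
  under eq_fun do rewrite big_nil; rewrite big_nil; exact: cvg_cst.
under eq_fun do rewrite big_cons; rewrite big_cons.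
by case: (P i) => //; apply: (@cvgM K) => //; exact: h.
Qed.

Lemma mx_lim_cst a b (l : 'M[K]_(a, b)) : mx_lim (fun=> l) l.
Proof. by move=> i j; exact: cvg_cst. Qed.

Lemma mx_limD a b (f g : X -> 'M[K]_(a, b)) l k :
  mx_lim f l -> mx_lim g k -> mx_lim (fun x => f x + g x) (l + k).
Proof.
move=> hf hg i j; under eq_fun do rewrite mxE; rewrite mxE.
by apply: (@cvgD K K^o); [exact: hf|exact: hg].
Qed.

Lemma mx_limM a b c (f : X -> 'M[K]_(a, b)) (g : X -> 'M[K]_(b, c)) l k :
  mx_lim f l -> mx_lim g k -> mx_lim (fun x => f x *m g x) (l *m k).
Proof.
move=> hf hg i j; under eq_fun do rewrite mxE; rewrite mxE.
by apply: scalar_lim_sum => s; apply: (@cvgM K); [exact: hf|exact: hg].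
Qed.

Lemma mx_limZ a b (f : X -> K) (g : X -> 'M[K]_(a, b)) c k :
  (fun x => f x : K^o) @ F --> (c : K^o) -> mx_lim g k ->
  mx_lim (fun x => f x *: g x) (c *: k).
Proof.
move=> hf hg i j; under eq_fun do rewrite mxE; rewrite mxE.
by apply: (@cvgM K); [exact: hf|exact: hg].
Qed.

Lemma mx_lim_det a (f : X -> 'M[K]_a) l :
  mx_lim f l -> (fun x => \det (f x) : K^o) @ F --> (\det l : K^o).
Proof.
move=> h; rewrite /determinant.
apply: scalar_lim_sum => s; apply: (@cvgM K); first exact: cvg_cst.
by apply: scalar_lim_prod => i; exact: h.
Qed.

Lemma mx_lim_adj a (f : X -> 'M[K]_a) l :
  mx_lim f l -> mx_lim (fun x => \adj (f x)) (\adj l).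
Proof.
move=> h i j; under eq_fun do rewrite mxE; rewrite mxE /cofactor.
apply: (@cvgM K); first exact: cvg_cst.
apply: mx_lim_det => s t; under eq_fun do rewrite !mxE; rewrite !mxE; exact: h.
Qed.

Lemma mx_lim_mxvec a b (f : X -> 'M[K]_(a, b)) l :
  mx_lim f l -> mx_lim (fun x => mxvec (f x)) (mxvec l).
Proof.
move=> h i j; rewrite ord1; case/mxvec_indexP: j => s t.
by under eq_fun do rewrite mxvecE; rewrite mxvecE; exact: h.
Qed.

Lemma mx_lim_eq a b (f g : X -> 'M[K]_(a, b)) l :
  (\forall x \near F, f x = g x) -> mx_lim f l -> mx_lim g l.
Proof.
move=> fg h i j; apply: cvg_trans (h i j); apply: near_eq_cvg.
by apply: filterS fg => x ->.
Qed.

(** A right inverse [B] of the limit reduces freeness to a nonzero determinant of [f x *m B], and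
    this determinant tends to 1. *)
Lemma near_row_free a b (f : X -> 'M[K]_(a, b)) l :
  mx_lim f l -> row_free l -> \forall x \near F, row_free (f x).
Proof.
move=> h /row_freeP[B lB].
have /mx_lim_det : mx_lim (fun x => f x *m B) (l *m B).
  by apply: mx_limM => //; exact: mx_lim_cst.
rewrite lB det1 => /cvgrPdist_lt /(_ 1 ltr01); apply: filterS => x /= hx.
have : f x *m B \in unitmx.
  rewrite unitmxE unitfE; apply: contraTneq hx => ->.
  by rewrite subr0 normr1 ltxx.
by move=> fu; apply/row_freeP; exists (B *m invmx (f x *m B)); rewrite mulmxA mulmxV.
Qed.

End MatrixLimits.

Section LimitOfSpans.
Context {K : numFieldType} {X : Type} (F : set_system X) {FF : ProperFilter F}.

(* If [l *m B = 1], then [q = q B (f B)^-1 f] for nearby [f]; multiplied by the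
   determinant this identity passes to the limit. *)
Lemma mx_lim_sub a b (f : X -> 'M[K]_(a, b)) (q : X -> 'rV[K]_b) l s :
  mx_lim F f l -> row_free l -> mx_lim F q s ->
  (\forall x \near F, (q x <= f x)%MS) -> (s <= l)%MS.
Proof.
move=> hf /row_freeP[B lB] hq sub.
have hfB : mx_lim F (fun x => f x *m B) (l *m B).
  by apply: mx_limM => //; exact: mx_lim_cst.
have h1 : mx_lim F (fun x => \det (f x *m B) *: q x) (\det (l *m B) *: s).
  by apply: mx_limZ => //; exact: mx_lim_det.
have h2 : mx_lim F (fun x => q x *m B *m \adj (f x *m B) *m f x)
             (s *m B *m \adj (l *m B) *m l).
  apply: mx_limM => //; apply: mx_limM; last exact: mx_lim_adj.
  by apply: mx_limM => //; exact: mx_lim_cst.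
have e : \forall x \near F,
    \det (f x *m B) *: q x = q x *m B *m \adj (f x *m B) *m f x.
  apply: filterS sub => x /submxP[D ->].
  by rewrite -[D *m f x *m B]mulmxA -[X in X *m f x]mulmxA mul_mx_adj mul_mx_scalar
    scalemxAl.
have {}h1 : mx_lim F (fun x => q x *m B *m \adj (f x *m B) *m f x)
    (\det (l *m B) *: s) by exact: mx_lim_eq h1.
have -> : s = s *m B *m \adj (l *m B) *m l.
  rewrite {1}lB det1 scale1r in h1.
  by apply/matrixP => i j; apply: (cvg_unique _ (h1 i j) (h2 i j)).
exact: submxMl.
Qed.

End LimitOfSpans.

(** * Multi-indices *)

Section MultiIndices.
Context {m : nat}.
Implicit Types (I J K : multi_index m) (i j : 'I_m).

Definition midx0 : multi_index m := [ffun=> 0%N].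
Definition mone i : multi_index m := [ffun j => nat_of_bool (j == i)].
Definition madd I J : multi_index m := [ffun j => (I j + J j)%N].
Definition msub I J : multi_index m := [ffun j => (I j - J j)%N].

Lemma mdeg0 : mdeg midx0 = 0%N.
Proof. by rewrite /mdeg big1 // => i _; rewrite ffunE. Qed.

Lemma mdeg1 i : mdeg (mone i) = 1%N.
Proof.
rewrite /mdeg (bigD1 i) //= big1 ?ffunE ?eqxx // => j /negPf.
by rewrite ffunE => ->.
Qed.

Lemma mdegD I J : mdeg (madd I J) = (mdeg I + mdeg J)%N.
Proof. by rewrite /mdeg -big_split; apply: eq_bigr => i _; rewrite ffunE. Qed.

Lemma mdeg_eq0 I : (mdeg I == 0%N) = (I == midx0).
Proof.
apply/idP/eqP => [|->]; last by rewrite mdeg0.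
rewrite /mdeg sum_nat_eq0 => /forallP h; apply/ffunP => i.
by rewrite ffunE; apply/eqP; have := h i.
Qed.

Lemma mdeg_gt0P I : I != midx0 -> exists i, I i != 0%N.
Proof.
rewrite -mdeg_eq0 => I0; apply/existsP; apply: contraR I0.
rewrite negb_exists => /forallP h; rewrite /mdeg big1 // => i _.
by apply/eqP; rewrite -[_ == _]negbK; exact: h.
Qed.

Lemma msub0 I : msub I midx0 = I.
Proof. by apply/ffunP => i; rewrite !ffunE subn0. Qed.

Lemma msubb I : msub I I = midx0.
Proof. by apply/ffunP => i; rewrite !ffunE subnn. Qed.

Lemma maddK I J : msub (madd I J) J = I.
Proof. by apply/ffunP => i; rewrite !ffunE addnK. Qed.

Lemma msubK I i : I i != 0%N -> madd (msub I (mone i)) (mone i) = I.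
Proof.
move=> Ii; apply/ffunP => j; rewrite !ffunE; case: eqP => [->|_] /=.
  by rewrite subnK // lt0n.
by rewrite subn0 addn0.
Qed.

Lemma mdeg_msub1 I i : I i != 0%N -> (mdeg (msub I (mone i))).+1 = mdeg I.
Proof. by move=> Ii; rewrite -{2}(msubK Ii) mdegD mdeg1 addn1. Qed.

Lemma mone_neq0 i : mone i != midx0.
Proof. by rewrite -mdeg_eq0 mdeg1. Qed.

Definition mle I J := [forall i, (I i <= J i)%N].

Lemma mleP I J : reflect (forall i, (I i <= J i)%N) (mle I J).
Proof. exact: forallP. Qed.

Lemma mle_refl I : mle I I.
Proof. by apply/mleP. Qed.

Lemma mle0 I : mle midx0 I.
Proof. by apply/mleP => i; rewrite ffunE. Qed.

Lemma mle_deg I J : mle I J -> (mdeg I <= mdeg J)%N.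
Proof. by move/mleP => h; rewrite /mdeg; apply: leq_sum => i _; exact: h. Qed.

Lemma mle_deg_eq I J : mle I J -> mdeg I = mdeg J -> I = J.
Proof.
move=> IJ e; suff : mdeg (msub J I) = 0%N.
  move/eqP; rewrite mdeg_eq0 => /eqP/ffunP h; apply/ffunP => i.
  move/mleP/(_ i): IJ; move: (h i); rewrite !ffunE => /eqP.
  by rewrite subn_eq0 => a b; apply/eqP; rewrite eqn_leq a b.
have : madd (msub J I) I = J.
  by apply/ffunP => i; rewrite !ffunE subnK //; move/mleP: IJ.
by move/(congr1 (@mdeg m)); rewrite mdegD e => /eqP; rewrite -{2}[mdeg J]add0n eqn_add2r
  => /eqP.
Qed.

Lemma mdeg_msub I J : (mdeg (msub I J) <= mdeg I)%N.
Proof. by apply: mle_deg; apply/mleP => i; rewrite ffunE leq_subr. Qed.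

Lemma leq_mdeg I i : (I i <= mdeg I)%N.
Proof. by rewrite /mdeg (bigD1 i) //= leq_addr. Qed.

Definition mbox b : seq (multi_index m) :=
  [seq [ffun i => nat_of_ord ((f : {ffun 'I_m -> 'I_b.+1}) i)] | f : {ffun 'I_m -> 'I_b.+1}].

Lemma mbox_uniq b : uniq (mbox b).
Proof.
rewrite map_inj_uniq ?enum_uniq // => f g /ffunP h; apply/ffunP => i.
by apply: val_inj; have := h i; rewrite !ffunE.
Qed.

Lemma mem_mbox b I : (forall i, (I i <= b)%N) -> I \in mbox b.
Proof.
move=> Ib; apply/mapP; exists [ffun i => inord (I i)]; first by rewrite mem_enum.
by apply/ffunP => i; rewrite !ffunE inordK // ltnS.
Qed.

Definition mupto k : seq (multi_index m) := [seq J <- mbox k | (mdeg J <= k)%N].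

Lemma mupto_uniq k : uniq (mupto k).
Proof. exact/filter_uniq/mbox_uniq. Qed.

Lemma mem_mupto k I : (I \in mupto k) = (mdeg I <= k)%N.
Proof.
rewrite mem_filter andb_idr // => Ik; apply: mem_mbox => i.
exact: leq_trans (leq_mdeg _ _) Ik.
Qed.

(** These indices run through the sums in covariant derivatives. The omitted index [midx0] would
    contribute a pairing of the value of a normal frame with a first-order coefficient, which
    vanishes. *)
Definition mbelow I : seq (multi_index m) :=
  [seq K <- mbox (mdeg I) | mle K I && (K != midx0)].

Lemma mbelow_uniq I : uniq (mbelow I).
Proof. exact/filter_uniq/mbox_uniq. Qed.

Lemma mem_mbelow I K : (K \in mbelow I) = mle K I && (K != midx0).
Proof.
rewrite mem_filter andb_idr // => /andP[/mleP h _]; apply: mem_mbox => i.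
exact: leq_trans (h i) (leq_mdeg _ _).
Qed.

Lemma mbelow_msub1 I i : I i != 0%N ->
  perm_eq [seq K : multi_index m <- mbelow I | (K i < I i)%N] (mbelow (msub I (mone i))).
Proof.
move=> Ii; apply: uniq_perm; [exact/filter_uniq/mbelow_uniq|exact: mbelow_uniq|move=> K].
rewrite mem_filter !mem_mbelow andbA; congr andb; rewrite ?andbT.
apply/idP/mleP => [/andP[Ki /mleP KI] j|h].
  rewrite !ffunE; case: eqP => [->|_]; last by rewrite subn0 KI.
  by rewrite subn1 -ltnS prednK // lt0n.
apply/andP; split.
  have := h i; rewrite !ffunE eqxx subn1 => h'.
  by rewrite -(prednK (n := I i)) ?lt0n // ltnS.
by apply/mleP => j; apply: leq_trans (h j) _; rewrite ffunE leq_subr.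
Qed.

Lemma mupto_msub1 k i :
  perm_eq [seq I : multi_index m <- mupto k.+1 | I i != 0%N] [seq madd J (mone i) | J <- mupto k].
Proof.
have inj : injective (fun I => madd I (mone i)).
  by move=> I J /(congr1 (fun A => msub A (mone i))); rewrite !maddK.
apply: uniq_perm; first exact/filter_uniq/mupto_uniq.
  by rewrite map_inj_uniq ?mupto_uniq.
move=> I; rewrite mem_filter mem_mupto; apply/andP/mapP => [[Ii Ik]|[J Jk ->]].
  exists (msub I (mone i)); last by rewrite msubK.
  by rewrite mem_mupto -ltnS mdeg_msub1.
by rewrite ffunE [mone i i]ffunE eqxx addn1 mdegD mdeg1 addn1 ltnS -mem_mupto.
Qed.

End MultiIndices.
Arguments midx0 {m}.

(** * Words in the Gram coefficients and their covariant derivatives *)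

Section Expressions.
Context {K : numClosedFieldType} {m : nat}.
Local Notation letter := (multi_index m * multi_index m)%type.

(** Words are kept apart from their values because [dexpr] depends on the word, and because one word
    has to be evaluated at all nearby points and in both families. *)
Inductive expr :=
  Cst of K | Letter of letter | Add of expr & expr | Mul of expr & expr.

Fixpoint ev N (V : letter -> 'M[K]_N.+1) (e : expr) : 'M[K]_N.+1 :=
  match e with
  | Cst c => c%:M
  | Letter l => V l
  | Add e1 e2 => ev V e1 + ev V e2
  | Mul e1 e2 => ev V e1 *m ev V e2
  end.

Fixpoint letters_in (P : pred letter) (e : expr) : bool :=
  match e with
  | Cst _ => true
  | Letter l => P l
  | Add e1 e2 | Mul e1 e2 => letters_in P e1 && letters_in P e2
  end.

Fixpoint adj_expr (e : expr) : expr :=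
  match e with
  | Cst c => Cst c^*
  | Letter l => Letter (l.2, l.1)
  | Add e1 e2 => Add (adj_expr e1) (adj_expr e2)
  | Mul e1 e2 => Mul (adj_expr e2) (adj_expr e1)
  end.

Definition sum_expr T (s : seq T) (f : T -> expr) : expr :=
  foldr (fun x => Add (f x)) (Cst 0) s.

(* The covariant derivative, in the j-th holomorphic direction, of the Taylor
   coefficient of index (I, J) of the Gram matrix of a normal frame. *)
Definition dletter j (l : letter) : expr :=
  Add (Mul (Cst (l.1 j).+1%:R) (Letter (madd l.1 (mone j), l.2)))
      (Mul (Cst (- 1))
         (sum_expr (mbelow l.2) (fun A => Mul (Letter (mone j, A)) (Letter (l.1, msub l.2 A))))).

Fixpoint dexpr j (e : expr) : expr :=
  match e with
  | Cst c => Cst 0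
  | Letter l => dletter j l
  | Add e1 e2 => Add (dexpr j e1) (dexpr j e2)
  | Mul e1 e2 => Add (Mul (dexpr j e1) e2) (Mul e1 (dexpr j e2))
  end.

Lemma ev_sum N (V : letter -> 'M[K]_N.+1) T (s : seq T) f :
  ev V (sum_expr s f) = \sum_(x <- s) ev V (f x).
Proof.
elim: s => [|x s /= ->]; last by rewrite big_cons.
by rewrite big_nil /= raddf0.
Qed.

Lemma ev_dletter N (V : letter -> 'M[K]_N.+1) j I J :
  ev V (dletter j (I, J)) = (I j).+1%:R *: V (madd I (mone j), J)
    - \sum_(A <- mbelow J) V (mone j, A) *m V (I, msub J A).
Proof. by rewrite /= ev_sum !mul_scalar_mx scaleN1r. Qed.

Lemma letters_in_sum P (T : eqType) (s : seq T) f :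
  (forall x, x \in s -> letters_in P (f x)) -> letters_in P (sum_expr s f).
Proof.
elim: s => //= x s IH h; rewrite h ?mem_head ?IH // => y ys.
by apply: h; rewrite inE ys orbT.
Qed.

Lemma letters_inW (P Q : pred letter) e : subpred P Q -> letters_in P e -> letters_in Q e.
Proof.
move=> PQ; elim: e => //= e1 IH1 e2 IH2.
  by move=> /andP[/IH1 -> /IH2 ->].
by move=> /andP[/IH1 -> /IH2 ->].
Qed.

Lemma letters_in_adj (P : pred letter) e :
  (forall l, P l -> P (l.2, l.1)) -> letters_in P e -> letters_in P (adj_expr e).
Proof.
move=> PQ; elim: e => //= e1 IH1 e2 IH2.
  by move=> /andP[/IH1 -> /IH2 ->].
by move=> /andP[/IH1 -> /IH2 ->].
Qed.

Lemma letters_in_dexpr (P Q : pred letter) j e : subpred P Q ->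
  (forall l, P l -> letters_in Q (dletter j l)) -> letters_in P e -> letters_in Q (dexpr j e).
Proof.
move=> PQ dPQ; elim: e => //= e1 IH1 e2 IH2.
  by move=> /andP[/IH1 -> /IH2 ->].
by move=> /andP[h1 h2]; rewrite IH1 // IH2 // !(letters_inW PQ).
Qed.

Lemma ev_adj_expr N (V : letter -> 'M[K]_N.+1) e :
  (forall l, V (l.2, l.1) = (V l)^t*) -> ev V (adj_expr e) = (ev V e)^t*.
Proof.
move=> Vs; elim: e => //= [c|e1 IH1 e2 IH2|e1 IH1 e2 IH2].
- by rewrite tr_scalar_mx map_scalar_mx.
- by rewrite linearD /= map_mxD IH1 IH2.
- by rewrite trmx_mul map_mxM IH1 IH2.
Qed.

Lemma ev_intertwine N (V W : letter -> 'M[K]_N.+1) (S : 'M[K]_N.+1)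
    (P : pred letter) (e : expr) :
  (forall l, P l -> S *m V l = W l *m S) -> letters_in P e -> S *m ev V e = ev W e *m S.
Proof.
move=> VW; elim: e => /= [c|l|e1 IH1 e2 IH2|e1 IH1 e2 IH2].
- by rewrite mul_scalar_mx mul_mx_scalar.
- exact: VW.
- by move=> /andP[h1 h2]; rewrite mulmxDr mulmxDl IH1 // IH2.
- by move=> /andP[h1 h2]; rewrite mulmxA IH1 // -mulmxA IH2 // mulmxA.
Qed.

(** The size is convertible to [N.+1 + N.+1] and is visibly a successor, as [ev] requires. *)
Definition block_diag N (A B : 'M[K]_N.+1) : 'M[K]_((N + N.+1).+1) :=
  @block_mx K N.+1 N.+1 N.+1 N.+1 A 0 0 B.

Lemma block_diagD N (A B A' B' : 'M[K]_N.+1) :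
  block_diag A B + block_diag A' B' = block_diag (A + A') (B + B').
Proof.
by have := @add_block_mx K N.+1 N.+1 N.+1 N.+1 A 0 0 B A' 0 0 B'; rewrite !addr0.
Qed.

Lemma block_diagM N (A B A' B' : 'M[K]_N.+1) :
  block_diag A B *m block_diag A' B' = block_diag (A *m A') (B *m B').
Proof.
apply: (etrans (@mulmx_block K N.+1 N.+1 N.+1 N.+1 N.+1 N.+1 A 0 0 B A' 0 0 B')).
by rewrite !mulmx0 !mul0mx !addr0 !add0r.
Qed.

Lemma ev_block N (V W : letter -> 'M[K]_N.+1) (e : expr) :
  ev (fun l => block_diag (V l) (W l)) e = block_diag (ev V e) (ev W e).
Proof.
elim: e => //= [c|e1 -> e2 ->|e1 -> e2 ->].
- exact: (@scalar_mx_block K N.+1 N.+1).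
- exact: block_diagD.
- exact: block_diagM.
Qed.

End Expressions.
Arguments expr : clear implicits.

(** * Holomorphic frames and first derivatives along real rays *)

Section Frames.
Context {R : realType} {m N : nat}.
Local Notation C := R[i].
Local Notation space := 'rV[C^o]_m.
Local Notation letter := (multi_index m * multi_index m)%type.
Implicit Types (z : space) (e : expr C m).

Definition ray z (j : 'I_m) (c : C) (t : R) : space :=
  z + (t%:C%C * c : C^o) *: delta_mx 0 j.

Lemma real_complex_cvg0 : (t%:C%C : C^o) @[t --> (0 : R)^'] --> (0 : C^o).
Proof.
apply/cvgrPdist_lt => e e0.
have eE : e = (complex.Re e)%:C%C by rewrite RRe_real // gtr0_real.
have Re0 : 0 < complex.Re e by rewrite -ltcR -eE.
apply: filterS (@dnbhs0_lt R R^o _ Re0) => t.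
by rewrite sub0r normrN eE normc_def /= expr0n /= addr0 sqrtr_sqr ltcR.
Qed.

Lemma ray_cvg z j c : ray z j c t @[t --> (0 : R)^'] --> z.
Proof.
rewrite -[X in _ --> X]addr0 -(scale0r (delta_mx 0 j : space)).
apply: cvgD; first exact: cvg_cst.
apply: (@cvgZ C space); last exact: cvg_cst.
rewrite -(mul0r c); apply: (@cvgM C); first exact: real_complex_cvg0.
exact: cvg_cst.
Qed.

(* [Y] expresses the letters in a frame which is holomorphic near [z]; the
   derivative along the real line [ray z j c] then splits into a part linear
   in [c] and a part conjugate linear in [c]. *)
Definition holomorphic_frame (X : space -> letter -> 'M[C]_N.+1) z
    (Y : space -> letter -> 'M[C]_N.+1) : Prop :=
  [/\ \forall v \near z, exists S : 'M[C]_N.+1,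
        S \in unitmx /\ forall l, S *m Y v l = X v l *m S,
      forall l, mx_lim (nbhs z) (fun v => Y v l) (X z l)
    & forall j l, exists B : 'M[C]_N.+1, forall c : C,
        mx_lim ((0 : R)^') (fun t : R => t^-1%:C%C *: (Y (ray z j c t) l - X z l))
          (c *: ev (X z) (dletter j l) + c^* *: B)].

Lemma ev_frame_cvg X z Y e : holomorphic_frame X z Y ->
  mx_lim (nbhs z) (fun v => ev (Y v) e) (ev (X z) e).
Proof.
case=> _ hY _; elim: e => [c|l|e1 IH1 e2 IH2|e1 IH1 e2 IH2] /=.
- exact: mx_lim_cst.
- exact: hY.
- exact: (mx_limD IH1 IH2).
- exact: (mx_limM IH1 IH2).
Qed.

(** Induction with the product rule. Only the part linear in [c] has to be a word again; the
    conjugate linear part stays an anonymous matrix. *)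
Lemma ev_frame_der X z Y e j : holomorphic_frame X z Y ->
  exists B : 'M[C]_N.+1, forall c : C,
    mx_lim ((0 : R)^') (fun t : R => t^-1%:C%C *: (ev (Y (ray z j c t)) e - ev (X z) e))
      (c *: ev (X z) (dexpr j e) + c^* *: B).
Proof.
move=> fr; elim: e => [a|l|e1 [B1 IH1] e2 [B2 IH2]|e1 [B1 IH1] e2 [B2 IH2]].
- exists 0 => c /=; rewrite raddf0 !scaler0 addr0.
  have -> : (fun t : R => t^-1%:C%C *: (a%:M - a%:M)) = fun=> 0 :> 'M[C]_N.+1.
    by apply/funext => t; rewrite subrr scaler0.
  exact: mx_lim_cst.
- by case: fr => _ _; exact.
- exists (B1 + B2) => c /=.
  have := mx_limD (IH1 c) (IH2 c).
  rewrite !scalerDr addrACA => h; apply: mx_lim_eq (h _).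
  by near=> t; rewrite -scalerDr opprD addrACA.
- exists (B1 *m ev (X z) e2 + ev (X z) e1 *m B2) => c /=.
  have h2 : mx_lim ((0 : R)^') (fun t : R => ev (Y (ray z j c t)) e2) (ev (X z) e2).
    move=> p q; have := ev_frame_cvg (e := e2) fr (i := p) (j := q).
    exact: (cvg_comp (ray z j c) (fun v => ev (Y v) e2 p q : C^o) (@ray_cvg z j c)).
  have h : mx_lim ((0 : R)^')
      (fun t => (t^-1%:C%C *: (ev (Y (ray z j c t)) e1 - ev (X z) e1)) *m
         ev (Y (ray z j c t)) e2 +
         ev (X z) e1 *m (t^-1%:C%C *: (ev (Y (ray z j c t)) e2 - ev (X z) e2)))
      ((c *: ev (X z) (dexpr j e1) + c^* *: B1) *m ev (X z) e2 +
       ev (X z) e1 *m (c *: ev (X z) (dexpr j e2) + c^* *: B2)).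
    apply: mx_limD; first exact: (mx_limM (IH1 c) h2).
    apply: (mx_limM _ (IH2 c)); exact: mx_lim_cst.
  rewrite mulmxDl mulmxDr -!scalemxAl -!scalemxAr addrACA -!scalerDr in h.
  apply: mx_lim_eq h; near=> t.
  rewrite -scalemxAl -scalemxAr -scalerDr; congr (_ *: _).
  by rewrite mulmxBl mulmxBr addrA subrK.
Unshelve. all: by end_near. Qed.

End Frames.

(** * Star algebras of matrices *)

Section StarAlgebras.
Context {K : numClosedFieldType} {N : nat}.
Implicit Types (A B S : 'M[K]_N.+1) (p : {poly K}).

Record star_algebra (P : set 'M[K]_N.+1) : Prop := {
  staralg_cst : forall c, P c%:M ;
  staralg_add : forall A B, P A -> P B -> P (A + B) ;
  staralg_mul : forall A B, P A -> P B -> P (A *m B) ;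
  staralg_adj : forall A, P A -> P (A ^t*)
}.

Lemma staralg_scale P c A : star_algebra P -> P A -> P (c *: A).
Proof.
by move=> sP PA; rewrite -mul_scalar_mx; apply: staralg_mul => //; exact: staralg_cst.
Qed.

Lemma staralg_sub P A B : star_algebra P -> P A -> P B -> P (A - B).
Proof.
by move=> sP PA PB; rewrite -scaleN1r; apply: staralg_add => //; exact: staralg_scale.
Qed.

Lemma staralg_sum P T (s : seq T) (f : T -> 'M[K]_N.+1) : star_algebra P ->
  (forall x, P (f x)) -> P (\sum_(x <- s) f x).
Proof.
move=> sP Pf; elim: s => [|x s IH]; last by rewrite big_cons; exact: staralg_add.
by rewrite big_nil -(raddf0 (@scalar_mx K N.+1)); exact: staralg_cst.
Qed.

Lemma staralg_horner P A p : star_algebra P -> P A -> P (horner_mx A p).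
Proof.
move=> sP PA; elim/poly_ind: p => [|p c IH].
  by rewrite rmorph0 -(raddf0 (@scalar_mx K N.+1)); exact: staralg_cst.
rewrite rmorphD rmorphM /= horner_mx_X horner_mx_C.
by apply: staralg_add => //; [exact: staralg_mul|exact: staralg_cst].
Qed.

Lemma adjmxD A B : (A + B) ^t* = A ^t* + B ^t*.
Proof. by rewrite linearD map_mxD. Qed.

Lemma adjmxM A B : (A *m B) ^t* = B ^t* *m A ^t*.
Proof. by rewrite trmx_mul map_mxM. Qed.

Lemma adjmxZ c A : (c *: A) ^t* = c^* *: A ^t*.
Proof. by rewrite linearZ /= map_mxZ. Qed.

Lemma adjmxC c : (c%:M : 'M[K]_N.+1) ^t* = (c^*)%:M.
Proof. by rewrite tr_scalar_mx map_scalar_mx. Qed.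

Lemma adjmx0 : (0 : 'M[K]_N.+1) ^t* = 0.
Proof. by rewrite trmx0 map_mx0. Qed.

Lemma adjmxB A B : (A - B) ^t* = A ^t* - B ^t*.
Proof. by rewrite linearB map_mxB. Qed.

Lemma adjmx_sum I (s : seq I) (P : pred I) (F : I -> 'M[K]_N.+1) :
  (\sum_(i <- s | P i) F i) ^t* = \sum_(i <- s | P i) (F i) ^t*.
Proof. exact: (big_morph (fun A => A ^t*) adjmxD adjmx0). Qed.

Lemma adjmx_mul_eq0 A : A ^t* *m A = 0 -> A = 0.
Proof.
move=> AA; apply/matrixP => p q; rewrite [RHS]mxE.
have /matrixP/(_ q q) := AA; rewrite [RHS]mxE mxE.
under eq_bigr do rewrite mxE mxE mulrC -normCK.
move=> h; have := psumr_eq0P (fun i _ => exprn_ge0 2 (normr_ge0 (A i q))) h.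
by move=> /(_ p isT)/eqP; rewrite sqrf_eq0 normr_eq0 => /eqP.
Qed.

Lemma row_eq_neq0 A : A != 0 -> exists v : 'rV[K]_N.+1, v *m A != 0.
Proof.
move=> A0; have [i Ai] : exists i, row i A != 0.
  apply/existsP; apply: contraR A0; rewrite negb_exists => /forallP h.
  apply/eqP/row_matrixP => i; rewrite row0; apply/eqP; rewrite -[_ == _]negbK.
  exact: h.
by exists (delta_mx 0 i); rewrite -rowE.
Qed.

Lemma powers_free_poly A r p :
  row_free (powers_mx A r) -> (size p <= r)%N -> horner_mx A p = 0 -> p = 0.
Proof.
move=> fr pr; have <- : rVpoly (poly_rV p : 'rV_r) = p by rewrite poly_rV_K.
rewrite horner_rVpoly => /(congr1 mxvec); rewrite vec_mxK raddf0 => h.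
have -> : poly_rV p = 0 :> 'rV_r by apply: (row_free_inj fr); rewrite /= mul0mx.
by rewrite raddf0.
Qed.

Lemma powers_not_free_poly A r : ~~ row_free (powers_mx A r) ->
  exists p, [/\ p != 0, (size p <= r)%N & horner_mx A p = 0].
Proof.
rewrite -kermx_eq0 => /rowV0Pn[u /sub_kermxP uA u0].
exists (rVpoly u); split; last by rewrite horner_rVpoly uA raddf0.
  by apply: contra u0 => /eqP h; rewrite -(rVpolyK u) h raddf0.
by rewrite size_poly.
Qed.

Lemma horner_mx_eigen A p (v : 'rV[K]_N.+1) a :
  v *m A = a *: v -> v *m horner_mx A p = p.[a] *: v.
Proof.
move=> vA; elim/poly_ind: p => [|p c IH].
  by rewrite rmorph0 mulmx0 horner0 scale0r.
rewrite rmorphD rmorphM /= horner_mx_X horner_mx_C hornerMXaddC mulmxDr.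
by rewrite -mulmxE mulmxA IH -scalemxAl vA scalerA mul_mx_scalar scalerDl.
Qed.

Lemma eigen_size A p (s : seq K) : uniq s ->
  (forall a, a \in s -> exists2 v : 'rV[K]_N.+1, v != 0 & v *m A = a *: v) ->
  p != 0 -> horner_mx A p = 0 -> (size s < size p)%N.
Proof.
move=> us sA p0 pA; apply: max_poly_roots => //.
apply/allP => a /sA[v v0 vA]; have := horner_mx_eigen p vA.
rewrite pA mulmx0 => /esym/eqP; rewrite scaler_eq0 (negPf v0) orbF.
by rewrite rootE.
Qed.

(** The last clause, that each [Q a] is a polynomial in [A], places the projections in every star
    algebra containing [A], and lets a derivation that kills [A] kill them too. *)
Definition spectral_family A (s : seq K) (Q : K -> 'M[K]_N.+1) : Prop :=
  [/\ uniq s,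
      forall a, a \in s -> [/\ a \is Num.real, Q a != 0, (Q a) ^t* = Q a,
         Q a *m Q a = Q a & Q a *m A = a *: Q a],
      forall a b, a \in s -> b \in s -> a != b -> Q a *m Q b = 0,
      \sum_(a <- s) Q a = 1%:M
    & horner_mx A (\prod_(a <- s) ('X - a%:P)) = 0]
  /\ forall a, a \in s -> exists p, Q a = horner_mx A p.

Lemma spectral_projections A : A ^t* = A -> exists s Q, spectral_family A s Q.
Proof.
move=> Ah; have Ah' : A \is hermsymmx.
  by apply/is_hermitianmxP; rewrite expr0 scale1r Ah.
have real := hermitian_spectral_diag_real Ah'.
have /hermitian_normalmx/orthomx_spectralP := Ah'.
have := spectral_unitarymx A; set W := spectralmx A; set D := spectral_diag A in real *.
move=> Wu AE; have Wi := unitarymx_unit Wu.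
have WV : invmx W = W ^t* by rewrite invmx_unitary.
pose s := undup [seq D 0 i | i <- enum 'I_N.+1].
have Ds i : D 0 i \in s by rewrite mem_undup; apply/mapP; exists i => //; rewrite mem_enum.
have sP a : a \in s -> exists i, a = D 0 i.
  by rewrite mem_undup => /mapP[i _ ->]; exists i.
pose E a : 'rV[K]_N.+1 := \row_i (D 0 i == a)%:R.
pose Q a := invmx W *m diag_mx (E a) *m W.
have QM (u v : 'rV[K]_N.+1) : (invmx W *m diag_mx u *m W) *m (invmx W *m diag_mx v *m W) =
    invmx W *m diag_mx (\row_i (u 0 i * v 0 i)) *m W.
  by rewrite -!mulmxA (mulmxA W) mulmxV // mul1mx !mulmxA -[_ *m diag_mx u *m _]mulmxA
    mulmx_diag.
have hor p : horner_mx A p = invmx W *m diag_mx (map_mx (horner p) D) *m W.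
  by rewrite AE horner_mx_uconjC // horner_mx_diag.
exists s, Q; split; first split.
- exact: undup_uniq.
- move=> a aS; have [i ai] := sP a aS; split.
  + by rewrite ai; exact: (mxOverP real).
  + apply/eqP => Q0; have : W *m Q a *m invmx W = 0 by rewrite Q0 mulmx0 mul0mx.
    rewrite /Q !mulmxA mulmxV // mul1mx -mulmxA mulmxV // mulmx1.
    move=> /matrixP/(_ i i); rewrite !mxE ai !eqxx mulr1n => /eqP.
    by rewrite oner_eq0.
  + rewrite /Q WV !adjmxM trmxCK mulmxA; congr (_ *m _ *m _).
    apply/matrixP => p q; rewrite !mxE rmorphMn /=.
    rewrite [q == p]eq_sym; case: (p =P q) => [->|_]; last by rewrite !mulr0n.
    by rewrite !mulr1n; case: eqP; rewrite ?rmorph1 ?rmorph0.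
  + rewrite /Q QM; congr (_ *m diag_mx _ *m _); apply/rowP => p; rewrite !mxE.
    by case: eqP; rewrite ?mul1r ?mul0r.
  + rewrite {1}AE /Q QM scalemxAl scalemxAr; congr (_ *m _ *m _).
    apply/matrixP => p q; rewrite !mxE mulrnAr; congr (_ *+ _).
    by case: eqP => [->|]; rewrite ?mul1r ?mulr1 ?mul0r ?mulr0.
- move=> a b aS bS ab; rewrite /Q QM.
  have -> : (\row_i (E a 0 i * E b 0 i) : 'rV[K]_N.+1) = 0.
    apply/rowP => p; rewrite !mxE; case: eqP => [->|]; last by rewrite mul0r.
    by rewrite (negPf ab) mulr0.
  by rewrite raddf0 mulmx0 mul0mx.
- rewrite /Q -mulmx_suml -mulmx_sumr -raddf_sum /=.
  have -> : \sum_(a <- s) E a = const_mx 1.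
    apply/rowP => p; rewrite summxE mxE.
    rewrite (bigD1_seq (D 0 p)) ?undup_uniq //= big1 => [|a ap]; last first.
      by rewrite mxE eq_sym (negPf ap).
    by rewrite mxE eqxx addr0.
  by rewrite diag_const_mx mulmx1 mulVmx.
- rewrite hor.
  have -> : map_mx (horner (\prod_(a <- s) ('X - a%:P))) D = 0.
    apply/rowP => p; rewrite !mxE; apply/eqP; rewrite -rootE.
    by rewrite root_prod_XsubC.
  by rewrite raddf0 mulmx0 mul0mx.
(* Lagrange interpolation: this polynomial is 1 at [a] and 0 at the other eigenvalues. *)
- move=> a aS; exists (\prod_(b <- s | b != a) ((a - b)^-1 *: ('X - b%:P))).
  rewrite hor /Q; congr (_ *m diag_mx _ *m _); apply/rowP => p.
  rewrite !mxE horner_prod; case: eqP => [->|/eqP pa].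
    rewrite big1 // => b ba; rewrite hornerZ hornerXsubC mulVf //.
    by rewrite subr_eq0 eq_sym.
  rewrite (big_rem (D 0 p)) //= pa hornerZ hornerXsubC subrr mulr0 mul0r //.
Qed.

Lemma spectral_size A s Q r : spectral_family A s Q ->
  row_free (powers_mx A r) -> (r <= size s)%N.
Proof.
move=> [[_ _ _ _ pA] _] fr; rewrite leqNgt; apply/negP => sr.
have := powers_free_poly fr _ pA.
by rewrite size_prod_XsubC => /(_ sr)/eqP; rewrite (negPf (monic_neq0 (monic_prod_XsubC _ _ _))).
Qed.

Lemma avoid_finite (s : seq K) : exists2 c : K, c \is Num.real & c \notin s.
Proof.
have : ~~ all (mem s) [seq (i%:R : K) | i <- iota 0 (size s).+1].
  apply/negP => /allP h.
  have : (size [seq (i%:R : K) | i <- iota 0 (size s).+1] <= size s)%N.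
    apply: uniq_leq_size => //; rewrite map_inj_uniq ?iota_uniq // => i j /eqP.
    by rewrite eqr_nat => /eqP.
  by rewrite size_map size_iota ltnn.
rewrite -has_predC => /hasP[c /mapP[i _ ci] cs]; exists c => //.
by rewrite ci realn.
Qed.

(* If the corner were not scalar, it would have two eigenvalues on the range of
   [Q a]; shifting the rest of [S] away from them would give a self-adjoint
   element of [P] with more than [r] eigenvalues. *)
Lemma corner_hermitian P S s Q r A a : star_algebra P -> P S ->
  spectral_family S s Q -> (r <= size s)%N ->
  (forall B, P B -> B ^t* = B -> exists p, [/\ p != 0, (size p <= r.+1)%N & horner_mx B p = 0]) ->
  P A -> A ^t* = A -> a \in s -> exists c, Q a *m A *m Q a = c *: Q a.
Proof.
move=> sP PS [[us Qs oQ sumQ _] Qp] rs bound PA Ah aS.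
have [areal Qa0 Qah Qaa QaS] := Qs a aS.
set B := Q a *m A *m Q a.
have PQ b : b \in s -> P (Q b) by move=> /Qp[p ->]; exact: staralg_horner.
have PB : P B by do 2?apply: staralg_mul => //; exact: PQ.
have Bh : B ^t* = B by rewrite /B !adjmxM Qah Ah mulmxA.
have BQ : B *m Q a = B by rewrite /B -mulmxA Qaa.
have QB : Q a *m B = B by rewrite /B !mulmxA Qaa.
have [s' [Q' [[us' Qs' oQ' sumQ' _] Qp']]] := spectral_projections Bh.
have BS b : b \in s -> S *m Q b = b *: Q b.
  move=> bS; have [/CrealP bR _ Qbh _ QbS] := Qs b bS.
  have [p QbE] := Qp b bS.
  rewrite -QbS QbE; exact: (comm_mx_horner p (comm_mx_refl S)).
(* [T] lists the eigenvalues of [B] that occur on the range of [Q a]. None would give [Q a = 0],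
   exactly one makes [B] a multiple of [Q a], and two have to be excluded. *)
pose T := [seq b <- s' | Q' b *m Q a != 0].
have sumT : \sum_(b <- s') Q' b *m Q a = Q a by rewrite -mulmx_suml sumQ' mul1mx.
have BE : B = \sum_(b <- s') b *: (Q' b *m Q a).
  rewrite -[LHS]BQ -{1}[B]mul1mx -sumQ' mulmx_suml mulmx_suml.
  apply: eq_big_seq => b bs; have [_ _ _ _ ->] := Qs' b bs.
  by rewrite -scalemxAl.
case ET: T => [|b [|b' T']].
- exfalso; move: Qa0; rewrite -[X in X != 0]sumT big_seq big1 ?eqxx // => b bs.
  apply/eqP; apply: contraT => h.
  by have : b \in T; [rewrite mem_filter h|rewrite ET].
- exists b; rewrite BE -[X in b *: X]sumT scaler_sumr; apply: eq_big_seq => d ds.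
  have [->//|db] := eqVneq d b.
  suff /eqP -> : Q' d *m Q a == 0 by rewrite !scaler0.
  by apply: contraT => h; have : d \in T; [rewrite mem_filter h|rewrite ET inE (negPf db)].
exfalso.
have uT : uniq T by rewrite filter_uniq.
have bT : b \in T by rewrite ET mem_head.
have b'T : b' \in T by rewrite ET inE mem_head orbT.
have bb' : b != b' by move: uT; rewrite ET /= inE negb_or => /andP[/andP[]].
(* The shift [c] keeps every [d + c], with [d] an eigenvalue of [S], away from [b] and [b']. *)
have [c creal cN] := avoid_finite ([seq b - d | d <- s] ++ [seq b' - d | d <- s]).
pose A' := B + (S + c%:M) *m (1%:M - Q a).
have Sh : S ^t* = S.
  have -> : S = \sum_(d <- s) d *: Q d.
    rewrite -{1}[S]mul1mx -sumQ mulmx_suml; apply: eq_big_seq => d ds.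
    by have [] := Qs d ds.
  rewrite adjmx_sum; apply: eq_big_seq => d ds.
  have [/CrealP dR _ Qdh _ _] := Qs d ds.
  by rewrite /= adjmxZ dR Qdh.
have comm : (S + c%:M) *m (1%:M - Q a) = (1%:M - Q a) *m (S + c%:M).
  rewrite mulmxBr mulmxBl mulmx1 mul1mx; congr (_ - _).
  by rewrite mulmxDl mulmxDr BS // QaS mul_scalar_mx mul_mx_scalar.
have A'h : A' ^t* = A'.
  rewrite /A' adjmxD Bh adjmxM comm; congr (_ + _ *m _).
    by rewrite adjmxB adjmxC rmorph1 Qah.
  by rewrite adjmxD Sh adjmxC (CrealP creal).
have PA' : P A'.
  apply: staralg_add => //; apply: staralg_mul => //.
    by apply: staralg_add => //; exact: staralg_cst.
  by apply: staralg_sub => //; [exact: staralg_cst|exact: PQ].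
have [p [p0 szp pA']] := bound _ PA' A'h.
pose s2 := [seq d + c | d <- rem a s].
have s2P x : x \in s2 -> exists2 d, d \in s /\ d != a & x = d + c.
  move=> /mapP[d]; rewrite mem_rem_uniq // inE => /andP[da ds] ->.
  by exists d.
have s2N x : x \in T -> (x == b) || (x == b') -> x \notin s2.
  move=> xT xb; apply/negP => /s2P[d [ds _] xE]; move: cN.
  have cE : c = x - d by rewrite xE addrC addKr.
  rewrite mem_cat; case/orP: xb => /eqP <-; rewrite cE.
    by rewrite (map_f (fun d => x - d) ds).
  by rewrite (map_f (fun d => x - d) ds) orbT.
have us2 : uniq [:: b, b' & s2].
  rewrite /= inE negb_or bb' !s2N ?eqxx ?orbT //=.
  rewrite map_inj_uniq ?rem_uniq // => x y; exact: addIr.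
have eigT x : x \in T -> exists2 v : 'rV[K]_N.+1, v != 0 & v *m A' = x *: v.
  rewrite mem_filter => /andP[/row_eq_neq0[u u0] xs'].
  exists (u *m (Q' x *m Q a)) => //.
  have [_ _ _ _ Q'B] := Qs' x xs'.
  rewrite /A' mulmxDr comm.
  have -> : u *m (Q' x *m Q a) *m ((1%:M - Q a) *m (S + c%:M)) = 0.
    by rewrite !mulmxA mulmxBr mulmx1 -[_ *m Q a *m Q a]mulmxA Qaa subrr mul0mx.
  rewrite addr0 -!mulmxA QB -BQ (mulmxA (Q' x)) Q'B.
  by rewrite -scalemxAl -scalemxAr.
have eig2 x : x \in s2 -> exists2 v : 'rV[K]_N.+1, v != 0 & v *m A' = x *: v.
  move=> /s2P[d [ds da] ->]; have [_ /row_eq_neq0[u u0] _ Qdd QdS] := Qs d ds.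
  exists (u *m Q d) => //.
  have QdQa : Q d *m Q a = 0 by exact: oQ.
  rewrite /A' mulmxDr -[X in X + _]mulmxA /B (mulmxA (Q d)) (mulmxA (Q d)) QdQa !mul0mx mulmx0 add0r.
  rewrite (mulmxA (u *m Q d)) -(mulmxA u) [Q d *m (S + _)]mulmxDr QdS mul_mx_scalar -scalerDl.
  rewrite -scalemxAr -scalemxAl mulmxBr mulmx1 -mulmxA QdQa mulmx0 subr0 //.
(* [A'] has the eigenvalues [b], [b'] and the shifted eigenvalues of [S] other than [a], so
   [size s + 1] of them, while a polynomial of size at most [r.+1] has at most [r] roots. *)
have := eigen_size us2 _ p0 pA'; rewrite /= size_map size_rem // => /(_ _).
rewrite prednK; last by case: (s) aS.
move=> h; have {h} : ((size s).+1 < size p)%N.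
  apply: h => x; rewrite !inE => /or3P[/eqP ->|/eqP ->|]; [exact: eigT|exact: eigT|exact: eig2].
move=> /leq_trans/(_ szp); rewrite ltnS => /leq_trans/(_ rs).
by rewrite ltnn.
Qed.

(** The hermitian case applies to [A1] and [A2], twice the real part and minus twice the imaginary
    part of [A]. *)
Lemma corner_scalar P S s Q r A a : star_algebra P -> P S ->
  spectral_family S s Q -> (r <= size s)%N ->
  (forall B, P B -> B ^t* = B -> exists p, [/\ p != 0, (size p <= r.+1)%N & horner_mx B p = 0]) ->
  P A -> a \in s -> exists c, Q a *m A *m Q a = c *: Q a.
Proof.
move=> sP PS SQ rs bound PA aS.
pose A1 := A + A ^t*; pose A2 := 'i *: (A - A ^t*).
have PAs : P (A ^t*) by exact: staralg_adj.
have [c1 h1] : exists c, Q a *m A1 *m Q a = c *: Q a.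
  apply: (corner_hermitian sP PS SQ rs bound) => //; first exact: staralg_add.
  by rewrite /A1 adjmxD trmxCK addrC.
have [c2 h2] : exists c, Q a *m A2 *m Q a = c *: Q a.
  apply: (corner_hermitian sP PS SQ rs bound) => //.
    by apply: staralg_scale => //; exact: staralg_sub.
  rewrite /A2 adjmxZ conjCi adjmxB trmxCK.
  by rewrite scaleNr -scalerN opprB.
exists (2^-1 * (c1 - 'i * c2)).
have -> : A = 2^-1 *: (A1 - 'i *: A2).
  rewrite /A1 /A2 scalerA -expr2 sqrCi scaleN1r opprK.
  rewrite addrACA subrr addr0 -[A + A]mulr2n -[A *+ 2]scaler_nat scalerA mulVf ?scale1r ?pnatr_eq0 //.
rewrite -scalemxAr -scalemxAl mulmxBr mulmxBl -scalemxAr -scalemxAl h1 h2.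
by rewrite scalerA -scalerBl scalerA.
Qed.

End StarAlgebras.

(** * The derivation modulo the intermediate algebra *)

Section Derivation.
Context {K : numClosedFieldType} {m N : nat}.
Local Notation letter := (multi_index m * multi_index m)%type.
Implicit Types (V : letter -> 'M[K]_N.+1) (e : expr K m) (j : 'I_m).

Definition algebra_of V (P : pred letter) : set 'M[K]_N.+1 :=
  [set A | exists2 e, letters_in P e & ev V e = A].

Lemma algebra_of_star V (P : pred letter) :
  (forall l, V (l.2, l.1) = (V l)^t*) -> (forall l, P l -> P (l.2, l.1)) ->
  star_algebra (algebra_of V P).
Proof.
move=> Vs Ps; split=> [c|_ _ [e Pe <-] [f Pf <-]|_ _ [e Pe <-] [f Pf <-]|_ [e Pe <-]].
- by exists (Cst c).
- by exists (Add e f); rewrite //= Pe.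
- by exists (Mul e f); rewrite //= Pe.
- by exists (adj_expr e); [exact: letters_in_adj|exact: ev_adj_expr].
Qed.

Lemma algebra_ofW V (P P' : pred letter) A :
  subpred P P' -> algebra_of V P A -> algebra_of V P' A.
Proof. by move=> PP' [e Pe <-]; exists e => //; exact: letters_inW Pe. Qed.

Definition box k : pred letter := [pred l | (mdeg l.1 <= k)%N && (mdeg l.2 <= k)%N].

(** This set contains [box k] and all letters in the derivatives of its letters, and it is
    symmetric, so it generates a star algebra between those of [box k] and [box k.+1]. *)
Definition notched_box k : pred letter :=
  [pred l | box k.+1 l && ((mdeg l.1 <= k)%N || (mdeg l.2 <= k)%N)].

Lemma box_sym k l : box k l -> box k (l.2, l.1).
Proof. by rewrite /box /= andbC. Qed.

Lemma notched_box_sym k l : notched_box k l -> notched_box k (l.2, l.1).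
Proof. by case/andP=> /box_sym h; rewrite orbC => h'; apply/andP. Qed.

Lemma box_notched k : subpred (box k) (notched_box k).
Proof. by move=> l /andP[h1 h2]; rewrite /notched_box /box /= !leqW // h1. Qed.

Lemma notched_boxS k : subpred (notched_box k) (box k.+1).
Proof. by move=> l /andP[]. Qed.

Lemma boxS k : subpred (box k) (box k.+1).
Proof. by move=> l /box_notched/notched_boxS. Qed.

Lemma box_leq k k' : (k <= k')%N -> subpred (box k) (box k').
Proof. by move=> kk l /andP[h1 h2]; rewrite /box /= !(leq_trans _ kk). Qed.

Lemma letters_in_dletter (P : pred letter) j I J : P (madd I (mone j), J) ->
  (forall A, mle A J -> A != midx0 -> P (mone j, A) && P (I, msub J A)) ->
  letters_in P (dletter j (I, J) : expr K m).
Proof.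
move=> h1 h2 /=; rewrite h1 /=; apply: letters_in_sum => A.
by rewrite mem_mbelow => /andP[AJ A0]; exact: h2.
Qed.

Lemma letters_in_dletter_box k j l : box k l -> letters_in (notched_box k) (dletter j l : expr K m).
Proof.
case: l => I J /andP[/= Ik Jk]; apply: letters_in_dletter => [|A AJ A0]; rewrite /notched_box /box /=.
  by rewrite mdegD mdeg1 addn1 ltnS Ik leqW // Jk orbT.
have Ak := leq_trans (mle_deg AJ) Jk.
have Sk : (mdeg (msub J A) <= k)%N := leq_trans (mdeg_msub _ _) Jk.
by rewrite mdeg1 Ak (leqW Ak) (leqW Ik) Ik (leqW Sk) orbT.
Qed.

Lemma letters_in_dletter_notched k j l : notched_box k l -> (mdeg l.1 <= k)%N ->
  letters_in (box k.+1) (dletter j l : expr K m).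
Proof.
case: l => I J /andP[/andP[/= _ Jk] _] Ik; apply: letters_in_dletter => [|A AJ A0]; rewrite /notched_box /box /=.
  by rewrite mdegD mdeg1 addn1 ltnS Ik.
have Sk : (mdeg (msub J A) <= k.+1)%N := leq_trans (mdeg_msub _ _) Jk.
by rewrite mdeg1 (leq_trans (mle_deg AJ) Jk) (leqW Ik) Sk.
Qed.

Section Kill.
Variables (V : letter -> 'M[K]_N.+1) (k : nat) (j : 'I_m).
Variables (S : 'M[K]_N.+1) (s : seq K) (Q : K -> 'M[K]_N.+1).
Hypothesis Vstar : forall l, V (l.2, l.1) = (V l)^t*.
Hypothesis AS : algebra_of V (box k) S.
Hypothesis SQ : spectral_family S s Q.
Hypothesis corner : forall A a, algebra_of V (box k.+1) A -> a \in s ->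
  exists c, Q a *m A *m Q a = c *: Q a.
Let B := algebra_of V (notched_box k).
Hypothesis wd : forall e, letters_in (notched_box k) e -> ev V e = 0 -> B (ev V (dexpr j e)).

Let sB : star_algebra B.
Proof. by apply: algebra_of_star => // l; exact: notched_box_sym. Qed.

Let sA : star_algebra (algebra_of V (box k.+1)).
Proof. by apply: algebra_of_star => // l; exact: box_sym. Qed.

Let BA A : B A -> algebra_of V (box k.+1) A.
Proof. exact/algebra_ofW/notched_boxS. Qed.

(* [A] is killed by the derivation that [dexpr j] induces modulo [B]. *)
Let killed (A : 'M[K]_N.+1) := exists e,
  [/\ letters_in (notched_box k) e, ev V e = A & B (ev V (dexpr j e))].

Let killedB A : killed A -> B A.
Proof. by move=> [e [he <- _]]; exists e. Qed.

(** By [wd], two words with the same value have derivatives that differ by an element of [B]; being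
    killed is thus a property of the value. *)
Let killed_any e : letters_in (notched_box k) e -> killed (ev V e) -> B (ev V (dexpr j e)).
Proof.
move=> he [f [hf fe Bf]].
have /wd : letters_in (notched_box k) (Add e (Mul (Cst (-1)) f)) by rewrite /= he hf.
rewrite /= raddf0 mul0mx add0r !mul_scalar_mx !scaleN1r fe subrr => /(_ erefl) h.
by have := staralg_add sB h Bf; rewrite subrK.
Qed.

Let killed_add A A' : killed A -> killed A' -> killed (A + A').
Proof.
move=> [e [he <- Be]] [f [hf <- Bf]]; exists (Add e f); split=> //=.
  by rewrite he.
exact: staralg_add.
Qed.

Let killed_mul A A' : killed A -> killed A' -> killed (A *m A').
Proof.
move=> [e [he <- Be]] [f [hf <- Bf]]; exists (Mul e f); split=> //=.
  by rewrite he.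
by apply: staralg_add => //; apply: staralg_mul => //; [exists f|exists e].
Qed.

Let killed_cst c : killed c%:M.
Proof. by exists (Cst c); split=> //; exists (Cst 0). Qed.

Let killed_scale c A : killed A -> killed (c *: A).
Proof. by move=> h; rewrite -mul_scalar_mx; exact: killed_mul. Qed.

Let killed0 : killed 0.
Proof. by rewrite -(raddf0 (@scalar_mx K N.+1)); exact: killed_cst. Qed.

Let killed_box e : letters_in (box k) e -> killed (ev V e).
Proof.
move=> he; exists e; split=> //; first exact: (letters_inW (@box_notched k)).
eexists; last reflexivity.
by apply: letters_in_dexpr he; [exact: box_notched|exact: letters_in_dletter_box].
Qed.

Let killed_horner A p : killed A -> killed (horner_mx A p).
Proof.
move=> kA; elim/poly_ind: p => [|p c IH]; first by rewrite rmorph0.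
rewrite rmorphD rmorphM /= horner_mx_X horner_mx_C.
by apply: killed_add => //; exact: killed_mul.
Qed.

(** [S] is a word in [box k], whose derivatives are words in [notched_box k], and [Q a] is a
    polynomial in [S]. *)
Let killedQ a : a \in s -> killed (Q a).
Proof.
case: SQ => _ Qp /Qp[p ->]; apply: killed_horner.
by case: AS => e he <-; exact: killed_box.
Qed.

Let decompose A : A = \sum_(a <- s) \sum_(b <- s) Q a *m A *m Q b.
Proof.
case: SQ => [[_ _ _ sQ _] _].
under eq_bigr do rewrite -mulmx_sumr sQ mulmx1.
by rewrite -mulmx_suml sQ mul1mx.
Qed.

(* For a letter in the domain the derivative lies in the next algebra, whose
   off-diagonal corners are spanned by any of their nonzero elements. *)
Let killed_corner l a b : notched_box k l -> (mdeg l.1 <= k)%N -> a \in s -> b \in s ->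
  killed (Q a *m V l *m Q b).
Proof.
move=> hl l1 aS bS; set A := Q a *m V l *m Q b.
have [->//|A0] := eqVneq A 0.
have [_ Qs _ _ _] := SQ.1.
have [_ Qa0 Qah Qaa _] := Qs a aS; have [_ Qb0 Qbh Qbb _] := Qs b bS.
have [ea [hea Ea Da]] := killedQ aS; have [eb [heb Eb Db]] := killedQ bS.
have BV : B (V l) by exists (Letter l).
have BA' : B A by apply: staralg_mul => //; [apply: staralg_mul => //|];
  exact/killedB/killedQ.
exists (Mul (Mul ea (Letter l)) eb); split; first by rewrite /= hea heb andbT.
  by rewrite /= Ea Eb.
rewrite [dexpr _ _]/= [ev _ _]/= Ea Eb mulmxDl.
apply: staralg_add => //; last first.
  apply: staralg_mul => //; apply: staralg_mul => //; exact/killedB/killedQ.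
apply: staralg_add => //.
  apply: staralg_mul => //; last exact/killedB/killedQ.
  by apply: staralg_mul.
set D := ev V (dletter j l).
have AD : algebra_of V (box k.+1) D.
  by exists (dletter j l) => //; exact: letters_in_dletter_notched.
have AQ c : c \in s -> algebra_of V (box k.+1) (Q c) by move=> cS; exact/BA/killedB/killedQ.
have [c Ec] : exists c, Q b *m (A ^t* *m A) *m Q b = c *: Q b.
  by apply: corner => //; apply/BA/(staralg_mul sB) => //; exact: (staralg_adj sB).
have AQb : A *m Q b = A by rewrite /A -mulmxA Qbb.
have QbA : Q b *m A ^t* = A ^t* by rewrite -{1}Qbh -adjmxM AQb.
rewrite mulmxA QbA -mulmxA AQb in Ec.
have c0 : c != 0.
  by apply: contra A0 => /eqP c0; apply/eqP/adjmx_mul_eq0; rewrite Ec c0 scale0r.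
have [d Ed] : exists d, Q a *m (D *m A ^t*) *m Q a = d *: Q a.
  by apply: corner => //; apply: (staralg_mul sA) => //; apply/(staralg_adj sA)/BA.
have QaA : Q a *m A = A by rewrite /A !mulmxA Qaa.
have -> : Q a *m D *m Q b = (c^-1 * d) *: A.
  apply: (scalerI c0); rewrite scalerA mulrA mulfV // mul1r scalemxAr -Ec.
  by rewrite -[in RHS]QaA [RHS]scalemxAl -Ed -!mulmxA QaA.
exact: staralg_scale.
Qed.

(** [A *m A ^t*] is a multiple of [Q a], hence killed, and [A] is killed; the product rule then puts
    [A] times the derivative of [A ^t*] in [B]. Multiplication by [A ^t*] on the left, where
    [A ^t* *m A] is a nonzero multiple of [Q b], leaves [Q b] times that derivative. This is enough
    because [A ^t* = Q b *m A ^t*] and [Q b] is killed. *)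
Let killed_corner_adj A a b : A = Q a *m A -> A = A *m Q b -> a \in s -> b \in s ->
  killed A -> killed (A ^t*).
Proof.
move=> QaA AQb aS bS kA.
have [->|A0] := eqVneq A 0; first by rewrite adjmx0.
have [_ Qs _ _ _] := SQ.1.
have [_ Qa0 Qah Qaa _] := Qs a aS; have [_ Qb0 Qbh Qbb _] := Qs b bS.
have BA' := killedB kA; have BAs : B (A ^t*) by exact: (staralg_adj sB).
have QbA : Q b *m A ^t* = A ^t* by rewrite -{1}Qbh -adjmxM -AQb.
have AQa : A ^t* *m Q a = A ^t* by rewrite -{1}Qah -adjmxM -QaA.
have [c Ec] : exists c, Q b *m (A ^t* *m A) *m Q b = c *: Q b.
  by apply: corner => //; apply/BA/(staralg_mul sB).
have [d Ed] : exists d, Q a *m (A *m A ^t*) *m Q a = d *: Q a.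
  by apply: corner => //; apply/BA/(staralg_mul sB).
rewrite mulmxA QbA -mulmxA -AQb in Ec.
rewrite mulmxA -QaA -mulmxA AQa in Ed.
have c0 : c != 0.
  by apply: contra A0 => /eqP c0; apply/eqP/adjmx_mul_eq0; rewrite Ec c0 scale0r.
have [e [he Ee De]] := kA; have [f hf Ef] := BAs.
have [g [hg Eg Dg]] := killedQ bS.
have h1 : B (ev V (dexpr j (Mul e f))).
  apply: killed_any; first by rewrite /= he.
  by rewrite /= Ee Ef Ed; apply: killed_scale; exact: killedQ.
have h2 : B (A *m ev V (dexpr j f)).
  have : B (ev V (dexpr j (Mul e f)) - ev V (dexpr j e) *m A ^t*).
    by apply: staralg_sub => //; exact: staralg_mul.
  by rewrite [ev _ _]/= Ee Ef addrC addKr.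
have h3 : B (Q b *m ev V (dexpr j f)).
  have -> : Q b = c^-1 *: (A ^t* *m A) by rewrite Ec scalerA mulVf // scale1r.
  by rewrite -scalemxAl -mulmxA; apply: staralg_scale => //; exact: staralg_mul.
exists (Mul g f); split; first by rewrite /= hg.
  by rewrite /= Eg Ef.
rewrite [dexpr _ _]/= [ev _ _]/= Eg Ef; apply: staralg_add => //.
exact: staralg_mul.
Qed.

(** The projections cut a letter into corners. If its first degree is at most [k], each corner is
    killed directly; otherwise its adjoint is such a letter, and [killed_corner_adj] passes back. *)
Lemma dexpr_notched e : letters_in (notched_box k) e -> B (ev V (dexpr j e)).
Proof.
have Qaa a : a \in s -> Q a *m Q a = Q a by case: SQ => [[_ Qs _ _ _] _] /Qs[].
have good l : notched_box k l -> (mdeg l.1 <= k)%N -> killed (V l).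
  move=> hl l1; rewrite (decompose (V l)) big_seq.
  elim/big_rec: _ => // a x aS kx; apply: killed_add kx.
  rewrite big_seq; elim/big_rec: _ => // b y bS ky; apply: killed_add ky.
  exact: killed_corner.
suff kl e' : letters_in (notched_box k) e' -> killed (ev V e').
  by move=> he; apply: killed_any (he) _; exact: kl.
elim: e' => [c _|l /= hl|e1 IH1 e2 IH2 /andP[h1 h2]|e1 IH1 e2 IH2 /andP[h1 h2]].
- exact: killed_cst.
- have /andP[_ /orP[l1|l2]] := hl; first exact: good.
  have hl' := notched_box_sym hl.
  have -> : V l = (V (l.2, l.1)) ^t* by rewrite -Vstar; case: (l).
  rewrite (decompose (V (l.2, l.1))) adjmx_sum.
  rewrite big_seq; elim/big_rec: _ => // a x aS kx; apply: killed_add kx.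
  rewrite adjmx_sum.
  rewrite big_seq; elim/big_rec: _ => // b y bS ky; apply: killed_add ky.
  apply: (@killed_corner_adj _ a b) => //; last exact: killed_corner.
    by rewrite !mulmxA Qaa.
  by rewrite -[RHS]mulmxA Qaa.
- by apply: killed_add; [exact: IH1|exact: IH2].
- by apply: killed_mul; [exact: IH1|exact: IH2].
Qed.

End Kill.
End Derivation.

Section FreeFamilies.
Context {K : fieldType} {a b : nat}.

Lemma mul_mxvec_rows d (f : 'I_d -> 'M[K]_(a, b)) (u : 'rV[K]_d) :
  u *m (\matrix_i mxvec (f i)) = mxvec (\sum_i u 0 i *: f i).
Proof.
rewrite mulmx_sum_row linear_sum; apply: eq_bigr => i _.
by rewrite rowK linearZ.
Qed.

Lemma row_free_adjoin d (W : 'M[K]_(d, a)) (u : 'rV[K]_a) :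
  row_free W -> ~~ (u <= W)%MS -> row_free (col_mx W u).
Proof.
move=> fW uW; apply: inj_row_free => v; rewrite -(hsubmxK v) mul_row_col => h.
have r0 : rsubmx v = 0.
  apply: contraNeq uW => r0; have [c rE] : exists c, rsubmx v = c%:M.
    by exists (rsubmx v 0 0); apply/matrixP => i j; rewrite !ord1 [RHS]mxE eqxx mulr1n.
  have c0 : c != 0 by apply: contra r0 => /eqP c0; rewrite rE c0 raddf0.
  have -> : u = (- c^-1 *: lsubmx v) *m W.
    move/eqP: h; rewrite rE mul_scalar_mx addr_eq0 => /eqP h.
    by rewrite -scalemxAl h scaleNr scalerN opprK scalerA mulVf // scale1r.
  exact: submxMl.
have l0 : lsubmx v = 0.
  by apply: (row_free_inj fW); rewrite /= mul0mx -h r0 mul0mx addr0.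
by rewrite r0 l0 row_mx0.
Qed.

End FreeFamilies.

(** * Generic points and persistence of linear independence *)

Section GenericPoints.
Context {Z : topologicalType}.

(** The largest [r] attained anywhere on [O] persists near a point where it is attained, and there
    it is the maximum at every point. *)
Lemma generic_open (O : set Z) (P : Z -> nat -> Prop) (M : nat) :
  open O -> O !=set0 ->
  (forall z r, O z -> P z r -> \forall v \near z, P v r) ->
  (forall z, O z -> P z 0%N) -> (forall z r, O z -> P z r -> (r <= M)%N) ->
  exists O' r, [/\ open O', O' !=set0, O' `<=` O
    & forall z, O' z -> P z r /\ forall r', P z r' -> (r' <= r)%N].
Proof.
move=> oO [z0 Oz0] nP P0 PM.
have exP : exists r, `[< exists2 z, O z & P z r >].
  by exists 0%N; apply/asboolP; exists z0 => //; exact: P0.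
have ubP r : `[< exists2 z, O z & P z r >] -> (r <= M)%N.
  by move=> /asboolP[z Oz /PM]; exact.
case: (ex_maxnP exP ubP) => r /asboolP[z Oz Pz] rmax.
exists (O `&` (P^~ r)^°)%classic, r; split.
- exact/openI/open_interior.
- by exists z; split => //; exact: nP.
- by move=> v [].
- move=> v [Ov /interior_subset Pv]; split=> // r' Pr'.
  by apply: rmax; apply/asboolP; exists v.
Qed.

End GenericPoints.

Section NearFree.
Context {R : realType} {m N : nat}.
Local Notation C := R[i].
Local Notation space := 'rV[C^o]_m.
Local Notation letter := (multi_index m * multi_index m)%type.
Implicit Types (X : space -> letter -> 'M[C]_N.+1) (z : space) (e : expr C m).

Definition ev_rows (V : letter -> 'M[C]_N.+1) d (w : 'I_d -> expr C m) :=
  \matrix_i mxvec (ev V (w i)).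

Lemma ev_rows_lim X z Y d (w : 'I_d -> expr C m) : holomorphic_frame X z Y ->
  mx_lim (nbhs z) (fun v => ev_rows (Y v) w) (ev_rows (X z) w).
Proof.
move=> fr i j; under eq_fun do rewrite mxE; rewrite mxE.
exact: (mx_lim_mxvec (ev_frame_cvg (e := w i) fr)).
Qed.

Lemma ev_similar (V W : letter -> 'M[C]_N.+1) (S : 'M[C]_N.+1) :
  (forall l, S *m V l = W l *m S) -> forall e, S *m ev V e = ev W e *m S.
Proof.
move=> h e; apply: (ev_intertwine (P := predT)) => //.
by elim: e => //= e1 -> e2 ->.
Qed.

(** Freeness is an open condition for the family [Y], which converges at [z]. The similarity between
    [Y v] and [X v] is the same for all words, so it preserves their linear relations. *)
Lemma near_ev_free X z Y d (w : 'I_d -> expr C m) : holomorphic_frame X z Y ->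
  row_free (ev_rows (X z) w) -> \forall v \near z, row_free (ev_rows (X v) w).
Proof.
move=> fr /(near_row_free (ev_rows_lim (w := w) fr)); case: (fr) => sim _ _.
apply: filterS2 sim => v [S [Su SY]] fY; apply: inj_row_free => u.
rewrite mul_mxvec_rows => /(congr1 vec_mx); rewrite mxvecK raddf0 => h.
apply: (row_free_inj fY); rewrite /= mul0mx mul_mxvec_rows.
have -> : \sum_i u 0 i *: ev (Y v) (w i) = 0; last by rewrite raddf0.
rewrite -[LHS](mulKmx Su) mulmx_sumr -[RHS](mulmx0 _ (invmx S)); congr (_ *m _).
under eq_bigr do rewrite -scalemxAr (ev_similar SY) scalemxAl.
by rewrite -mulmx_suml h mul0mx.
Qed.

(** As [e] vanishes at [z], its difference quotients are multiples of its nearby values and lie in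
    the moving span of [w]. Freeness at [z] prevents that span from losing dimension in the limit,
    so the limit stays in it. *)
Lemma ev_der_span X z Y d (w : 'I_d -> expr C m) e j : holomorphic_frame X z Y ->
  row_free (ev_rows (X z) w) -> ev (X z) e = 0 ->
  (\forall v \near z, (mxvec (ev (X v) e) <= ev_rows (X v) w)%MS) ->
  (mxvec (ev (X z) (dexpr j e)) <= ev_rows (X z) w)%MS.
Proof.
move=> fr fX e0 sub; set W := ev_rows (X z) w.
have subY : \forall v \near z, (mxvec (ev (Y v) e) <= ev_rows (Y v) w)%MS.
  case: (fr) => sim _ _; apply: filterS2 sim sub => v [S [Su SY]] /submxP[u].
  rewrite mul_mxvec_rows => /(congr1 vec_mx); rewrite !mxvecK => h.
  apply/submxP; exists u; rewrite mul_mxvec_rows; congr mxvec.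
  rewrite -[LHS](mulKmx Su) -[RHS](mulKmx Su); congr (_ *m _).
  rewrite (ev_similar SY) h mulmx_suml mulmx_sumr; apply: eq_bigr => i _.
  by rewrite -scalemxAl -scalemxAr (ev_similar SY).
have [B hB] := ev_frame_der e j fr.
have key c : (mxvec (c *: ev (X z) (dexpr j e) + c^* *: B) <= W)%MS.
  have h1 : mx_lim ((0 : R)^') (fun t : R => ev_rows (Y (ray z j c t)) w) W.
    move=> p q; have h := ev_rows_lim (w := w) fr (i := p) (j := q).
    exact: (cvg_comp (ray z j c) (fun v => ev_rows (Y v) w p q : C^o) (@ray_cvg _ _ z j c)).
  have h2 : mx_lim ((0 : R)^') (fun t : R => mxvec (t^-1%:C%C *: ev (Y (ray z j c t)) e))
     (mxvec (c *: ev (X z) (dexpr j e) + c^* *: B)).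
    apply: mx_lim_mxvec; have := hB c; rewrite e0.
    by under eq_fun do rewrite subr0.
  apply: (mx_lim_sub h1 fX h2).
  have h3 : \forall t \near (0 : R)^', (mxvec (ev (Y (ray z j c t)) e) <=
      ev_rows (Y (ray z j c t)) w)%MS by exact: (@ray_cvg _ _ z j c _ subY).
  apply: filterS h3 => t /= ht.
  by rewrite linearZ /=; exact: scalemx_sub.
(* Two directions suffice to solve for the part linear in [c]. *)
have h1 := key 1; have h2 := key 'i.
rewrite conjC1 !scale1r in h1; rewrite conjCi scaleNr in h2.
have -> : ev (X z) (dexpr j e) = 2^-1 *: (ev (X z) (dexpr j e) + B)
   - (2^-1 * 'i) *: ('i *: ev (X z) (dexpr j e) - 'i *: B).
  rewrite -scalerBr scalerA -mulrA -expr2 sqrCi mulrN1 scaleNr opprK -scalerDr.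
  rewrite addrACA addrN addr0 -[X in _ = _ *: X]mulr2n -[X in _ = _ *: X]scaler_nat.
  by rewrite scalerA mulVf ?scale1r // pnatr_eq0.
rewrite linearB /=; apply: addmx_sub; last rewrite eqmx_opp.
  by rewrite linearZ; exact: scalemx_sub.
by rewrite linearZ; exact: scalemx_sub.
Qed.

End NearFree.

(** * Stabilization at a generic point *)

(** Without a stall, [r i > i] would hold up to [i = n], against [r n <= n]. *)
Lemma monotone_stall (r : nat -> nat) n :
  (0 < r 0%N)%N -> (r n <= n)%N -> (forall i, (i < n)%N -> (r i <= r i.+1)%N) ->
  exists2 k, (k < n)%N & r k = r k.+1.
Proof.
move=> r0 rn mono; have [//|h] := pselect (exists2 k, (k < n)%N & r k = r k.+1).
have grow i : (i <= n)%N -> (i < r i)%N.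
  elim: i => // i IH lt_in; apply: (leq_ltn_trans (IH (ltnW lt_in))).
  rewrite ltn_neqAle mono // andbT; apply/negP => /eqP e; apply: h.
  by exists i.
by have := grow n (leqnn n); rewrite ltnNge rn.
Qed.

Section Stabilization.
Context {R : realType} {m N : nat} (n : nat).
Local Notation C := R[i].
Local Notation space := 'rV[C^o]_m.
Local Notation letter := (multi_index m * multi_index m)%type.
Variables (O : set space) (X : space -> letter -> 'M[C]_N.+1).
Implicit Types (z v : space) (e f : expr C m).

Hypothesis oO : open O.
Hypothesis O_neq0 : O !=set0.
Hypothesis Xadj : forall z l, O z -> X z (l.2, l.1) = (X z l)^t*.
Hypothesis X0 : forall z J, O z -> X z (midx0, J) = (J == midx0)%:R%:M.
Hypothesis X_frame : forall z, O z -> exists Y, holomorphic_frame X z Y.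
Hypothesis X_bound : forall z e, O z -> letters_in (box n) e ->
  exists p : {poly C}, [/\ p != 0, (size p <= n.+1)%N & horner_mx (ev (X z) e) p = 0].

Let pow e i : expr C m := iter i (Mul e) (Cst 1).

Let ev_pow V e i : ev V (pow e i) = ev V e ^+ i :> 'M[C]_N.+1.
Proof. by elim: i => // i IH; rewrite exprS -IH. Qed.

(** The value of [Add e (adj_expr e)] is self-adjoint, so independence of its first [r] powers means
    at least [r] distinct eigenvalues. Put this way, the condition is visibly open in [z]. *)
Let rho k z r := exists e, letters_in (box k) e /\
  row_free (powers_mx (ev (X z) (Add e (adj_expr e))) r).

Let rho_near k z r : O z -> rho k z r -> \forall v \near z, rho k v r.
Proof.
move=> Oz [e [he fr]]; have [Y hY] := X_frame Oz.
have E v : ev_rows (X v) (fun i : 'I_r => pow (Add e (adj_expr e)) i) =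
    powers_mx (ev (X v) (Add e (adj_expr e))) r.
  by apply/row_matrixP => i; rewrite !rowK ev_pow.
by rewrite -E in fr; apply: filterS (near_ev_free hY fr) => v; rewrite E; exists e.
Qed.

Let rho_bound k z r : (k <= n)%N -> O z -> rho k z r -> (r <= n)%N.
Proof.
move=> kn Oz [e [he fr]]; rewrite leqNgt; apply/negP => nr.
have : letters_in (box n) (Add e (adj_expr e)).
  have hn := letters_inW (box_leq kn) he.
  by apply/andP; split=> //; apply: letters_in_adj hn => l; exact: box_sym.
move=> /(X_bound Oz)[p [p0 sp pA]].
by move: p0; rewrite (powers_free_poly fr (leq_trans sp nr) pA) eqxx.
Qed.

Let rho_generic k : (k <= n.+1)%N -> exists O' (r : nat -> nat),
  [/\ open O', O' !=set0, O' `<=` O & forall i z, (i < k)%N -> O' z ->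
     rho i z (r i) /\ forall r', rho i z r' -> (r' <= r i)%N].
Proof.
elim: k => [_|k IH kn]; first by exists O, (fun=> 0%N); split.
have [U1 [r [oO1 nO1 O1O h1]]] := IH (ltnW kn).
have [|||U2 [d [oO2 nO2 O2O1 h2]]] := @generic_open _ U1 (rho k) n oO1 nO1.
- by move=> z q /O1O; exact: rho_near.
- move=> z /O1O Oz; exists (Cst 0); split=> //.
  by apply: inj_row_free => u _; apply/rowP => -[].
- by move=> z q /O1O; exact: rho_bound.
exists U2, (fun i => if i == k then d else r i); split=> //.
  exact: subset_trans O2O1 O1O.
move=> i z; rewrite ltnS leq_eqVlt => /orP[/eqP ->|ik] O2z; first by rewrite eqxx; exact: h2.
by rewrite (ltn_eqF ik); apply: h1 => //; exact: O2O1.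
Qed.

Section StableOpen.
Variables (k d r : nat) (O' : set space).
Hypothesis oO' : open O'.
Hypothesis O'O : O' `<=` O.
Hypothesis rho_k : forall z, O' z -> rho k z r.
Hypothesis rho_max : forall z r', O' z -> rho k.+1 z r' -> (r' <= r)%N.
Let free_notched z d' := exists w : 'I_d' -> expr C m,
  (forall i, letters_in (notched_box k) (w i)) /\ row_free (ev_rows (X z) w).
Hypothesis free_d : forall z, O' z -> free_notched z d.
Hypothesis free_max : forall z d', O' z -> free_notched z d' -> (d' <= d)%N.

Let B z := algebra_of (X z) (notched_box k).

Let sB z : O' z -> star_algebra (B z).
Proof.
move=> O'z; apply: algebra_of_star => l.
 - exact: (Xadj l (O'O O'z)).
 - exact: notched_box_sym.
Qed.

(** A free family of maximal length spans: a value outside its span could be adjoined to give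
    [d + 1] free words. *)
Let span_B z (w : 'I_d -> expr C m) A : O' z ->
  (forall i, letters_in (notched_box k) (w i)) -> row_free (ev_rows (X z) w) ->
  (mxvec A <= ev_rows (X z) w)%MS <-> B z A.
Proof.
move=> O'z hw fw; split.
  move=> /submxP[u]; rewrite mul_mxvec_rows => /(congr1 vec_mx); rewrite !mxvecK => ->.
  apply: staralg_sum; first exact: sB.
  by move=> i; apply: staralg_scale; [exact: sB|exists (w i)].
move=> [e he <-]; apply: contraT => /(row_free_adjoin fw) fr.
suff /(free_max O'z) : free_notched z (d + 1) by rewrite addn1 ltnn.
exists (fun i : 'I_(d + 1) => match fintype.split i with inl a => w a | inr _ => e end); split.
  by move=> i; case: (fintype.split i).
rewrite (_ : ev_rows _ _ = col_mx (ev_rows (X z) w) (mxvec (ev (X z) e))) //.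
apply/row_matrixP => i; rewrite rowK; case: (fintype.splitP i) => a ia.
  have -> : i = lshift 1 a by apply: val_inj.
  by rewrite rowKu rowK.
have -> : i = rshift d a by apply: val_inj.
by rewrite rowKd; apply/rowP => b; rewrite [RHS]mxE ord1.
Qed.

(** On [O'] the dimension of [B] is constantly [d], so words that are free at [z] span [B] at all
    nearby points, as [ev_der_span] demands. *)
Let wd z e j : O' z -> (forall v, O' v -> B v (ev (X v) e)) -> ev (X z) e = 0 ->
  B z (ev (X z) (dexpr j e)).
Proof.
move=> O'z Be e0; have [w [hw fw]] := free_d O'z.
have [Y hY] := X_frame (O'O O'z).
apply/(span_B _ O'z hw fw). apply: (ev_der_span j hY) => //.
have nO : \forall v \near z, O' v by exact: open_nbhs_nbhs.
apply: filterS2 nO (near_ev_free hY fw) => v O'v fv.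
by apply/(span_B _ O'v hw fv); exact: Be.
Qed.

(** The algebra of [box k] has a self-adjoint element with at least [r] eigenvalues, and by
    [rho_max] the larger algebra of [box k.+1] has none with more than [r]; hence [corner_scalar]
    applies to the latter. *)
Let spectral_at z : O' z -> exists S s Q, [/\ algebra_of (X z) (box k) S,
  spectral_family S s Q & forall A a, algebra_of (X z) (box k.+1) A -> a \in s ->
    exists c, Q a *m A *m Q a = c *: Q a].
Proof.
move=> O'z; have [e [he fr]] := rho_k O'z.
have Xs l := Xadj l (O'O O'z).
have Sh : (ev (X z) (Add e (adj_expr e))) ^t* = ev (X z) (Add e (adj_expr e)).
  by rewrite /= ev_adj_expr // adjmxD trmxCK addrC.
have AS : algebra_of (X z) (box k) (ev (X z) (Add e (adj_expr e))).
  exists (Add e (adj_expr e)) => //=.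
  by rewrite he letters_in_adj // => l; exact: box_sym.
have [s [Q SQ]] := spectral_projections Sh.
exists (ev (X z) (Add e (adj_expr e))), s, Q; split=> // A a hA aS.
have sA : star_algebra (algebra_of (X z) (box k.+1)).
  by apply: algebra_of_star => // l; exact: box_sym.
apply: (corner_scalar sA _ SQ (spectral_size SQ fr)) => //.
  exact: (algebra_ofW (@boxS _ k) AS).
move=> _ [f hf <-] fh; apply: powers_not_free_poly; apply/negP => fr'.
suff /(rho_max O'z) : rho k.+1 z r.+1 by rewrite ltnn.
(* [rho] asks for a word plus its adjoint; half of [f] gives back the self-adjoint value of [f]. *)
pose f2 := Mul (Cst 2^-1) f.
have E : ev (X z) (Add f2 (adj_expr f2)) = ev (X z) f.
  rewrite [LHS]/= ev_adj_expr // fh mul_scalar_mx mul_mx_scalar -scalerDl.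
  have -> : (2^-1 : C)^* = 2^-1 by rewrite fmorphV rmorph_nat.
  by rewrite -[2^-1 + _]mulr2n -[_ *+ 2]mulr_natr mulVf ?pnatr_eq0 // scale1r.
by exists f2; split; [exact: hf|rewrite E].
Qed.

(** Membership is required on all of [O'], since membership at one point says nothing about the
    derivative. *)
Let everywhere e := forall v, O' v -> B v (ev (X v) e).

(** At a given point, take a word [f] in [notched_box k] with the same value as [e]. The difference
    vanishes there and stays in [B] nearby, so [wd] controls its derivative, while [dexpr_notched]
    controls that of [f]. *)
Let everywhere_dexpr e j : everywhere e -> everywhere (dexpr j e).
Proof.
move=> he z O'z; have [f hf fe] := he z O'z.
have [S [s [Q [AS SQ corner]]]] := spectral_at O'z.
have wdz g : letters_in (notched_box k) g -> ev (X z) g = 0 -> B z (ev (X z) (dexpr j g)).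
  by move=> hg; apply: wd => // v _; exists g.
have Df := dexpr_notched (fun l => Xadj l (O'O O'z)) AS SQ corner wdz hf.
have : B z (ev (X z) (dexpr j (Add e (Mul (Cst (-1)) f)))).
  apply: wd => //; last by rewrite /= mul_scalar_mx scaleN1r fe subrr.
  move=> v O'v /=; apply: (staralg_add (sB O'v)); first exact: he.
  by rewrite mul_scalar_mx; apply: (staralg_scale _ (sB O'v)); exists f.
rewrite /= raddf0 mul0mx add0r mul_scalar_mx scaleN1r => h.
by have := staralg_add (sB O'z) h Df; rewrite subrK.
Qed.

Let ev_swap I J : everywhere (Letter (I, J)) -> everywhere (Letter (J, I)).
Proof.
move=> h z O'z; rewrite /= (Xadj (I, J) (O'O O'z)).
exact: (staralg_adj (sB O'z)) (h z O'z).
Qed.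

Let letter0 J : everywhere (Letter (midx0, J)).
Proof. by move=> z O'z; rewrite /= X0; [|exact: O'O]; exists (Cst (J == midx0)%:R). Qed.

(** For [k = 0] these letters lie outside the notched box. But the algebra of [box 0] consists of
    scalars, so [Q a] is a nonzero scalar, and the corner condition says that [X z (I, J)] is itself
    a scalar. *)
Let letter11 I J : mdeg I = 1%N -> mdeg J = 1%N -> everywhere (Letter (I, J)).
Proof.
move=> I1 J1 z O'z.
have [k0|k0] := posnP k; last first.
  by exists (Letter (I, J)) => //; rewrite /= /notched_box /box /= I1 J1 k0.
have [S [s [Q [[e he eS] SQ corner]]]] := spectral_at O'z.
have cst f : letters_in (box 0) f -> exists c, ev (X z) f = c%:M.
  elim: f => [c _|[I' J'] /andP[/= I0 _]|f1 IH1 f2 IH2 /andP[/IH1[c /= ->] /IH2[c' ->]]|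
    f1 IH1 f2 IH2 /andP[/IH1[c /= ->] /IH2[c' ->]]]; first by exists c.
  - move: I0; rewrite leqn0 mdeg_eq0 => /eqP ->.
    by rewrite /= X0; [exists (J' == midx0)%:R|exact: O'O].
  - by exists (c + c'); rewrite raddfD.
  - by exists (c * c'); rewrite -scalar_mxM.
have [c Sc] : exists c, S = c%:M by rewrite -eS; apply: cst; rewrite -k0.
have [[_ Qs _ sQ _] Qp] := SQ.
have [a aS] : exists a, a \in s.
  case: (s) sQ => [|a s' _]; last by exists a; rewrite mem_head.
  rewrite big_nil => /matrixP/(_ 0 0); rewrite !mxE eqxx mulr1n => /esym/eqP.
  by rewrite oner_eq0.
have [_ Qa0 _ _ _] := Qs a aS.
have [q Qq] : exists q, Q a = q%:M.
  have [p ->] := Qp a aS; rewrite Sc; exists p.[c].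
  by rewrite -[c%:M]diag_const_mx horner_mx_diag map_const_mx diag_const_mx.
have q0 : q != 0 by apply: contra Qa0 => /eqP q0; rewrite Qq q0 raddf0.
have [|x] := corner (X z (I, J)) a _ aS.
  by exists (Letter (I, J)) => //=; rewrite /box /= I1 J1.
rewrite Qq mul_scalar_mx mul_mx_scalar scalerA scale_scalar_mx => h.
exists (Cst ((q * q)^-1 * (x * q))) => //=; rewrite -scale_scalar_mx -h scalerA.
by rewrite mulVf ?scale1r // mulf_neq0.
Qed.

(** The derivative of the letter [(I, J)] is solved for its leading term. In the sum the term
    [A = J] contains [X z (I, midx0)], which vanishes for nonzero [I]; the hypothesis covers the
    other terms. *)
Let letter_step j I J : I != midx0 -> everywhere (Letter (I, J)) ->
  (forall A, mle A J -> A != midx0 -> (mdeg A < mdeg J)%N ->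
     everywhere (Letter (mone j, A)) /\ everywhere (Letter (I, msub J A))) ->
  everywhere (Letter (madd I (mone j), J)).
Proof.
move=> I0 hIJ hA z O'z.
have := @everywhere_dexpr (Letter (I, J)) j hIJ z O'z; rewrite [dexpr _ _]/= ev_dletter => h.
have h2 : B z (\sum_(A <- mbelow J) X z (mone j, A) *m X z (I, msub J A)).
  rewrite big_seq; elim/big_rec: _ => [|A x AJ Bx].
    by rewrite -(raddf0 (@scalar_mx C N.+1)); exact: (staralg_cst (sB O'z)).
  apply: (staralg_add (sB O'z)) Bx.
  move: AJ; rewrite mem_mbelow => /andP[AJ A0].
  have [AJ'|AJ'] := ltnP (mdeg A) (mdeg J).
    by have [h1 h2] := hA A AJ A0 AJ'; apply: (staralg_mul (sB O'z)); [exact: h1|exact: h2].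
  have -> : A = J by apply: mle_deg_eq => //; apply/eqP; rewrite eqn_leq mle_deg.
  have -> : X z (I, msub J J) = 0.
    rewrite msubb (Xadj (midx0, I) (O'O O'z)) X0 ?(negPf I0); last exact: O'O.
    by rewrite raddf0 raddf0 (raddf0 (map_mx Num.conj)).
  by rewrite mulmx0 -(raddf0 (@scalar_mx C N.+1)); exact: (staralg_cst (sB O'z)).
have := staralg_add (sB O'z) h h2; rewrite subrK => h3.
have := staralg_scale (I j).+1%:R^-1 (sB O'z) h3.
by rewrite scalerA mulVf ?scale1r // pnatr_eq0.
Qed.

(** Induction on the total degree. An index of degree above one is lowered by [letter_step], on the
    second side after an adjoint. What remains are the scalar letters with a zero index and those of
    bidegree (1, 1). *)
Lemma letters_everywhere I J z : O' z -> algebra_of (X z) (notched_box k) (X z (I, J)).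
Proof.
suff h : everywhere (Letter (I, J)) by exact: h.
move: {2}(mdeg I + mdeg J)%N (leqnn (mdeg I + mdeg J)) => q.
elim: q I J => [|q IH] I J.
  by rewrite leqn0 addn_eq0 mdeg_eq0 => /andP[/eqP -> _]; exact: letter0.
move=> IJq; have [->|I0] := eqVneq I midx0; first exact: letter0.
have [->|J0] := eqVneq J midx0; first by apply: ev_swap; exact: letter0.
have I1 : (0 < mdeg I)%N by rewrite lt0n mdeg_eq0.
have J1 : (0 < mdeg J)%N by rewrite lt0n mdeg_eq0.
have step I' J' : J' != midx0 -> (1 < mdeg I')%N -> (mdeg I' + mdeg J' <= q.+1)%N ->
    everywhere (Letter (I', J')).
  move=> J'0 I'1 h; have [j Ij] : exists j, I' j != 0%N.
    by apply: mdeg_gt0P; rewrite -mdeg_eq0 -lt0n ltnW.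
  rewrite -(msubK Ij).
  have dI := mdeg_msub1 Ij.
  apply: letter_step => [||A AJ A0 AJ'].
  - by rewrite -mdeg_eq0 -lt0n -ltnS dI.
  - by apply: IH; rewrite -ltnS -addSn dI.
  split; apply: IH.
    rewrite mdeg1 add1n (leq_trans AJ') //.
    by rewrite -ltnS; apply: leq_trans h; rewrite -add1n leq_add2r ltnW.
  rewrite -ltnS -addSn dI; apply: leq_trans h; rewrite leq_add2l.
  exact: mdeg_msub.
have [I2|I2] := ltnP 1 (mdeg I); first exact: step.
have [J2|J2] := ltnP 1 (mdeg J); first by apply/ev_swap/step => //; rewrite addnC.
by apply: letter11; apply/eqP; rewrite eqn_leq ?I2 ?J2.
Qed.

End StableOpen.

Theorem stabilization : exists2 z, O z & forall l, algebra_of (X z) (box n) (X z l).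
Proof.
have [U1 [r [oO1 nO1 O1O h1]]] := rho_generic (leqnn n.+1).
have [z1 O1z1] := nO1.
(* The zeroth power, the identity matrix, is free on its own. *)
have r0 : (0 < r 0%N)%N.
  have [_] := h1 0%N z1 (ltn0Sn _) O1z1; apply.
  exists (Cst 0); split=> //; apply: inj_row_free => u.
  rewrite mulmx_sum_row big_ord1 rowK expr0 => /eqP.
  rewrite scaler_eq0 => /orP[/eqP u0|].
    by apply/rowP => i; rewrite ord1 u0 mxE.
  by rewrite mxvec_eq0 oner_eq0.
have rn : (r n <= n)%N.
  by have [/(rho_bound (leqnn n) (O1O _ O1z1))] := h1 n z1 (ltnSn _) O1z1.
have mono i : (i < n)%N -> (r i <= r i.+1)%N.
  move=> lin; have [[e [he fe]] _] := h1 i z1 (ltn_trans lin (ltnSn _)) O1z1.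
  have [_] := h1 i.+1 z1 lin O1z1; apply.
  by exists e; split=> //; apply: letters_inW he; exact: boxS.
have [k kn rk] := monotone_stall r0 rn mono.
(* The second shrinking: the dimension of the intermediate algebra becomes constant. It is bounded
   by the dimension of the matrix space. *)
pose fn z d' := exists w : 'I_d' -> expr C m,
  (forall i, letters_in (notched_box k) (w i)) /\ row_free (ev_rows (X z) w).
have [|||U2 [d [oO2 nO2 O2O1 h2]]] := @generic_open _ U1 fn (N.+1 * N.+1) oO1 nO1.
- move=> z q /O1O Oz [w [hw fw]]; have [Y hY] := X_frame Oz.
  by apply: filterS (near_ev_free hY fw) => v fv; exists w.
- move=> z _; exists (fun=> Cst 0); split=> //.
  by apply: inj_row_free => u _; apply/rowP => -[].
- move=> z q _ [w [_ /eqP fw]]; rewrite -fw; exact: rank_leq_col.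
have [z O2z] := nO2; exists z; first exact/O1O/O2O1.
(* Since [k < n], the notched box is contained in [box n]. *)
move=> [I J]; apply: (algebra_ofW (P := notched_box k)).
  by move=> l /notched_boxS; exact: box_leq.
apply: (@letters_everywhere k d (r k) U2) => //.
- exact: subset_trans O2O1 O1O.
- by move=> v /O2O1 O1v; have [] := h1 k v (leqW kn) O1v.
- by move=> v r' /O2O1 O1v; rewrite rk; have [_] := h1 k.+1 v kn O1v; apply.
- by move=> v O2v; have [] := h2 v O2v.
- by move=> v d' O2v hd; have [_] := h2 v O2v; apply.
Qed.

End Stabilization.

(** * Two families side by side *)

Section BlockDiagonal.
Context {K : numClosedFieldType} {N : nat}.
Implicit Types A B S : 'M[K]_N.+1.

Lemma block_diagB A B A' B' :
  block_diag A B - block_diag A' B' = block_diag (A - A') (B - B').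
Proof.
have -> : - block_diag A' B' = block_diag (- A') (- B').
  by apply: (etrans (@opp_block_mx K N.+1 N.+1 N.+1 N.+1 A' 0 0 B')); rewrite !oppr0.
exact: block_diagD.
Qed.

Lemma block_diagZ c A B : c *: block_diag A B = block_diag (c *: A) (c *: B).
Proof.
by apply: (etrans (@scale_block_mx K N.+1 N.+1 N.+1 N.+1 c A 0 0 B)); rewrite !scaler0.
Qed.

Lemma block_diagC (c : K) : block_diag c%:M c%:M = c%:M :> 'M[K]_((N + N.+1).+1).
Proof. by rewrite [RHS](@scalar_mx_block K N.+1 N.+1). Qed.

Lemma block_diag0 : block_diag 0 0 = 0 :> 'M[K]_((N + N.+1).+1).
Proof. by have := block_diagC 0; rewrite !raddf0. Qed.

Lemma block_diag_adj A B : (block_diag A B)^t* = block_diag (A^t*) (B^t*).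
Proof.
rewrite /block_diag; apply: (etrans (congr1 (map_mx Num.conj) (@tr_block_mx K N.+1 N.+1 N.+1 N.+1 A 0 0 B))).
apply: (etrans (@map_block_mx _ _ _ N.+1 N.+1 N.+1 N.+1 _ _ _ _)).
by rewrite !trmx0 !map_mx0.
Qed.

Lemma block_diag_inj A B A' B' : block_diag A B = block_diag A' B' -> A = A' /\ B = B'.
Proof. by move=> /(@eq_block_mx K N.+1 N.+1 N.+1 N.+1 A 0 0 B A' 0 0 B') []. Qed.

Lemma horner_block_diag A B (p : {poly K}) :
  horner_mx (block_diag A B) p = block_diag (horner_mx A p) (horner_mx B p).
Proof.
elim/poly_ind: p => [|p c IH]; first by rewrite !rmorph0 block_diag0.
by rewrite !rmorphD !rmorphM /= !horner_mx_X !horner_mx_C IH -block_diagD -block_diagM block_diagC.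
Qed.

Lemma horner_intertwine S A B (p : {poly K}) : S *m A = B *m S ->
  S *m horner_mx A p = horner_mx B p *m S.
Proof.
move=> SA; elim/poly_ind: p => [|p c IH]; first by rewrite !rmorph0 mulmx0 mul0mx.
rewrite !rmorphD !rmorphM /= !horner_mx_X !horner_mx_C mulmxDr mulmxDl.
by rewrite mulmxA IH -!mulmxA SA mul_scalar_mx mul_mx_scalar.
Qed.

End BlockDiagonal.

Section TwoFamilies.
Context {R : realType} {m N : nat}.
Local Notation C := R[i].
Local Notation space := 'rV[C^o]_m.
Local Notation letter := (multi_index m * multi_index m)%type.
Implicit Types (z v : space) (X Y : space -> letter -> 'M[C]_N.+1).

Lemma mx_lim_block (A : Type) (F : set_system A) {FF : Filter F} (f g : A -> 'M[C]_N.+1) k l :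
  mx_lim F f k -> mx_lim F g l ->
  mx_lim F (fun x => block_diag (f x) (g x)) (block_diag k l).
Proof.
move=> hf hg.
suff h (p q : 'I_(N.+1 + N.+1)) : (fun x => block_mx (f x) 0 0 (g x) p q : C^o) @ F -->
  (block_mx k 0 0 l p q : C^o) by exact: h.
rewrite -[p]splitK -[q]splitK.
have cst0 : (fun=> 0 : C^o) @ F --> (0 : C^o) by exact: cvg_cst.
case: (fintype.split p) => i; case: (fintype.split q) => j /=.
- by under eq_fun do rewrite block_mxEul; rewrite block_mxEul; exact: hf.
- by under eq_fun do rewrite block_mxEur mxE; rewrite block_mxEur mxE.
- by under eq_fun do rewrite block_mxEdl mxE; rewrite block_mxEdl mxE.
- by under eq_fun do rewrite block_mxEdr; rewrite block_mxEdr; exact: hg.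
Qed.

Lemma holomorphic_frame_block X X' z Y Y' :
  holomorphic_frame X z Y -> holomorphic_frame X' z Y' ->
  holomorphic_frame (fun v l => block_diag (X v l) (X' v l)) z
    (fun v l => block_diag (Y v l) (Y' v l)).
Proof.
case=> S1 L1 D1 [S2 L2 D2]; split.
- apply: filterS2 S1 S2 => v [S [Su SY]] [S' [Su' SY']].
  exists (block_diag S S'); split=> [|l]; last by rewrite !block_diagM SY SY'.
  by rewrite unitmxE /block_diag (@det_ublock C N.+1 N.+1) unitrM -!unitmxE Su.
- by move=> l; apply: mx_lim_block.
- move=> j l; have [B hB] := D1 j l; have [B' hB'] := D2 j l.
  exists (block_diag B B') => c.
  rewrite ev_block !block_diagZ block_diagD.
  under eq_fun do rewrite block_diagB block_diagZ.
  exact: (mx_lim_block (hB c) (hB' c)).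
Qed.

Variables (O : set space) (X X' : space -> letter -> 'M[C]_N.+1).
Hypothesis oO : open O.
Hypothesis O_neq0 : O !=set0.
Hypothesis Xadj : forall z l, O z -> X z (l.2, l.1) = (X z l)^t*.
Hypothesis Xadj' : forall z l, O z -> X' z (l.2, l.1) = (X' z l)^t*.
Hypothesis X0 : forall z J, O z -> X z (midx0, J) = (J == midx0)%:R%:M.
Hypothesis X0' : forall z J, O z -> X' z (midx0, J) = (J == midx0)%:R%:M.
Hypothesis X_frame : forall z, O z -> exists Y, holomorphic_frame X z Y.
Hypothesis X_frame' : forall z, O z -> exists Y, holomorphic_frame X' z Y.

(* By Cayley-Hamilton, at most [N.+1] powers of an expression in the letters of
   [box N.+1] are independent, and similarity makes the relation common to
   both families. *)
Theorem intertwine_all_letters :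
  (forall z, O z -> exists S : 'M[C]_N.+1, S \in unitmx /\
     forall l, box N.+1 l -> S *m X z l = X' z l *m S) ->
  exists2 z, O z & forall S : 'M[C]_N.+1,
    (forall l, box N.+1 l -> S *m X z l = X' z l *m S) ->
    forall l, S *m X z l = X' z l *m S.
Proof.
move=> simX.
have [||||z Oz h] := @stabilization R m (N + N.+1) N.+1 O
    (fun v l => block_diag (X v l) (X' v l)) oO O_neq0.
- by move=> z l Oz; rewrite Xadj // Xadj' // block_diag_adj.
- by move=> z J Oz; rewrite X0 // X0' // block_diagC.
- move=> z Oz; have [Y hY] := X_frame Oz; have [Y' hY'] := X_frame' Oz.
  by exists (fun v l => block_diag (Y v l) (Y' v l)); exact: holomorphic_frame_block.
- move=> z e Oz he; have [S [Su SX]] := simX z Oz.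
  exists (char_poly (ev (X z) e)); split.
  + by rewrite monic_neq0 ?char_poly_monic.
  + by rewrite size_char_poly.
  + have CH : horner_mx (ev (X z) e) (char_poly (ev (X z) e)) = 0.
      exact: Cayley_Hamilton.
    rewrite ev_block horner_block_diag CH.
    have := horner_intertwine (char_poly (ev (X z) e)) (ev_intertwine SX he).
    rewrite CH mulmx0 => /esym/(congr1 (mulmx^~ (invmx S))).
    by rewrite mulmxK // mul0mx => ->; exact: block_diag0.
(* At this [z] a single word in the letters of the box gives the letter [l] in both blocks at once,
   so whatever intertwines the box intertwines [l]. *)
exists z => // S SX l; have [e he] := h l.
by rewrite ev_block => /block_diag_inj[<- <-]; exact: (ev_intertwine SX he).
Qed.

End TwoFamilies.

(** * Hilbert spaces *)

Section ComplexModulus.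
Context {R : realType}.
Local Notation C := R[i].
Implicit Types c d : C.

(** The modulus as an element of [R], so that estimates take place in a totally ordered field; [nr]
    plays the same role for vectors. *)
Definition cmod c : R := complex.Re `|c|.

Lemma cmodE c : `|c| = (cmod c)%:C%C.
Proof. by rewrite /cmod RRe_real // normr_real. Qed.

Lemma cmod_ge0 c : 0 <= cmod c.
Proof. by rewrite -ler0c -cmodE. Qed.

Lemma cmodM c d : cmod (c * d) = cmod c * cmod d.
Proof. by apply: complexI; rewrite -cmodE normrM !cmodE rmorphM. Qed.

Lemma cmodD c d : cmod (c + d) <= cmod c + cmod d.
Proof. by rewrite -lecR rmorphD /= -!cmodE ler_normD. Qed.

Lemma cmodN c : cmod (- c) = cmod c.
Proof. by rewrite /cmod normrN. Qed.

Lemma cmod0 : cmod 0 = 0.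
Proof. by rewrite /cmod normr0. Qed.

Lemma cmod1 : cmod 1 = 1.
Proof. by rewrite /cmod normr1. Qed.

Lemma cmodr (r : R) : cmod r%:C%C = `|r|.
Proof. by rewrite /cmod normc_def /= expr0n addr0 sqrtr_sqr. Qed.

Lemma cmod_i : cmod 'i = 1.
Proof. by rewrite /cmod normCi. Qed.

Lemma cmodJ c : cmod c^* = cmod c.
Proof. by rewrite /cmod norm_conjC. Qed.

Lemma cmod_eq0 c : cmod c = 0 -> c = 0.
Proof. by move=> c0; apply/eqP; rewrite -normr_eq0 cmodE c0. Qed.

Lemma cmod_sqr c : c * c^* = (cmod c ^+ 2)%:C%C.
Proof. by rewrite -normCK cmodE rmorphXn. Qed.

End ComplexModulus.

Section RealNorm.
Context {R : realType} {H : hilbertType R}.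
Local Notation C := R[i].
Implicit Types (x y z : H) (c : C).

Definition nr x : R := complex.Re `|x|.

Lemma nrE x : `|x| = (nr x)%:C%C.
Proof. by rewrite /nr RRe_real // normr_real. Qed.

Lemma nr_ge0 x : 0 <= nr x.
Proof. by rewrite -ler0c -nrE. Qed.

Lemma nrD x y : nr (x + y) <= nr x + nr y.
Proof. by rewrite -lecR rmorphD /= -!nrE ler_normD. Qed.

Lemma nrN x : nr (- x) = nr x.
Proof. by rewrite /nr normrN. Qed.

Lemma nrC x y : nr (x - y) = nr (y - x).
Proof. by rewrite -nrN opprB. Qed.

Lemma nr0 : nr 0 = 0.
Proof. by rewrite /nr normr0. Qed.

Lemma nr_eq0 x : nr x = 0 -> x = 0.
Proof. by move=> x0; apply/eqP; rewrite -normr_eq0 nrE x0. Qed.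

Lemma nrZ c x : nr (c *: x) = cmod c * nr x.
Proof. by apply: complexI; rewrite -nrE normrZ cmodE nrE rmorphM. Qed.

Lemma nrB x y : nr (x - y) <= nr x + nr y.
Proof. by rewrite -[nr y]nrN; exact: nrD. Qed.

Lemma nr_sum I (r : seq I) (P : pred I) (F : I -> H) :
  nr (\sum_(i <- r | P i) F i) <= \sum_(i <- r | P i) nr (F i).
Proof.
elim: r => [|i r IH]; first by rewrite !big_nil nr0.
by rewrite !big_cons; case: (P i) => //; rewrite (le_trans (nrD _ _)) // lerD2l.
Qed.

Lemma innerDl x y z : inner (x + y) z = inner x z + inner y z.
Proof. exact: linearDl. Qed.

Lemma innerZl c x y : inner (c *: x) y = c * inner x y.
Proof. by rewrite linearZl_LR. Qed.

Lemma innerC x y : inner y x = (inner x y)^*.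
Proof. by rewrite hermC expr0 mul1r. Qed.

Lemma innerDr x y z : inner x (y + z) = inner x y + inner x z.
Proof. by rewrite innerC innerDl rmorphD /= -!innerC. Qed.

Lemma innerZr c x y : inner x (c *: y) = c^* * inner x y.
Proof. by rewrite innerC innerZl rmorphM /= -innerC. Qed.

Lemma inner0l x : inner 0 x = 0.
Proof. by rewrite -(scale0r 0) innerZl mul0r. Qed.

Lemma inner0r x : inner x 0 = 0.
Proof. by rewrite innerC inner0l rmorph0. Qed.

Lemma innerNl x y : inner (- x) y = - inner x y.
Proof. by rewrite -scaleN1r innerZl mulN1r. Qed.

Lemma innerNr x y : inner x (- y) = - inner x y.
Proof. by rewrite innerC innerNl rmorphN /= -innerC. Qed.

Lemma innerBl x y z : inner (x - y) z = inner x z - inner y z.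
Proof. by rewrite innerDl innerNl. Qed.

Lemma innerBr x y z : inner x (y - z) = inner x y - inner x z.
Proof. by rewrite innerDr innerNr. Qed.

Lemma inner_suml I (r : seq I) (P : pred I) (F : I -> H) y :
  inner (\sum_(i <- r | P i) F i) y = \sum_(i <- r | P i) inner (F i) y.
Proof.
apply: (big_ind2 (fun a b => inner a y = b)) => //; first exact: inner0l.
by move=> a _ b _ <- <-; exact: innerDl.
Qed.

Lemma inner_sumr I (r : seq I) (P : pred I) (F : I -> H) y :
  inner y (\sum_(i <- r | P i) F i) = \sum_(i <- r | P i) inner y (F i).
Proof.
apply: (big_ind2 (fun a b => inner y a = b)) => //; first exact: inner0r.
by move=> a _ b _ <- <-; exact: innerDr.
Qed.

Lemma inner_nr x : inner x x = (nr x ^+ 2)%:C%C.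
Proof. by rewrite -inner_norm nrE rmorphXn. Qed.

Lemma inner_eq0 x : inner x x = 0 -> x = 0.
Proof.
rewrite inner_nr => /(congr1 (@complex.Re R)) /= /eqP.
by rewrite sqrf_eq0 => /eqP; exact: nr_eq0.
Qed.

Lemma Cauchy_Schwarz x y : cmod (inner x y) <= nr x * nr y.
Proof.
have [->|y0] := eqVneq y 0; first by rewrite inner0r cmod0 nr0 mulr0.
have ny : 0 < nr y.
  by rewrite lt_neqAle nr_ge0 andbT eq_sym; apply: contra y0 => /eqP/nr_eq0 ->.
rewrite -ler_sqr ?nnegrE ?cmod_ge0 ?mulr_ge0 ?nr_ge0 // exprMn.
(* Up to the factor [nr y ^+ 2], [u] is the component of [x] orthogonal to [y]. *)
set a := inner x y; pose u := (nr y ^+ 2)%:C%C *: x - a *: y.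
have : 0 <= nr u ^+ 2 by rewrite sqr_ge0.
have -> : nr u ^+ 2 = nr y ^+ 2 * (nr x ^+ 2 * nr y ^+ 2 - cmod a ^+ 2).
  apply: complexI; rewrite -inner_nr /u innerBl !innerBr !innerZl !innerZr.
  rewrite -/a (innerC x y) -/a !inner_nr !rmorphM !rmorphB !rmorphM /=.
  have -> : ((nr y)%:C%C : C)^* = (nr y)%:C%C by exact: conjc_real.
  have -> : (cmod a)%:C%C * (cmod a)%:C%C = a * a^* by rewrite cmod_sqr rmorphM.
  ring.
by rewrite pmulr_rge0 ?exprn_gt0 // subr_ge0.
Qed.

Lemma nbhs_nrP x (A : set H) :
  nbhs x A <-> exists2 e : R, 0 < e & forall y, nr (x - y) < e -> A y.
Proof.
split.
  move=> /nbhs_ballP[e /= e0 eA].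
  have eE : e = (complex.Re e)%:C%C by rewrite RRe_real // gtr0_real.
  exists (complex.Re e); first by rewrite -ltcR -eE.
  by move=> y xy; apply: eA; rewrite -ball_normE /= nrE eE ltcR.
move=> [e e0 eA]; apply/nbhs_ballP; exists e%:C%C; first by rewrite /= ltcR.
by move=> y; rewrite -ball_normE /= nrE ltcR; exact: eA.
Qed.

Lemma nr_Cauchy (u : nat -> H) :
  (forall e, 0 < e -> exists N, forall p q, (N <= p)%N -> (N <= q)%N -> nr (u p - u q) < e) ->
  exists l, forall e, 0 < e -> exists N, forall p, (N <= p)%N -> nr (u p - l) < e.
Proof.
move=> cu; have cvgu : cvg (u @ \oo).
  apply/cauchy_cvgP/cauchy_ballP => e /= e0.
  have eE : e = (complex.Re e)%:C%C by rewrite RRe_real // gtr0_real.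
  have [|N hN] := cu (complex.Re e); first by rewrite -ltcR -eE.
  exists ([set u p | p in [set p | (N <= p)%N]], [set u p | p in [set p | (N <= p)%N]]).
    by split; exists N => // p /= Np; exists p.
  move=> [_ _] /= [[p Np <-] [q Nq <-]].
  by rewrite -ball_normE /= nrE eE ltcR; exact: hN.
exists (lim (u @ \oo)) => e e0.
have /cvgrPdist_lt/(_ e%:C%C) := cvgu; rewrite ltcR => /(_ e0)[N _ hN].
by exists N => p Np; rewrite nrC -ltcR -nrE; exact: hN.
Qed.

End RealNorm.

Section OrthonormalBases.
Context {R : realType} {H : hilbertType R}.
Local Notation C := R[i].
Implicit Types (x y h : H).

Definition onb k (b : 'I_k -> H) : Prop :=
  forall i j, inner (b i) (b j) = (i == j)%:R.

Definition linear_on (A : H -> H) : Prop :=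
  forall (c : C) x y, A (c *: x + y) = c *: A x + A y.

Lemma lincombD k (e : 'I_k -> H) c d :
  lincomb e c + lincomb e d = lincomb e (fun i => c i + d i).
Proof. by rewrite /lincomb -big_split; apply: eq_bigr => i _; rewrite scalerDl. Qed.

Lemma lincombZ k (e : 'I_k -> H) a c :
  a *: lincomb e c = lincomb e (fun i => a * c i).
Proof. by rewrite /lincomb scaler_sumr; apply: eq_bigr => i _; rewrite scalerA. Qed.

Lemma lincomb_recr k (e : 'I_k.+1 -> H) c : lincomb e c =
  lincomb (fun i => e (widen_ord (leqnSn k) i)) (fun i => c (widen_ord (leqnSn k) i))
    + c ord_max *: e ord_max.
Proof. by rewrite /lincomb big_ord_recr. Qed.

Lemma linear_on_lincomb A k (e : 'I_k -> H) c : linear_on A ->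
  A (lincomb e c) = lincomb (fun i => A (e i)) c.
Proof.
move=> linA; have A0 : A 0 = 0.
  by have := linA (-1) 0 0; rewrite scaler0 addr0 scaleN1r addNr.
apply: (big_ind2 (fun a b => A a = b)) => // [x _ y _ <- <-|i _].
  by have := linA 1 x y; rewrite !scale1r.
by have := linA (c i) (e i) 0; rewrite A0 !addr0.
Qed.

Lemma onb_coord k (b : 'I_k -> H) c i : onb b -> inner (lincomb b c) (b i) = c i.
Proof.
move=> ob; rewrite inner_suml (bigD1 i) //= innerZl ob eqxx mulr1.
by rewrite big1 ?addr0 // => j /negPf ji; rewrite innerZl ob ji mulr0.
Qed.

Lemma onb_nr k (b : 'I_k -> H) i : onb b -> nr (b i) = 1.
Proof.
move=> /(_ i i); rewrite eqxx inner_nr => /complexI /eqP.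
by rewrite sqrf_eq1 => /orP[/eqP //|/eqP h]; have := nr_ge0 (b i); rewrite h ler0N1.
Qed.

Lemma onb_lincombE k (b : 'I_k -> H) h : onb b -> range (lincomb b) h ->
  h = lincomb b (fun i => inner h (b i)).
Proof. by move=> ob [c _ <-]; congr lincomb; apply/funext => i; rewrite onb_coord. Qed.

Lemma onb_orth k (b : 'I_k -> H) h i : onb b ->
  inner (h - lincomb b (fun i => inner h (b i))) (b i) = 0.
Proof. by move=> ob; rewrite innerBl onb_coord // subrr. Qed.

Lemma orth_lincomb k (b : 'I_k -> H) c h :
  (forall i, inner h (b i) = 0) -> inner h (lincomb b c) = 0.
Proof. by move=> h0; rewrite inner_sumr big1 // => i _; rewrite innerZr h0 mulr0. Qed.

Lemma nr_lincomb k (b : 'I_k -> H) c : onb b ->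
  nr (lincomb b c) <= \sum_i cmod (c i).
Proof.
move=> ob; rewrite (le_trans (nr_sum _ _ _)) //; apply: ler_sum => i _.
by rewrite nrZ onb_nr // mulr1.
Qed.

Lemma lincomb_restrict k (e : 'I_k.+1 -> H) (c : 'I_k -> C) :
  lincomb (fun i => e (widen_ord (leqnSn k) i)) c =
  lincomb e (fun i => if insub (val i) is Some j then c j else 0).
Proof.
rewrite lincomb_recr /= insubF ?ltnn // scale0r addr0; congr lincomb.
by apply/funext => i /=; rewrite valK.
Qed.

(** A vector that adds nothing to the span is skipped. Dependent families are thus allowed, which is
    convenient for families that merely span a generalized kernel. *)
Lemma gram_schmidt n (e : 'I_n -> H) : exists k (b : 'I_k -> H),
  [/\ onb b, range (lincomb b) = range (lincomb e)
    & injective (lincomb e) -> k = n].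
Proof.
elim: n e => [|n IH] e; first by exists 0%N, e; split=> // -[].
pose e' (i : 'I_n) := e (widen_ord (leqnSn n) i); pose v := e ord_max.
have [k [b [ob rb inj_b]]] := IH e'.
have le' c : lincomb e' c = lincomb e (fun i => if insub (val i) is Some j then c j else 0).
  exact: lincomb_restrict.
have le c : lincomb e c =
    lincomb e' (fun i => c (widen_ord (leqnSn n) i)) + c ord_max *: v.
  exact: lincomb_recr.
have inj_e : injective (lincomb e) -> k = n.
  move=> inj; apply: inj_b => c d; rewrite !le' => /inj cd.
  apply/funext => i; have /(congr1 (fun f => f (widen_ord (leqnSn n) i))) := cd.
  by rewrite /= valK.
pose u := v - lincomb b (fun i => inner v (b i)).
have [u0|u0] := eqVneq u 0.
  exists k, b; split=> //; last first.
    move=> inj; exfalso.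
    have : range (lincomb b) v.
      by exists (fun i => inner v (b i)) => //; apply/eqP; rewrite eq_sym -subr_eq0; apply/eqP.
    rewrite rb => -[c _]; rewrite le'.
    have -> : v = lincomb e (fun i => (i == ord_max)%:R).
      rewrite le eqxx scale1r /lincomb big1 ?add0r // => i _.
      rewrite -val_eqE /= ltn_eqF ?scale0r //; exact: ltn_ord.
    move=> /inj/(congr1 (fun f => f ord_max)); rewrite /= insubF ?ltnn // eqxx.
    by move/eqP; rewrite eq_sym oner_eq0.
  apply/seteqP; split => x.
    rewrite rb => -[c _ <-]; rewrite le'.
    by exists (fun i => if insub (val i) is Some j then c j else 0).
  move=> [c _ <-]; rewrite le.
  have : range (lincomb e') (lincomb e' (fun i => c (widen_ord (leqnSn n) i))) by eexists.
  rewrite -rb => -[d _ <-].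
  have -> : v = lincomb b (fun i => inner v (b i)).
    by apply/eqP; rewrite -subr_eq0; apply/eqP.
  by rewrite lincombZ lincombD; eexists.
have nu : (nr u)%:C%C != 0 :> C.
  by apply: contra u0 => /eqP/complexI/nr_eq0 ->.
pose w := (nr u)%:C%C^-1 *: u.
pose b' (i : 'I_k.+1) := if insub (val i) is Some j then b j else w.
have b'w i : b' (widen_ord (leqnSn k) i) = b i by rewrite /b' /= valK.
have b'm : b' ord_max = w by rewrite /b' /= insubF ?ltnn.
have ub i : inner u (b i) = 0 by exact: onb_orth.
have wb i : inner w (b i) = 0 by rewrite innerZl ub mulr0.
have lb' c : lincomb b' c = lincomb b (fun i => c (widen_ord (leqnSn k) i)) + c ord_max *: w.
  by rewrite lincomb_recr b'm; congr (lincomb _ _ + _); apply/funext => i; rewrite b'w.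
exists k.+1, b'; split.
- have ordP (i : 'I_k.+1) : i = ord_max \/ exists j, i = widen_ord (leqnSn k) j.
    have [ik|ki] := ltnP i k; last first.
      by left; apply: val_inj => /=; apply/eqP; rewrite eqn_leq ki -ltnS ltn_ord.
    by right; exists (Ordinal ik); apply: val_inj.
  move=> i j; have [->|[i' ->]] := ordP i; have [->|[j' ->]] := ordP j.
  + rewrite b'm eqxx innerZl innerZr inner_nr.
    have -> : ((nr u)%:C%C^-1 : C)^* = (nr u)%:C%C^-1.
      by rewrite fmorphV; congr (_^-1); exact: conjc_real.
    by rewrite rmorphXn expr2 mulKf // mulVf.
  + rewrite b'm b'w wb eq_sym -val_eqE /= ltn_eqF //; exact: ltn_ord.
  + by rewrite b'm b'w innerC wb rmorph0 -val_eqE /= ltn_eqF //; exact: ltn_ord.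
  + by rewrite !b'w ob -!val_eqE.
- apply/seteqP; split => x [c _ <-].
    rewrite lb'; have : range (lincomb b) (lincomb b (fun i => c (widen_ord (leqnSn k) i)))
      by eexists.
    have : range (lincomb b) (lincomb b (fun i => inner v (b i))) by eexists.
    rewrite rb => -[d _ dE] [d' _ <-].
    have -> : w = (nr u)%:C%C^-1 *: (v - lincomb e' d) by rewrite /w /u dE.
    exists (fun i => if insub (val i) is Some j then
       d' j - c ord_max * (nr u)%:C%C^-1 * d j else c ord_max * (nr u)%:C%C^-1) => //.
    rewrite le /= insubF ?ltnn // !scalerBr !scalerA addrCA [RHS]addrC; congr (_ + _).
    rewrite lincombZ -scaleN1r lincombZ lincombD; congr lincomb.
    by apply/funext => i; rewrite /= valK mulN1r.
  rewrite le.
  have : range (lincomb e') (lincomb e' (fun i => c (widen_ord (leqnSn n) i))) by eexists.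
  rewrite -rb => -[d _ <-].
  have -> : v = (nr u)%:C%C *: w + lincomb b (fun i => inner v (b i)).
    by rewrite /w scalerA mulfV // scale1r /u subrK.
  exists (fun i => if insub (val i) is Some j then
     d j + c ord_max * inner v (b j) else c ord_max * (nr u)%:C%C) => //.
  rewrite lb' /= insubF ?ltnn // scalerDr scalerA addrCA addrC; congr (_ + _).
  rewrite lincombZ lincombD; congr lincomb.
  by apply/funext => i; rewrite /= valK.
- by move/inj_e ->.
Qed.

Lemma has_dim_onb (X : set H) n : has_dim X n ->
  exists b : 'I_n -> H, onb b /\ X = range (lincomb b).
Proof.
move=> [e [inj ->]]; have [k [b [ob rb /(_ inj) kn]]] := gram_schmidt e.
by subst k; exists b.
Qed.

Lemma orth_projE k (b : 'I_k -> H) h : onb b ->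
  orth_proj (range (lincomb b)) h = lincomb b (fun i => inner h (b i)).
Proof.
move=> ob; rewrite /orth_proj; set P := [set w | _].
have Pl : P (lincomb b (fun i => inner h (b i))).
  split; first by eexists.
  by move=> x [c _ <-]; apply: orth_lincomb => i; exact: onb_orth.
have [Xw hw] : P (xget 0 P) by exact: xgetPex (ex_intro _ _ Pl).
rewrite (onb_lincombE ob Xw); congr lincomb; apply/funext => i.
apply/eqP; rewrite eq_sym -subr_eq0 -innerBl; apply/eqP/hw.
exists (fun j => (j == i)%:R) => //.
rewrite /lincomb (bigD1 i) //= eqxx scale1r big1 ?addr0 // => j /negPf ->.
exact: scale0r.
Qed.

Lemma adjoint_onP k (b : 'I_k -> H) A y : onb b -> linear_on A ->
  let X := range (lincomb b) in
  X (adjoint_on X A y) /\ forall x, X x -> inner (A x) y = inner x (adjoint_on X A y).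
Proof.
move=> ob linA X; rewrite /adjoint_on; set P := [set w | _].
suff /xgetPex : exists w, P w by apply.
exists (lincomb b (fun i => (inner (A (b i)) y)^*)); split; first by eexists.
move=> x [c _ <-]; rewrite linear_on_lincomb // !inner_suml; apply: eq_bigr => i _.
by rewrite !innerZl [in RHS]innerC onb_coord // conjCK.
Qed.

End OrthonormalBases.

(** * An open mapping theorem for seminorms *)

Section OpenMapping.
Context {R : realType} {H : hilbertType R}.
Local Notation C := R[i].
Implicit Types (x y h : H).

(* [p] stands for the norm of the image of a vector under an operator with
   complete range. *)
Variable p : H -> R.
Hypothesis pD : forall x y, p (x + y) <= p x + p y.
Hypothesis pZ : forall (c : C) x, p (c *: x) = cmod c * p x.
Hypothesis p_complete : forall u : nat -> H,
  (forall e, 0 < e -> exists N, forall a b, (N <= a)%N -> (N <= b)%N -> p (u a - u b) < e) ->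
  exists l, forall e, 0 < e -> exists N, forall a, (N <= a)%N -> p (u a - l) < e.
Variable M : R.
Hypothesis pM : forall x, p x <= M * nr x.

Let p_ge0 x : 0 <= p x.
Proof.
have := pD x (- x); rewrite subrr -(scale0r 0) pZ cmod0 mul0r -scaleN1r pZ.
by rewrite cmodN cmod1 mul1r; lra.
Qed.

Let pN x : p (- x) = p x.
Proof. by rewrite -scaleN1r pZ cmodN cmod1 mul1r. Qed.

Let pC x y : p (x - y) = p (y - x).
Proof. by rewrite -pN opprB. Qed.

Let p_triangle y x z : p (x - z) <= p (x - y) + p (y - z).
Proof. by have := pD (x - y) (y - z); rewrite addrA subrK. Qed.

Let half_pow (k : nat) : R := 2^-1 ^+ k.

Let half_pow_gt0 k : 0 < half_pow k.
Proof. by rewrite exprn_gt0 // invr_gt0. Qed.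

Let half_pow_small e : 0 < e -> exists k, half_pow k < e.
Proof.
move=> e0; have := @cvg_expr R (2^-1) ; rewrite ger0_norm ?invr_ge0 // invf_lt1 // ltr1n.
move=> /(_ isT)/cvgrPdist_lt/(_ e e0)[k _ /(_ k (leqnn _))].
by rewrite sub0r normrN ger0_norm ?exprn_ge0 ?invr_ge0 //; exists k.
Qed.

Let half_powS k : half_pow k.+1 = half_pow k / 2.
Proof. by rewrite /half_pow exprS mulrC. Qed.

Let half_pow_le k q : (k <= q)%N -> half_pow q <= half_pow k.
Proof.
move=> /subnKC <-; rewrite /half_pow exprD ler_piMr ?exprn_ge0 ?invr_ge0 //.
by rewrite exprn_ile1 ?invr_ge0 // invf_le1 // ler1n.
Qed.

(** Baire's argument. If the [p]-closures of the norm balls of integer radius all had empty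
    interior, nested [p]-balls missing them one by one would shrink to a point outside every norm
    ball. *)
Let somewhere_dense : exists (k : nat) x0 (r : R), 0 < r /\
  forall x, p (x - x0) < r -> forall e, 0 < e -> exists2 y, nr y <= k%:R & p (x - y) < e.
Proof.
apply: contrapT => hn.
have step (s : (nat * H * R)%type) : exists t : (H * R)%type, 0 < s.2 ->
    [/\ p (t.1 - s.1.2) <= s.2 / 2, 0 < t.2, t.2 <= s.2 / 2 &
      forall x y, p (x - t.1) <= t.2 -> nr y <= s.1.1%:R -> 0 < p (x - y)].
  case: s => [[k x0] r] /=.
  have [r0|/negP r0] := boolP (0 < r); last by exists (x0, r).
  have [x [xr [e e0 he]]] : exists x, p (x - x0) < r / 2 /\
      exists2 e, 0 < e & forall y, nr y <= k%:R -> e <= p (x - y).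
    apply: contrapT => h; apply: hn; exists k, x0, (r / 2); split; first by lra.
    move=> x xr e e0; apply: contrapT => h'; apply: h; exists x; split=> //.
    exists e => // y yk; rewrite leNgt; apply/negP => h''; apply: h'.
    by exists y.
  exists (x, Num.min (e / 2) (r / 2)) => _ /=; split.
  - exact: ltW.
  - by rewrite lt_min; apply/andP; split; lra.
  - by rewrite ge_min lexx orbT.
  - move=> x' y; rewrite le_min => /andP[h1 h2] yk.
    have := he y yk; have := p_triangle x' x y; rewrite (pC x x'); lra.
have [f hf] := choice step.
pose s := fix s (k : nat) : (H * R)%type := if k is k'.+1 then
  f (k', (s k').1, (s k').2) else (0, 1).
have s0 k : 0 < (s k).2.
  elim: k => [|k IH] /=; first exact: ltr01.
  by have [] := hf (k, (s k).1, (s k).2) IH.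
have sS k := hf (k, (s k).1, (s k).2) (s0 k).
have sr k : (s k).2 <= half_pow k.
  elim: k => [|k IH]; first by rewrite /half_pow expr0.
  have [_ _ h _] := sS k; rewrite half_powS; move: h => /=; lra.
have nest k q : p ((s (q + k)%N).1 - (s k).1) <= (s k).2 - (s (q + k)%N).2.
  elim: q => [|q IH]; first by rewrite add0n !subrr -(scale0r 0) pZ cmod0 mul0r.
  have [h1 _ h2 _] := sS (q + k)%N.
  have := p_triangle (s (q + k)%N).1 (s (q.+1 + k)%N).1 (s k).1.
  move: h1 h2; rewrite addSn /=; lra.
have nest' k q : (k <= q)%N -> p ((s q).1 - (s k).1) <= (s k).2.
  by move=> /subnK <-; have := nest k (q - k)%N; have := s0 (q - k + k)%N; lra.
have [l hl] : exists l, forall e, 0 < e -> exists N, forall a, (N <= a)%N -> p ((s a).1 - l) < e.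
  apply: p_complete => e e0; have [N hN] := half_pow_small (e := e / 2) ltac:(lra).
  exists N => a b Na Nb.
  have := nest' _ _ Na; have := nest' _ _ Nb; have := sr N.
  have := p_triangle (s N).1 (s a).1 (s b).1; rewrite (pC (s N).1); lra.
have lim_in k : p (l - (s k).1) <= (s k).2.
  rewrite leNgt; apply/negP => h.
  have [N hN] := hl (p (l - (s k).1) - (s k).2) ltac:(lra).
  have := hN (maxn N k) (leq_maxl _ _); have := nest' _ _ (leq_maxr N k).
  have := p_triangle (s (maxn N k)).1 l (s k).1; rewrite (pC l (s (maxn N k)).1); lra.
have [k hk] : exists k : nat, nr l <= k%:R.
  exists (Num.truncn (nr l)).+1; exact/ltW/truncnS_gt.
have [_ _ _ /(_ l l)] := sS k.
rewrite subrr -[X in 0 < p X](scale0r 0) pZ cmod0 mul0r ltxx => /(_ (lim_in k.+1) hk).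
by [].
Qed.

(** Approximate preimages on a [p]-ball give, after scaling, a correction that halves [p]; the sum
    of the iterated corrections is the required [y]. The geometric series accounts for [2 * c0], and
    the added 1 makes the constant positive even if [c0] is 0. *)
Lemma open_mapping : exists2 c : R, 0 < c &
  forall x, exists y, nr y <= c * p x /\ p (x - y) = 0.
Proof.
have [k [x0 [r [r0 hd]]]] := somewhere_dense.
pose c0 := 4 * k%:R / r.
have c00 : 0 <= c0 by rewrite /c0 divr_ge0 ?mulr_ge0 ?ler0n // ltW.
(* The ball is moved to the origin by subtracting an approximation of [x0] from one of [x0 + x],
   which doubles the norm bound. *)
have ball0 x e : p x < r -> 0 < e -> exists2 y, nr y <= 2 * k%:R & p (x - y) < e.
  move=> xr e0.
  have [||y1 y1k h1] := hd (x0 + x) _ (e / 2); [by rewrite addrC addKr|lra|].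
  have [||y2 y2k h2] := hd x0 _ (e / 2); [|lra|].
    by rewrite subrr -(scale0r 0) pZ cmod0 mul0r.
  exists (y1 - y2); first by have := nrB y1 y2; lra.
  have := pD (x0 + x - y1) (- (x0 - y2)); rewrite pN.
  have -> : x0 + x - y1 - (x0 - y2) = x - (y1 - y2).
    by rewrite !opprB [y2 - x0]addrC addrACA [x0 + x]addrC addrK [- y1 + y2]addrC.
  lra.
have approx x : exists y, nr y <= c0 * p x /\ p (x - y) <= p x / 2.
  have [px0|px0] := eqVneq (p x) 0.
    by exists 0; rewrite nr0 px0 mulr0 subr0 px0 mul0r.
  have px : 0 < p x by rewrite lt_neqAle eq_sym px0 p_ge0.
  (* [t] scales [x] to [p]-size [r / 2]. The tolerance is half of that, and undoing the scaling
     turns the bound [2 * k] into [c0 * p x]. *)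
  pose t : R := r / (2 * p x).
  have t0 : 0 < t by rewrite divr_gt0 // mulr_gt0.
  have ct : cmod t%:C%C = t by rewrite cmodr ger0_norm ?ltW.
  have tx : t * p x = r / 2 by rewrite /t invfM mulrA mulfVK.
  have [||y yk hy] := ball0 (t%:C%C *: x) (t * p x / 2).
  - by rewrite pZ ct tx; lra.
  - by rewrite tx; lra.
  have tC : t%:C%C != 0 :> C by apply/eqP => /complexI h; rewrite h ltxx in t0.
  have cV : cmod (t%:C%C^-1 : C) = t^-1.
    by rewrite -fmorphV cmodr ger0_norm // invr_ge0 ltW.
  exists (t%:C%C^-1 *: y); split.
    rewrite nrZ cV; apply: (@le_trans _ _ (t^-1 * (2 * k%:R))).
      by rewrite ler_pM2l // invr_gt0.
    rewrite /t /c0 invf_div le_eqVlt; apply/orP; left; apply/eqP; field.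
    by rewrite lt0r_neq0.
  have -> : x - t%:C%C^-1 *: y = t%:C%C^-1 *: (t%:C%C *: x - y).
    by rewrite scalerBr scalerA mulVf // scale1r.
  rewrite pZ cV; apply: (@le_trans _ _ (t^-1 * (t * p x / 2))).
    by rewrite ler_pM2l ?invr_gt0 // ltW.
  by rewrite -mulrA mulKf // lt0r_neq0.
have [g hg] := choice approx.
exists (2 * c0 + 1); first by lra.
move=> x; pose u := fix u j := if j is j'.+1 then u j' - g (u j') else x.
have pu j : p (u j) <= half_pow j * p x.
  elim: j => [|j IH] /=; first by rewrite /half_pow expr0 mul1r.
  by have [_ h] := hg (u j); rewrite half_powS; lra.
have step j : nr (u j - u j.+1) <= c0 * p x * half_pow j.
  rewrite /= opprB addrC subrK; have [h _] := hg (u j).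
  by apply: le_trans h _; rewrite -mulrA [p x * _]mulrC ler_wpM2l.
have tail j q : nr (u j - u (q + j)%N) <= 2 * c0 * p x * (half_pow j - half_pow (q + j)%N).
  elim: q => [|q IH]; first by rewrite add0n !subrr nr0 mulr0.
  have := nrD (u j - u (q + j)%N) (u (q + j)%N - u (q + j).+1).
  rewrite addrA subrK addSn; have := step (q + j)%N; rewrite half_powS; lra.
have K0 : 0 <= 2 * c0 * p x by apply: mulr_ge0; [lra|exact: p_ge0].
have tail' j q : (j <= q)%N -> nr (u j - u q) <= 2 * c0 * p x * half_pow j.
  move=> /subnK <-; apply: le_trans (tail j (q - j)%N) _.
  by rewrite ler_wpM2l // lerBlDr lerDl ltW.
have [l hl] : exists l, forall e, 0 < e -> exists N, forall a, (N <= a)%N -> nr (u a - l) < e.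
  apply: nr_Cauchy => e e0.
  have [N hN] : exists N, 2 * c0 * p x * half_pow N < e / 2.
    have [N hN] := half_pow_small (e := e / 2 / (2 * c0 * p x + 1)) ltac:(by rewrite divr_gt0; lra).
    exists N; move: hN; rewrite ltr_pdivlMr; last by lra.
    have := half_pow_gt0 N; nra.
  exists N => a b Na Nb; have := tail' _ _ Na; have := tail' _ _ Nb.
  have := nrD (u a - u N) (u N - u b); rewrite addrA subrK (nrC (u a)); lra.
exists (x - l); split.
  rewrite leNgt; apply/negP => h.
  have px0 := p_ge0 x.
  have [N hN] := hl (nr (x - l) - 2 * c0 * p x) ltac:(lra).
  have := hN N (leqnn N); have := tail' 0%N N (leq0n N).
  have := nrD (x - u N) (u N - l); rewrite addrA subrK /half_pow expr0 mulr1 /=; lra.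
(* The residual [u N] is small for [p] and close to [l] in norm; by [pM] it is also close to [l] for
   [p], whence [p l = 0]. *)
rewrite opprB addrC subrK; apply/eqP; rewrite eq_le p_ge0 andbT leNgt; apply/negP => pl.
have M0 : 0 <= M.
  have := pM l; have := nr_ge0 l => n0 h; rewrite leNgt; apply/negP => hM.
  have : M * nr l <= 0 by rewrite mulr_le0_ge0 // ltW.
  lra.
have [N1 h1] := hl (p l / 2 / (M + 1)) ltac:(by rewrite divr_gt0; lra).
have [N2 h2] := half_pow_small (e := p l / 2 / (p x + 1)) ltac:(by rewrite divr_gt0; have := p_ge0 x; lra).
pose N := maxn N1 N2.
have := h1 N (leq_maxl _ _); rewrite ltr_pdivlMr; last by lra.
move=> h3; have := half_pow_le (leq_maxr N1 N2) => h4.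
have h5 : half_pow N < p l / 2 / (p x + 1) by exact: le_lt_trans h2.
move: h5; rewrite ltr_pdivlMr; last by have := p_ge0 x; lra.
have := pu N; have := pM (u N - l); have := pD (u N) (- (u N - l)); rewrite pN opprB addrC subrK.
have := p_ge0 x; have := half_pow_gt0 N; have := nr_ge0 (u N - l).
nra.
Qed.

End OpenMapping.

Lemma small_inv (R : realType) (e : R) : 0 < e ->
  exists N : nat, forall k, (N <= k)%N -> k.+1%:R^-1 < e.
Proof.
move=> e0; exists (Num.truncn e^-1) => k Nk.
rewrite invf_plt ?posrE ?ltr0n //; apply: lt_le_trans (truncnS_gt _) _.
by rewrite ler_nat ltnS.
Qed.

(** * Orthogonality and density in a Hilbert space *)

Section Density.
Context {R : realType} {H : hilbertType R}.
Local Notation C := R[i].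
Implicit Types (x y h v : H) (V : set H).

Lemma nr_sqrD x y : nr (x + y) ^+ 2 = nr x ^+ 2 + nr y ^+ 2 + 2 * complex.Re (inner x y).
Proof.
have E : (2 * complex.Re (inner x y))%:C%C = inner x y + (inner x y)^*.
  by rewrite rmorphM rmorph_nat; exact: esym (addcJ _).
apply: complexI; rewrite rmorphD /= E rmorphD /= -!inner_nr innerDl !innerDr (innerC x y).
ring.
Qed.

Lemma parallelogram x y :
  nr (x + y) ^+ 2 + nr (x - y) ^+ 2 = 2 * nr x ^+ 2 + 2 * nr y ^+ 2.
Proof. rewrite !nr_sqrD nrN innerNr raddfN /=; lra. Qed.

(** For [c *: v] the projection of [h] on [v], Pythagoras and minimality force [c *: v = 0]. *)
Lemma orth_minimal h v : (forall c : C, nr h <= nr (h - c *: v)) -> inner h v = 0.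
Proof.
move=> hmin; have [->|v0] := eqVneq v 0; first exact: inner0r.
have nv : 0 < nr v.
  by rewrite lt_neqAle nr_ge0 andbT eq_sym; apply: contra v0 => /eqP/nr_eq0 ->.
have nvC : (nr v ^+ 2)%:C%C != 0 :> C.
  by apply/eqP => /complexI /eqP; rewrite sqrf_eq0 => /eqP h0; rewrite h0 ltxx in nv.
set c := inner h v / (nr v ^+ 2)%:C%C; pose w := h - c *: v.
have wv : inner w v = 0 by rewrite innerBl innerZl inner_nr divfK // subrr.
have hE : h = w + c *: v by rewrite subrK.
have h2 : nr h ^+ 2 = nr w ^+ 2 + nr (c *: v) ^+ 2.
  by rewrite {1}hE nr_sqrD innerZr wv mulr0 mulr0 addr0.
have := hmin c; rewrite -/w => le_hw.
have c0 : nr (c *: v) = 0.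
  apply/eqP; rewrite -sqrf_eq0 eq_le sqr_ge0 andbT.
  have := nr_ge0 h; have := nr_ge0 w; nra.
have : c = 0.
  by move: c0; rewrite nrZ => /eqP; rewrite mulf_eq0 (gt_eqF nv) orbF => /eqP/cmod_eq0.
move/eqP; rewrite mulf_eq0 invr_eq0 (negPf nvC) orbF => /eqP //.
Qed.

(** A sequence in [V] minimizing the distance to [h] is Cauchy by the parallelogram law, and [h]
    minus its limit is orthogonal to [V], hence zero. *)
Lemma subspace_dense V : V 0 -> (forall (c : C) x y, V x -> V y -> V (c *: x + y)) ->
  (forall y, (forall v, V v -> inner y v = 0) -> y = 0) ->
  forall h (e : R), 0 < e -> exists2 v, V v & nr (h - v) < e.
Proof.
move=> V0 Vlin orth h.
have VD x y : V x -> V y -> V (x + y) by move=> /(Vlin 1 x y) + /[dup] => {}/[apply]; rewrite scale1r.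
have VZ c x : V x -> V (c *: x) by move=> Vx; rewrite -[_ *: _]addr0; exact: Vlin.
pose S := [set nr (h - v) | v in V].
have infS : has_inf S.
  split; first by exists (nr (h - 0)), 0.
  by exists 0 => _ [v _ <-]; exact: nr_ge0.
have dle v : V v -> inf S <= nr (h - v).
  by move=> Vv; apply: ge_inf; [exact: infS.2|exists v].
have d0 : 0 <= inf S by apply: lb_le_inf; [exact: infS.1|move=> _ [v _ <-]; exact: nr_ge0].
have /choice[u hu] : forall k : nat, exists u, V u /\ nr (h - u) < inf S + k.+1%:R^-1.
  move=> k.
  have [_ [v Vv <-] hv] := @inf_adherent R S k.+1%:R^-1 ltac:(by rewrite invr_gt0 ltr0n) infS.
  by exists v.
(* With errors [p] and [q] above the infimum [d], the parallelogram law bounds the square by [4 * d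
   * (p + q) + 2 * p ^+ 2 + 2 * q ^+ 2], and [p] and [q] are at most 1. *)
have quasi a b : nr (u a - u b) ^+ 2 <=
    (4 * inf S + 2) * (a.+1%:R^-1 + b.+1%:R^-1).
  have [Va ha] := hu a; have [Vb hb] := hu b.
  have := parallelogram (h - u a) (h - u b).
  have -> : h - u a - (h - u b) = - (u a - u b) by rewrite !opprB addrC subrKA.
  have -> : h - u a + (h - u b) = 2 *: (h - 2^-1 *: (u a + u b)).
    rewrite scalerBr scalerA mulfV ?pnatr_eq0 // scale1r scaler_nat mulr2n.
    by rewrite addrACA opprD.
  rewrite nrN nrZ; have -> : cmod (2 : C) = 2.
    by rewrite -(rmorph_nat (real_complex R)) cmodr ger0_norm.
  have hM := dle (2^-1 *: (u a + u b)) ltac:(by apply/VZ/VD).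
  have hA := dle _ Va; have hB := dle _ Vb.
  have ia : a.+1%:R^-1 <= 1 :> R by rewrite invf_le1 ?ltr0n // ler1n.
  have ib : b.+1%:R^-1 <= 1 :> R by rewrite invf_le1 ?ltr0n // ler1n.
  have ia0 : 0 < a.+1%:R^-1 :> R by rewrite invr_gt0 ltr0n.
  have ib0 : 0 < b.+1%:R^-1 :> R by rewrite invr_gt0 ltr0n.
  have sq (s t : R) : 0 <= s -> s <= t -> s ^+ 2 <= t ^+ 2.
    by move=> s0 st; rewrite ler_sqr // nnegrE (le_trans s0).
  have := sq _ _ (nr_ge0 (h - u a)) (ltW ha); have := sq _ _ (nr_ge0 (h - u b)) (ltW hb).
  have := sq _ _ d0 hM.
  move: (a.+1%:R^-1) (b.+1%:R^-1) ia ib ia0 ib0 => p q; nra.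
have [l hl] : exists l, forall e, 0 < e -> exists N, forall a, (N <= a)%N -> nr (u a - l) < e.
  apply: nr_Cauchy => e e0.
  have [N hN] := @small_inv R (e ^+ 2 / 2 / (4 * inf S + 3)) ltac:(by rewrite !divr_gt0 ?exprn_gt0 //; lra).
  exists N => a b Na Nb; rewrite -ltr_sqr ?nnegrE ?nr_ge0 ?(ltW e0) //.
  apply: le_lt_trans (quasi a b) _.
  have ha := hN a Na; have hb := hN b Nb.
  have ia0 : 0 < a.+1%:R^-1 :> R by rewrite invr_gt0 ltr0n.
  have ib0 : 0 < b.+1%:R^-1 :> R by rewrite invr_gt0 ltr0n.
  have S3 : 0 < 4 * inf S + 3 by lra.
  move: ha hb; rewrite !(ltr_pdivlMr _ _ S3).
  move: (a.+1%:R^-1) (b.+1%:R^-1) ia0 ib0 => p q; nra.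
have lmin : nr (h - l) <= inf S.
  rewrite leNgt; apply/negP => lt.
  have [N1 h1] := hl ((nr (h - l) - inf S) / 2) ltac:(lra).
  have [N2 h2] := @small_inv R ((nr (h - l) - inf S) / 2) ltac:(lra).
  have := h1 (maxn N1 N2) (leq_maxl _ _); have := h2 (maxn N1 N2) (leq_maxr _ _).
  have [_] := hu (maxn N1 N2); have := nrD (h - u (maxn N1 N2)) (u (maxn N1 N2) - l).
  rewrite addrA subrK; move: (_%:R^-1) => p; lra.
have hl0 : h - l = 0.
  apply: orth => v Vv; apply: orth_minimal => c.
  rewrite leNgt; apply/negP => lt.
  have [N hN] := hl (nr (h - l) - nr (h - l - c *: v)) ltac:(lra).
  have [VN _] := hu N; have := dle _ (VD _ _ VN (VZ c v Vv)).
  have := hN N (leqnn N); have := nrD (h - l - c *: v) (l - u N); rewrite (nrC l).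
  have -> : h - l - c *: v + (l - u N) = h - (u N + c *: v).
    by rewrite addrAC addrA subrK -addrA -opprD.
  lra.
move=> e e0; have [N hN] := hl e e0; exists (u N); first by have [] := hu N.
by rewrite (subr0_eq hl0) nrC; exact: hN.
Qed.

End Density.

(** * Extension of isometries from spanning families *)

Section IsometryExtension.
Context {R : realType}.
Local Notation C := R[i].

(** A relation and not a map, because the family [a] may be dependent and a vector need not
    determine its coefficients. Equality of the Gram matrices makes the relation norm preserving,
    and thereby single valued. *)
Definition span_graph (H H' : hilbertType R) (K : Type) (a : K -> H) (a' : K -> H')
    (g : H) (g' : H') : Prop :=
  exists n (k : 'I_n -> K) (c : 'I_n -> C),
    g = lincomb (fun i => a (k i)) c /\ g' = lincomb (fun i => a' (k i)) c.

Definition spanning (H : hilbertType R) (K : Type) (a : K -> H) : Prop :=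
  forall h (e : R), 0 < e -> exists n (k : 'I_n -> K) (c : 'I_n -> C),
    nr (h - lincomb (fun i => a (k i)) c) < e.

Section Graph.
Variables (H H' : hilbertType R) (K : Type) (a : K -> H) (a' : K -> H').
Hypothesis aa' : forall k l, inner (a k) (a l) = inner (a' k) (a' l).

Lemma span_graph_lin (c : C) g1 g1' g2 g2' : span_graph a a' g1 g1' ->
  span_graph a a' g2 g2' -> span_graph a a' (c *: g1 + g2) (c *: g1' + g2').
Proof.
move=> [n1 [k1 [c1 [-> ->]]]] [n2 [k2 [c2 [-> ->]]]].
exists (n1 + n2)%N, (fun i => match fintype.split i with inl j => k1 j | inr j => k2 j end),
  (fun i => match fintype.split i with inl j => c * c1 j | inr j => c2 j end).
by rewrite !lincombZ /lincomb !big_split_ord /=; split; congr (_ + _);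
  apply: eq_bigr => i _; rewrite ?(unsplitK (inl i)) ?(unsplitK (inr i)).
Qed.

Lemma span_graph_nr g g' : span_graph a a' g g' -> nr g = nr g'.
Proof.
move=> [n [k [c [-> ->]]]]; apply/eqP; rewrite -(@eqrXn2 _ 2) ?nr_ge0 //; apply/eqP/complexI.
rewrite -!inner_nr !inner_suml; apply: eq_bigr => i _.
by rewrite !inner_sumr; apply: eq_bigr => j _; rewrite !innerZl !innerZr aa'.
Qed.

Definition closed_graph (h : H) (h' : H') : Prop := forall e : R, 0 < e ->
  exists g g', [/\ span_graph a a' g g', nr (h - g) < e & nr (h' - g') < e].

Lemma closed_graph_nr h h' : closed_graph h h' -> nr h = nr h'.
Proof.
move=> G; have small (e : R) : 0 < e -> `|nr h - nr h'| < e.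
  move=> e0; have [g [g' [Gg h1 h2]]] := G (e / 2) ltac:(lra).
  have := span_graph_nr Gg.
  have := nrD (h - g) g; have := nrD (g - h) h; have := nrD (h' - g') g'.
  have := nrD (g' - h') h'; rewrite !subrK (nrC g) (nrC g') ltr_norml => *.
  by apply/andP; split; lra.
apply/eqP; rewrite -subr_eq0 -normr_eq0 eq_le normr_ge0 andbT leNgt; apply/negP => lt.
by have := small _ lt; rewrite ltxx.
Qed.

Lemma closed_graph_lin (c : C) h1 h1' h2 h2' : closed_graph h1 h1' ->
  closed_graph h2 h2' -> closed_graph (c *: h1 + h2) (c *: h1' + h2').
Proof.
move=> G1 G2 e e0; have c0 := cmod_ge0 c.
have e1 : 0 < e / 2 / (cmod c + 1) by rewrite !divr_gt0 //; lra.
have [g1 [g1' [Gg1 d1 d1']]] := G1 _ e1.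
have [g2 [g2' [Gg2 d2 d2']]] := G2 (e / 2) ltac:(lra).
move: d1 d1'; rewrite !ltr_pdivlMr; try lra.
move=> d1 d1'; exists (c *: g1 + g2), (c *: g1' + g2'); split.
- exact: span_graph_lin.
- have -> : c *: h1 + h2 - (c *: g1 + g2) = c *: (h1 - g1) + (h2 - g2).
    by rewrite scalerBr opprD addrACA.
  have := nrD (c *: (h1 - g1)) (h2 - g2); rewrite nrZ; have := nr_ge0 (h1 - g1); nra.
- have -> : c *: h1' + h2' - (c *: g1' + g2') = c *: (h1' - g1') + (h2' - g2').
    by rewrite scalerBr opprD addrACA.
  have := nrD (c *: (h1' - g1')) (h2' - g2'); rewrite nrZ; have := nr_ge0 (h1' - g1'); nra.
Qed.

Lemma closed_graph_total : spanning a -> forall h, exists h', closed_graph h h'.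
Proof.
move=> sp h.
have /choice[u hu] : forall k : nat, exists u : (H * H')%type,
    span_graph a a' u.1 u.2 /\ nr (h - u.1) < k.+1%:R^-1.
  move=> k.
  have [n [kk [c hc]]] := sp h k.+1%:R^-1 ltac:(by rewrite invr_gt0 ltr0n).
  exists (lincomb (fun i => a (kk i)) c, lincomb (fun i => a' (kk i)) c).
  by split=> //; exists n, kk, c.
have [l hl] : exists l, forall e, 0 < e ->
    exists N, forall p, (N <= p)%N -> nr ((u p).2 - l) < e.
  apply: nr_Cauchy => e e0; have [N hN] := @small_inv R (e / 2) ltac:(lra).
  exists N => p q Np Nq; have [G1 d1] := hu p; have [G2 d2] := hu q.
  have := span_graph_nr (span_graph_lin (-1) G2 G1).
  rewrite !scaleN1r addrC [X in _ = nr X]addrC => <-.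
  have := nrD ((u p).1 - h) (h - (u q).1); rewrite addrA subrK (nrC (u p).1).
  move: d1 d2 (hN p Np) (hN q Nq); move: (p.+1%:R^-1) (q.+1%:R^-1) => r s; lra.
exists l => e e0; have [N1 h1] := hl e e0; have [N2 h2] := small_inv e0.
pose N := maxn N1 N2; have [G d] := hu N.
exists (u N).1, (u N).2; split=> //.
  by apply: lt_trans d _; apply: h2; exact: leq_maxr.
by rewrite nrC; apply: h1; exact: leq_maxl.
Qed.

End Graph.

Lemma closed_graph_sym (H H' : hilbertType R) (K : Type) (a : K -> H) (a' : K -> H') h h' :
  closed_graph a a' h h' -> closed_graph a' a h' h.
Proof.
move=> G e e0; have [g [g' [[n [k [c [-> ->]]]] d d']]] := G e e0.
by eexists; eexists; split; [exists n, k, c|exact: d'|exact: d].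
Qed.

(** Polarization: multiplying [x] by 1 and by [-i] recovers the real and the imaginary part of the
    inner product. *)
Lemma isometry_inner (H H' : hilbertType R) (U : H -> H') :
  (forall (c : C) x y, U (c *: x + y) = c *: U x + U y) ->
  (forall x, nr (U x) = nr x) -> forall x y, inner (U x) (U y) = inner x y.
Proof.
move=> Ulin Unr x y.
have key (c : C) : complex.Re (c * inner (U x) (U y)) = complex.Re (c * inner x y).
  have := nr_sqrD (c *: x) y; have := nr_sqrD (c *: U x) (U y).
  rewrite -Ulin !Unr !nrZ Unr !innerZl; lra.
have := key 1; have := key (- 'i%C); rewrite !mul1r.
case: (inner (U x) (U y)) => p q; case: (inner x y) => p' q' /=.
by rewrite !oppr0 !mul0r !sub0r !mulN1r !opprK => -> ->.
Qed.

Lemma isometry_extension (H H' : hilbertType R) (K : Type) (a : K -> H) (a' : K -> H') :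
  (forall k l, inner (a k) (a l) = inner (a' k) (a' l)) ->
  spanning a -> spanning a' ->
  exists U : H -> H', unitary_between setT setT U /\ forall k, U (a k) = a' k.
Proof.
move=> aa' sp sp'.
have [U hU] := choice (closed_graph_total aa' sp).
have uniq h h' : closed_graph a a' h h' -> U h = h'.
  move=> G; apply/eqP; rewrite -subr_eq0; apply/eqP/nr_eq0.
  have := closed_graph_nr aa' (closed_graph_lin (-1) G (hU h)).
  by rewrite !scaleN1r addNr nr0 addrC => <-.
have Ulin (c : C) x y : U (c *: x + y) = c *: U x + U y.
  by apply: uniq; apply: closed_graph_lin.
exists U; split; first split=> //.
- move=> x y _ _; apply: isometry_inner => // v.
  by rewrite (closed_graph_nr aa' (hU v)).
- apply/seteqP; split=> // h' _.
  have [h /closed_graph_sym G] := closed_graph_total (fun k l => esym (aa' k l)) sp' h'.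
  by exists h => //; exact: uniq.
- move=> k; apply: uniq => e e0; exists (a k), (a' k); rewrite !subrr !nr0; split=> //.
  by exists 1%N, (fun=> k), (fun=> 1); rewrite /lincomb !big_ord1 !scale1r.
Qed.

Lemma bounded_operator_nr (H : hilbertType R) (A : {linear H -> H}) :
  bounded_operator A -> exists2 M : R, 0 <= M & forall x, nr (A x) <= M * nr x.
Proof.
move=> [M bA]; exists `|complex.Re M| => [|x]; first exact: normr_ge0.
have := bA x; rewrite !nrE lecE => /andP[_]; case: M {bA} => p q /=.
rewrite mulr0 subr0 => /le_trans; apply.
by rewrite ler_wpM2r ?nr_ge0 // ler_norm.
Qed.

(** The difference [D] of the two sides is linear, bounded, and zero on a dense span. *)
Lemma intertwine_spanning (H H' : hilbertType R) (K : Type) (a : K -> H) (U : H -> H')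
    (A : {linear H -> H}) (A' : {linear H' -> H'}) :
  unitary_between setT setT U -> spanning a ->
  bounded_operator A -> bounded_operator A' ->
  (forall k, U (A (a k)) = A' (U (a k))) -> forall h, U (A h) = A' (U h).
Proof.
move=> [Ulin Uinner _] sp /bounded_operator_nr[M M0 bA] /bounded_operator_nr[M' M'0 bA'] UA h.
have Unr x : nr (U x) = nr x.
  apply/eqP; rewrite -(@eqrXn2 _ 2) ?nr_ge0 //; apply/eqP/complexI.
  by rewrite -!inner_nr Uinner.
pose D x := U (A x) - A' (U x).
have Dlin (c : C) x y : D (c *: x + y) = c *: D x + D y.
  by rewrite /D !linearP /= !Ulin // linearP /= scalerBr opprD addrACA.
have D0 n (k : 'I_n -> K) c : D (lincomb (fun i => a (k i)) c) = 0.
  have D00 : D 0 = 0 by have := Dlin (-1) 0 0; rewrite scaler0 addr0 scaleN1r addNr.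
  apply: (big_ind (fun x => D x = 0)) => // [x y hx hy|i _].
    by have := Dlin 1 x y; rewrite !scale1r hx hy addr0.
  have := Dlin (c i) (a (k i)) 0; rewrite !addr0 D00 addr0 => ->.
  by rewrite /D UA subrr scaler0.
have Dbound x : nr (D x) <= (M + M') * nr x.
  have := nrB (U (A x)) (A' (U x)); rewrite Unr.
  have := bA x; have := bA' (U x); rewrite Unr /D; lra.
apply/eqP; rewrite -subr_eq0; apply/eqP/nr_eq0/eqP; rewrite eq_le nr_ge0 andbT.
rewrite leNgt; apply/negP; rewrite -/(D h) => lt.
have [n [k [c hc]]] := sp h (nr (D h) / (M + M' + 1)) ltac:(by rewrite divr_gt0 //; lra).
have := Dlin (-1) (lincomb (fun i => a (k i)) c) h.
rewrite D0 scaler0 add0r scaleN1r addrC => DE.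
have := Dbound (h - lincomb (fun i => a (k i)) c); rewrite DE.
move: hc; rewrite ltr_pdivlMr; last by lra.
by have := nr_ge0 (h - lincomb (fun i => a (k i)) c); nra.
Qed.

End IsometryExtension.

(** * Lower bounds from closed range *)

Section BoundedBelow.
Context {R : realType} {H : hilbertType R} {m : nat}.
Local Notation C := R[i].
Local Notation space := 'rV[C^o]_m.
Variables (n : nat) (O : set space) (T : 'I_m -> {linear H -> H}).
Hypothesis BT : class_B n O T.
Implicit Types (z v : space) (h x y : H).

Lemma sub_op_lin z i : linear_on (sub_op T z i).
Proof.
move=> c x y; rewrite /sub_op linearP scalerDr scalerBr opprD !scalerA [in c * _]mulrC.
by rewrite addrACA.
Qed.

Lemma sub_opD z i x y : sub_op T z i (x + y) = sub_op T z i x + sub_op T z i y.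
Proof. by have := sub_op_lin z i 1 x y; rewrite !scale1r. Qed.

Lemma sub_op0 z i : sub_op T z i 0 = 0.
Proof. by rewrite /sub_op linear0 scaler0 subrr. Qed.

Lemma sub_opZ z i c x : sub_op T z i (c *: x) = c *: sub_op T z i x.
Proof. by have := sub_op_lin z i c x 0; rewrite sub_op0 !addr0. Qed.

Lemma sub_opN z i x : sub_op T z i (- x) = - sub_op T z i x.
Proof. by rewrite -scaleN1r sub_opZ scaleN1r. Qed.

Lemma sub_opB z i x y : sub_op T z i (x - y) = sub_op T z i x - sub_op T z i y.
Proof. by rewrite sub_opD sub_opN. Qed.

Lemma sub_op_sum z i I (r : seq I) (P : pred I) (F : I -> H) :
  sub_op T z i (\sum_(j <- r | P j) F j) = \sum_(j <- r | P j) sub_op T z i (F j).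
Proof.
apply: (big_ind2 (fun a b => sub_op T z i a = b)) => //; first exact: sub_op0.
by move=> a _ b _ <- <-; exact: sub_opD.
Qed.

Lemma sub_op_shift z v i x :
  sub_op T z i x = sub_op T v i x + ((v 0 i : C) - z 0 i) *: x.
Proof. by rewrite /sub_op scalerBl addrA subrK. Qed.

Definition defect z x : R := \sum_i nr (sub_op T z i x).

Lemma defectD z x y : defect z (x + y) <= defect z x + defect z y.
Proof.
by rewrite /defect -big_split /=; apply: ler_sum => i _; rewrite sub_opD nrD.
Qed.

Lemma defectZ z c x : defect z (c *: x) = cmod c * defect z x.
Proof.
by rewrite /defect mulr_sumr; apply: eq_bigr => i _; rewrite sub_opZ nrZ.
Qed.

Lemma sub_op_defect z i x : nr (sub_op T z i x) <= defect z x.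
Proof.
by rewrite /defect (bigD1 i) //= lerDl sumr_ge0 // => j _; exact: nr_ge0.
Qed.

Lemma defect_bounded z : exists M, forall x, defect z x <= M * nr x.
Proof.
have /choice[f hf] : forall i, exists M, forall x, nr (sub_op T z i x) <= M * nr x.
  move=> i; have [M _ hM] := bounded_operator_nr (class_B_bounded BT i).
  exists (M + cmod (z 0 i)) => x; apply: le_trans (nrB _ _) _.
  by rewrite nrZ mulrDl lerD2r.
by exists (\sum_i f i) => x; rewrite mulr_suml; apply: ler_sum => i _; exact: hf.
Qed.

Lemma closed_range_limit z (y : 'I_m -> H) : O z ->
  (forall e : R, 0 < e -> exists h, forall i, nr (sub_op T z i h - y i) < e) ->
  exists x, forall i, sub_op T z i x = y i.
Proof.
move=> Oz lim_y.
have /(_ (\row_i y i))[] := class_B_closed BT Oz.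
  move=> B /nbhs_ballP[e /= e0 eB].
  have eE : e = (complex.Re e)%:C%C by rewrite RRe_real // gtr0_real.
  have [|h hh] := lim_y (complex.Re e); first by rewrite -ltcR -eE.
  exists (\row_i sub_op T z i h); split; first by exists h.
  apply: eB; split=> // i j; rewrite !mxE -ball_normE /= nrE eE ltcR nrC; exact: hh.
move=> x _ /rowP xy; exists x => i; have := xy i; by rewrite !mxE.
Qed.

Lemma joint_ker_defect z x : defect z x = 0 -> joint_ker T z x.
Proof.
move=> /eqP; rewrite psumr_eq0; last by move=> i _; exact: nr_ge0.
by move=> /allP h i; have /eqP/nr_eq0 := h i (mem_index_enum i).
Qed.

(** Closed range makes the seminorm [defect T z] complete, so [open_mapping] gives [y] with
    [nr y <= c * defect T z x] that differs from [x] by an element of the joint kernel. As [x] is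
    orthogonal to this kernel, [inner x x = inner x y], and Cauchy-Schwarz gives [nr x <= nr y]. *)
Lemma bounded_below z : O z -> exists2 c : R, 0 < c &
  forall x, (forall y, joint_ker T z y -> inner x y = 0) -> nr x <= c * defect z x.
Proof.
move=> Oz; have [M hM] := defect_bounded z.
have [|c c0 hc] := open_mapping (@defectD z) (@defectZ z) _ hM.
- move=> u cu.
  have /choice[y hy] : forall i, exists l, forall e, 0 < e ->
      exists N, forall a, (N <= a)%N -> nr (sub_op T z i (u a) - l) < e.
    move=> i; apply: nr_Cauchy => e /cu[N hN]; exists N => a b Na Nb.
    by rewrite -sub_opB; apply: le_lt_trans (sub_op_defect _ _ _) (hN a b Na Nb).
  have approx (e : R) : 0 < e -> exists N, forall a, (N <= a)%N ->
      forall i, nr (sub_op T z i (u a) - y i) < e.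
    move=> e0; have /choice[N hN] : forall i, exists N, forall a, (N <= a)%N ->
        nr (sub_op T z i (u a) - y i) < e by move=> i; exact: hy.
    exists (\max_i N i)%N => a Na i; apply: hN; apply: leq_trans Na.
    exact: (leq_bigmax i).
  have [l hl] : exists x, forall i, sub_op T z i x = y i.
    apply: closed_range_limit => // e /approx[N hN]; exists (u N) => i.
    exact: hN.
  exists l => e e0; have [|N hN] := approx (e / m.+1%:R).
    by rewrite divr_gt0 // ltr0n.
  exists N => a Na; apply: (@le_lt_trans _ _ (\sum_(i < m) e / m.+1%:R)).
    by apply: ler_sum => i _; rewrite sub_opB hl; exact/ltW/hN.
  rewrite sumr_const card_ord -[_ *+ m]mulr_natr -mulrA gtr_pMr // mulrC ltr_pdivrMr ?ltr0n //.
  by rewrite mul1r ltr_nat.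
- exists c => // x xE; have [y [hy1 /joint_ker_defect hy2]] := hc x.
  apply: le_trans hy1; have := xE _ hy2; rewrite innerBr => /eqP.
  rewrite subr_eq0 inner_nr => /eqP h.
  have := Cauchy_Schwarz x y; rewrite -h cmodr ger0_norm ?sqr_ge0 // expr2.
  have [x0|x0] := eqVneq (nr x) 0; first by rewrite x0 nr_ge0.
  by rewrite ler_pM2l // lt_neqAle eq_sym x0 nr_ge0.
Qed.

End BoundedBelow.

(** * Taylor coefficients of holomorphic frames *)

Lemma sum_pred1_seq (V : nmodType) (A : eqType) (s : seq A) (x : A) (F : A -> V) :
  uniq s -> x \in s -> \sum_(y <- s | y == x) F y = F x.
Proof.
move=> us xs; rewrite big_mkcond (bigD1_seq x) //= eqxx big1 ?addr0 //.
by move=> y /negPf ->.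
Qed.

Section Jets.
Context {R : realType} {H : hilbertType R} {m : nat}.
Local Notation C := R[i].
Local Notation space := 'rV[C^o]_m.
Variables (n : nat) (O : set space) (T : 'I_m -> {linear H -> H}).
Variable b : space -> 'I_n -> H.
Implicit Types (z v : space) (h x y : H) (I J K : multi_index m) (i j : 'I_m)
  (p q r : 'I_n).

(** Expanding the eigenvector equations of a holomorphic frame in powers of [v - z] gives these
    equations on its coefficients. They fix [u] up to the joint kernel, and orthogonality to the
    basis fixes it entirely. *)
Fixpoint jet_rec z (k : nat) I q : H :=
  if k is k'.+1 then
    xget 0 [set u | (forall i, sub_op T z i u =
              if I i == 0%N then 0 else jet_rec z k' (msub I (mone i)) q)
            /\ forall p, inner u (b z p) = 0]
  else b z q.

(* [jet z I] is the Taylor coefficient of index [I], at the point [z], of the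
   holomorphic frame that extends the basis [b z] and whose components in the
   fibre over [z] are constant. *)
Definition jet z I q : H := jet_rec z (mdeg I) I q.

Definition jet_ok z I : Prop := forall q,
  (forall i, sub_op T z i (jet z I q) =
     if I i == 0%N then 0 else jet z (msub I (mone i)) q)
  /\ (I != midx0 -> forall p, inner (jet z I q) (b z p) = 0).

Lemma jet0 z q : jet z midx0 q = b z q.
Proof. by rewrite /jet mdeg0. Qed.

Lemma jetE z I q : I != midx0 -> jet z I q =
  xget 0 [set u | (forall i, sub_op T z i u =
            if I i == 0%N then 0 else jet z (msub I (mone i)) q)
          /\ forall p, inner u (b z p) = 0].
Proof.
move=> I0; have [k Ik] : exists k, mdeg I = k.+1.
  by exists (mdeg I).-1; rewrite prednK // lt0n mdeg_eq0.
rewrite {1}/jet Ik /=; congr xget; apply/seteqP; split => u [h1 h2]; split=> // i;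
  rewrite h1; case: eqP => // /eqP Ii; rewrite /jet;
  by have := mdeg_msub1 Ii; rewrite Ik => -[->].
Qed.

Definition overlap z v : 'M[C]_n := \matrix_(p, q) inner (b v q) (b z p).

(** The bases [b v] are chosen point by point, without continuity. The inverse overlap changes the
    basis over [v] so that [frame z v midx0] pairs with [b z] to the identity, and this makes the
    coefficients comparable with those at [z]. *)
Definition frame z v I q : H := lincomb (jet v I) (fun p => invmx (overlap z v) p q).

Definition dist z v : R := \sum_i cmod ((v 0 i : C) - z 0 i).

Lemma dist_ge0 z v : 0 <= dist z v.
Proof. by apply: sumr_ge0 => i _; exact: cmod_ge0. Qed.

Lemma frame0E z v q : frame z v midx0 q = lincomb (b v) (fun p => invmx (overlap z v) p q).
Proof. by congr lincomb; apply/funext => p; rewrite jet0. Qed.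

Hypothesis BT : class_B n O T.
Hypothesis b_onb : forall z, O z -> onb (b z).
Hypothesis b_ker : forall z, O z -> joint_ker T z = range (lincomb (b z)).

Lemma sub_op_b z i q : O z -> sub_op T z i (b z q) = 0.
Proof.
move=> Oz; suff : joint_ker T z (b z q) by exact.
rewrite b_ker //; exists (fun p => (p == q)%:R) => //.
rewrite /lincomb (bigD1 q) //= eqxx scale1r big1 ?addr0 // => p /negPf ->.
exact: scale0r.
Qed.

Lemma sub_op_lincomb_b z i c : O z -> sub_op T z i (lincomb (b z) c) = 0.
Proof.
by move=> Oz; rewrite sub_op_sum big1 // => q _; rewrite sub_opZ sub_op_b // scaler0.
Qed.

(** [bounded_below] applies to [u] minus its projection on the joint kernel. The estimates for
    frames rest on this inequality: the equations of a frame control the defect, its normalization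
    the pairings. *)
Lemma norm_control z : O z -> exists2 c : R, 0 < c & forall u,
  nr u <= c * defect T z u + \sum_p cmod (inner u (b z p)).
Proof.
move=> Oz; have [c c0 hc] := bounded_below BT Oz; exists c => // u.
set w := lincomb (b z) (fun p => inner u (b z p)).
have := hc (u - w); have -> : defect T z (u - w) = defect T z u.
  by apply: eq_bigr => i _; rewrite sub_opB sub_op_lincomb_b // subr0.
move=> h; have {}h : nr (u - w) <= c * defect T z u.
  apply: h => y; rewrite b_ker // => -[d _ <-].
  by apply: orth_lincomb => i; exact: onb_orth (b_onb Oz).
have := nrD (u - w) w; rewrite subrK; have : nr w <= _ := nr_lincomb _ (b_onb Oz).
by lra.
Qed.

Lemma jet_ok0 z : O z -> jet_ok z midx0.
Proof.
move=> Oz q; split=> [i|]; last by rewrite eqxx.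
by rewrite jet0 sub_op_b // ffunE.
Qed.

Lemma jet_okI z I : O z -> I != midx0 ->
  (forall q, exists u, forall i, sub_op T z i u =
     if I i == 0%N then 0 else jet z (msub I (mone i)) q) -> jet_ok z I.
Proof.
move=> Oz I0 ex_u q; have [u hu] := ex_u q; rewrite jetE //.
set P := [set u | _]; suff /xgetPex : exists w, P w by move/(_ 0) => [].
exists (u - lincomb (b z) (fun p => inner u (b z p))); split=> [i|p].
  by rewrite sub_opB sub_op_lincomb_b // subr0.
exact: onb_orth (b_onb Oz).
Qed.

Section AtPoint.
Variables (z : space) (c : R).
Hypothesis Oz : O z.
Hypothesis c_gt0 : 0 < c.
Hypothesis hc : forall u, nr u <= c * defect T z u + \sum_p cmod (inner u (b z p)).

(** In [frame_near] the norm of the frame returns on the right with coefficient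
    [c * dist z v + n * (2 * c * dist z v)]. The condition says that this is at most one half, so
    the term can be absorbed. *)
Definition nearby v := O v /\ (2 * c + 4 * c * n%:R) * dist z v <= 1.

Lemma nearby_dist v : nearby v -> c * dist z v <= 2^-1.
Proof.
move=> [_ h]; have := dist_ge0 z v; have := ler0n R n.
move: (n%:R) (dist z v) h => k d h k0 d0.
have : 0 <= c * k * d by rewrite !mulr_ge0 // ltW.
by nra.
Qed.

(** A vector [y] of the fibre over [v] that is orthogonal to [b z] has defect [dist z v * nr y] at
    [z]; so its norm is at most half of itself. *)
Lemma overlap_unit v : nearby v -> overlap z v \in unitmx.
Proof.
move=> cl; have [Ov _] := cl; have cd := nearby_dist cl.
rewrite -unitmx_tr -row_free_unit; apply: inj_row_free => u uA.
pose y := lincomb (b v) (u 0).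
have yb p : inner y (b z p) = 0.
  have := congr1 (fun w : 'rV[C]_n => w 0 p) uA; rewrite !mxE => <-.
  by rewrite inner_suml; apply: eq_bigr => q _; rewrite innerZl !mxE.
have dy : defect T z y = dist z v * nr y.
  rewrite /defect /dist mulr_suml; apply: eq_bigr => i _.
  by rewrite (sub_op_shift _ z v) sub_op_lincomb_b // add0r nrZ.
have y0 : y = 0.
  apply: nr_eq0; have := hc y; rewrite dy big1 => [|p _]; last by rewrite yb cmod0.
  have := nr_ge0 y; nra.
apply/rowP => q; rewrite mxE -(onb_coord (u 0) q (b_onb Ov)).
by rewrite -/y y0 inner0l.
Qed.

Lemma inner_frame0 v p q : nearby v -> inner (frame z v midx0 q) (b z p) = (p == q)%:R.
Proof.
move=> cl; have := mulmxV (overlap_unit cl).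
move=> /matrixP/(_ p q); rewrite !mxE => <-.
rewrite frame0E inner_suml; apply: eq_bigr => r _.
by rewrite innerZl mxE mulrC.
Qed.

Lemma sub_op_frame v I q i : jet_ok v I -> sub_op T v i (frame z v I q) =
  if I i == 0%N then 0 else frame z v (msub I (mone i)) q.
Proof.
move=> ok; rewrite /frame (linear_on_lincomb _ _ (sub_op_lin T v i)).
case: eqP => Ii; last first.
  by congr lincomb; apply/funext => p; have [-> _] := ok p; case: eqP.
rewrite /lincomb big1 // => p _; have [-> _] := ok p.
by rewrite Ii eqxx scaler0.
Qed.

Lemma frame_orth v I p q : jet_ok v I -> I != midx0 ->
  inner (frame z v I q) (frame z v midx0 p) = 0.
Proof.
move=> ok I0; rewrite frame0E; apply: orth_lincomb => r.
rewrite /frame inner_suml big1 // => s _; rewrite innerZl.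
by have [_ ->] := ok s; rewrite // mulr0.
Qed.

Lemma defect_le (f : 'I_m -> R) u : (forall i, nr (sub_op T z i u) <= f i) ->
  defect T z u <= \sum_i f i.
Proof. by move=> h; apply: ler_sum => i _; exact: h. Qed.

Lemma frame0_near v q : nearby v ->
  nr (frame z v midx0 q - b z q) <= 2 * c * dist z v.
Proof.
move=> cl; have [Ov _] := cl; set u := _ - _.
have ub p : inner u (b z p) = 0.
  rewrite innerBl inner_frame0 // (b_onb Oz) [p == q]eq_sym subrr //.
have du : defect T z u = dist z v * nr (frame z v midx0 q).
  rewrite /defect /dist mulr_suml; apply: eq_bigr => i _.
  rewrite sub_opB sub_op_b // subr0 (sub_op_shift _ z v) sub_op_frame; last exact: jet_ok0.
  by rewrite ffunE eqxx add0r nrZ.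
have := hc u; rewrite du big1 => [|p _]; last by rewrite ub cmod0.
have : nr (frame z v midx0 q) <= nr u + 1.
  by rewrite -(onb_nr q (b_onb Oz)) -{1}(subrK (b z q) (frame z v midx0 q)) nrD.
have := nearby_dist cl; have := dist_ge0 z v; have := nr_ge0 u.
move: (dist z v) (nr u) (nr _) => d a f; rewrite addr0 => *.
have : 0 <= c * d by rewrite mulr_ge0 // ltW.
by nra.
Qed.

Definition jets_up_to k := forall v I, O v -> (mdeg I <= k)%N -> jet_ok v I.

(** Induction on the degree. The defect of the difference involves lower coefficients, already
    estimated, and terms of size [dist z v]. Its pairings with [b z] are small because the frame
    coefficient is orthogonal to [frame z v midx0], which is close to [b z]. *)
Lemma frame_near k I q : jets_up_to k -> (mdeg I <= k)%N ->
  exists2 B : R, 0 <= B & forall v, nearby v -> nr (frame z v I q - jet z I q) <= B * dist z v.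
Proof.
move=> ok; move: {2}(mdeg I) (erefl (mdeg I)) => d; elim: d I => [|d IH] I Id Ik.
  have -> : I = midx0 by apply/eqP; rewrite -mdeg_eq0 Id.
  by exists (2 * c) => [|v cl]; [by rewrite mulr_ge0 ?ltW|rewrite jet0; exact: frame0_near].
have I0 : I != midx0 by rewrite -mdeg_eq0 Id.
have /choice[B hB] : forall i, exists B : R, 0 <= B /\ forall v, nearby v ->
    nr (if I i == 0%N then 0 else
      frame z v (msub I (mone i)) q - jet z (msub I (mone i)) q) <= B * dist z v.
  move=> i; case: eqP => [_|/eqP Ii].
    by exists 0; split=> // v _; rewrite nr0 mul0r.
  have dI := mdeg_msub1 Ii; rewrite Id in dI; move: dI => [dI].
  have [|B B0 hB] := IH (msub I (mone i)) dI; first by rewrite dI; apply: leq_trans Ik; rewrite Id.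
  by exists B.
pose s := \sum_i B i; have s0 : 0 <= s by apply: sumr_ge0 => i _; have [] := hB i.
have e0 := nr_ge0 (jet z I q).
have nR := ler0n R n.
exists (2 * c * s + (2 * c + 4 * c * n%:R) * nr (jet z I q)) => [|v cl].
  by rewrite addr_ge0 // !mulr_ge0 // ?addr_ge0 ?mulr_ge0 // ltW.
have [Ov hv] := cl; set u := _ - _.
have okv : jet_ok v I by apply: ok.
have okz : jet_ok z I by apply: ok.
have du : defect T z u <= s * dist z v + dist z v * nr (frame z v I q).
  have -> : s * dist z v + dist z v * nr (frame z v I q) =
      \sum_i (B i * dist z v + cmod ((v 0 i : C) - z 0 i) * nr (frame z v I q)).
    by rewrite big_split /= -!mulr_suml.
  apply: defect_le => i.
  rewrite sub_opB (sub_op_shift _ z v) sub_op_frame //.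
  have [-> _] := okz q.
  have -> : (if I i == 0%N then 0 else frame z v (msub I (mone i)) q) +
      ((v 0 i : C) - z 0 i) *: frame z v I q -
      (if I i == 0%N then 0 else jet z (msub I (mone i)) q) =
      (if I i == 0%N then 0 else frame z v (msub I (mone i)) q - jet z (msub I (mone i)) q)
      + ((v 0 i : C) - z 0 i) *: frame z v I q.
    by case: eqP => _; rewrite ?subr0 // addrAC.
  apply: le_trans (nrD _ _) _; rewrite nrZ lerD2r.
  by have [_ /(_ v cl)] := hB i.
have ub p : cmod (inner u (b z p)) <= nr (frame z v I q) * (2 * c * dist z v).
  have -> : inner u (b z p) = inner (frame z v I q) (b z p - frame z v midx0 p).
    have [_ /(_ I0 p) jb] := okz q.
    by rewrite innerBl jb subr0 innerBr frame_orth // subr0.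
  apply: le_trans (Cauchy_Schwarz _ _) _.
  by rewrite ler_wpM2l ?nr_ge0 // nrC; exact: frame0_near.
have su : \sum_p cmod (inner u (b z p)) <=
    n%:R * (nr (frame z v I q) * (2 * c * dist z v)).
  apply: (@le_trans _ _ (\sum_(p < n) nr (frame z v I q) * (2 * c * dist z v))).
    by apply: ler_sum => p _; exact: ub.
  by rewrite sumr_const card_ord -[_ *+ n]mulr_natl.
have fu : nr (frame z v I q) <= nr u + nr (jet z I q).
  by rewrite -{1}(subrK (jet z I q) (frame z v I q)) nrD.
have ha := le_trans (hc u) (lerD (ler_wpM2l (ltW c_gt0) du) su).
move: (nr_ge0 u) (dist_ge0 z v) (nr_ge0 (frame z v I q)) hv e0 fu nR ha.
move: (dist z v) (nr u) (nr (frame z v I q)) (nr (jet z I q)) (n%:R)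
  => d' a f e k' a0 d0 f0 hv e0 fu nR ha.
have cd : 0 <= c * d' by rewrite mulr_ge0 // ltW.
have ckd : 0 <= c * d' * k' by rewrite mulr_ge0.
have h1 : a <= c * s * d' + (c * d' + 2 * (c * d' * k')) * f by nra.
have h2 : (c * d' + 2 * (c * d' * k')) * f <= (c * d' + 2 * (c * d' * k')) * (a + e).
  by rewrite ler_wpM2l // addr_ge0 // mulr_ge0.
have h3 : (c * d' + 2 * (c * d' * k')) <= 2^-1 by nra.
have h4 : (c * d' + 2 * (c * d' * k')) * a <= 2^-1 * a by rewrite ler_wpM2r.
nra.
Qed.

Definition gram v K L : 'M[C]_n := \matrix_(p, q) inner (jet v K q) (jet v L p).

(* The derivative at [t = 0] of [frame z (ray z j a t) I]. *)
Definition frame_der (a : C) j I q : H :=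
  (a * (I j).+1%:R) *: jet z (madd I (mone j)) q
  - a^* *: \sum_(K <- mbelow I) lincomb (jet z (msub I K)) (fun p => gram z K (mone j) p q).

(** These are the equations of [sub_op_frame] differentiated along the ray; the extra term comes
    from the moving point. Together with [frame_der_orth] they determine the derivative. *)
Lemma sub_op_frame_der k a j I q i : jets_up_to k -> (mdeg I < k)%N ->
  sub_op T z i (frame_der a j I q) =
  (if I i == 0%N then 0 else frame_der a j (msub I (mone i)) q)
  + (a * (i == j)%:R) *: jet z I q.
Proof.
move=> ok Ik; have okj K : (mdeg K <= k)%N -> jet_ok z K by exact: ok.
have E1 : sub_op T z i ((a * (I j).+1%:R) *: jet z (madd I (mone j)) q) =
    (if I i == 0%N then 0 else (a * (msub I (mone i) j).+1%:R) *:
       jet z (madd (msub I (mone i)) (mone j)) q) + (a * (i == j)%:R) *: jet z I q.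
  have [hj _] := okj (madd I (mone j)) ltac:(by rewrite mdegD mdeg1 addn1) q.
  rewrite sub_opZ hj !ffunE; have [->|ij] := eqVneq i j.
    rewrite addn1 /= maddK mulr1; case: eqP => [->|/eqP Ij]; first by rewrite add0r mulr1.
    rewrite msubK // -scalerDl ?eqxx /= subn1 prednK ?lt0n //.
    by rewrite -[(I j).+1%:R]natr1 mulrDr mulr1.
  rewrite addn0 /= mulr0 scale0r addr0; case: eqP => [_|/eqP Ii]; first by rewrite scaler0.
  rewrite subn0; congr (_ *: jet z _ q).
  apply/ffunP => l; rewrite !ffunE; have [->|li] := eqVneq l i.
    by rewrite (negPf ij) !addn0.
  by rewrite !subn0.
have E2 : sub_op T z i (\sum_(K <- mbelow I)
      lincomb (jet z (msub I K)) (fun p => gram z K (mone j) p q)) =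
    if I i == 0%N then 0 else \sum_(K <- mbelow (msub I (mone i)))
      lincomb (jet z (msub (msub I (mone i)) K)) (fun p => gram z K (mone j) p q).
  have E3 K : K \in mbelow I -> sub_op T z i
      (lincomb (jet z (msub I K)) (fun p => gram z K (mone j) p q)) =
      if (K i < I i)%N then lincomb (jet z (msub (msub I (mone i)) K))
        (fun p => gram z K (mone j) p q) else 0.
    move=> KI; rewrite (linear_on_lincomb _ _ (sub_op_lin T z i)).
    have dK : (mdeg (msub I K) <= k)%N by apply: leq_trans (mdeg_msub _ _) (ltnW Ik).
    have -> : (fun p => sub_op T z i (jet z (msub I K) p)) = fun p =>
        if (K i < I i)%N then jet z (msub (msub I (mone i)) K) p else 0.
      apply/funext => p; have [-> _] := okj _ dK p.
      rewrite ffunE subn_eq0 leqNgt; case: ltnP => //= _; congr (jet z _ p).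
      by apply/ffunP => l; rewrite !ffunE subnAC.
    case: ifP => // _; rewrite /lincomb big1 // => p _; exact: scaler0.
  rewrite sub_op_sum big_seq (eq_bigr _ E3) -big_seq -big_mkcond /=.
  case: eqP => [Ii|/eqP Ii]; first by rewrite big1 // => K; rewrite Ii.
  by rewrite -big_filter; apply: perm_big; exact: mbelow_msub1.
rewrite /frame_der sub_opB E1 sub_opZ E2.
by case: eqP => _; rewrite ?scaler0 ?subr0 // addrAC.
Qed.

(** This is what differentiating the orthogonality of [frame z v I] and [frame z v midx0] predicts:
    the moving second factor contributes [jet z (mone j)], with [a] conjugated. For [I = midx0] the
    pairings with [b z] are constant. *)
Lemma frame_der_orth k a j I p q : jets_up_to k -> (mdeg I < k)%N ->
  inner (frame_der a j I q) (b z p) =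
  if I == midx0 then 0 else - a^* * gram z I (mone j) p q.
Proof.
move=> ok Ik; have okj K : (mdeg K <= k)%N -> jet_ok z K by exact: ok.
have [_ jb] := okj (madd I (mone j)) ltac:(by rewrite mdegD mdeg1 addn1) q.
have nz : madd I (mone j) != midx0 by rewrite -mdeg_eq0 mdegD mdeg1 addn1.
rewrite /frame_der innerBl !innerZl jb // mulr0 sub0r inner_suml.
have E K : K \in mbelow I -> inner (lincomb (jet z (msub I K))
    (fun r => gram z K (mone j) r q)) (b z p) =
    if K == I then gram z K (mone j) p q else 0.
  rewrite mem_mbelow => /andP[KI K0]; case: eqP => [->|/eqP nKI].
    rewrite msubb (_ : lincomb _ _ = lincomb (b z) (fun r => gram z I (mone j) r q)).
      by rewrite onb_coord //; exact: b_onb.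
    by congr lincomb; apply/funext => r; rewrite jet0.
  have dK : (mdeg (msub I K) <= k)%N by apply: leq_trans (mdeg_msub _ _) (ltnW Ik).
  rewrite inner_suml big1 // => r _; rewrite innerZl.
  have [_ ->] := okj _ dK r; first by rewrite mulr0.
  apply: contra nKI => /eqP/ffunP h; apply/eqP/ffunP => l; apply/eqP.
  have := h l; rewrite !ffunE => /eqP; rewrite subn_eq0 eqn_leq => ->.
  by rewrite andbT; move/mleP: KI.
rewrite big_seq (eq_bigr _ E) -big_seq -big_mkcond /=.
case: eqP => [->|/eqP I0].
  rewrite big_seq_cond big1 ?mulr0 ?oppr0 // => K.
  by rewrite mem_mbelow => /andP[/andP[_ K0] /eqP KI]; rewrite KI eqxx in K0.
by rewrite sum_pred1_seq ?mbelow_uniq ?mem_mbelow ?mle_refl ?mulNr.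
Qed.

Lemma ray_coord j a t i : (ray z j a t 0 i : C) - z 0 i = t%:C%C * a * (i == j)%:R.
Proof. by rewrite !mxE eqxx /= [LHS]addrC addKr. Qed.

Lemma dist_ray j a t : dist z (ray z j a t) = `|t| * cmod a.
Proof.
rewrite /dist (bigD1 j) //= ray_coord eqxx mulr1 cmodM cmodr big1 ?addr0 // => i /negPf ij.
by rewrite ray_coord ij mulr0 cmod0.
Qed.

Lemma frame_bounded k I q : jets_up_to k -> (mdeg I <= k)%N ->
  exists2 B : R, 0 <= B & forall v, nearby v -> nr (frame z v I q) <= B.
Proof.
move=> ok Ik; have [B B0 hB] := frame_near q ok Ik.
exists (B * (2 * c)^-1 + nr (jet z I q)) => [|v cl].
  by rewrite addr_ge0 ?nr_ge0 // mulr_ge0 // invr_ge0 mulr_ge0 // ltW.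
have := nrD (frame z v I q - jet z I q) (jet z I q); rewrite subrK => /le_trans; apply.
rewrite lerD2r; apply: le_trans (hB v cl) _; rewrite ler_wpM2l //.
by rewrite invfM ler_pdivlMr // mulrC; exact: nearby_dist.
Qed.

Lemma frame0_der_near k a j q : jets_up_to k -> (0 < k)%N ->
  exists2 B : R, 0 <= B & forall t : R, nearby (ray z j a t) ->
    nr (frame z (ray z j a t) midx0 q - b z q - (t%:C%C * a) *: jet z (mone j) q)
      <= B * t ^+ 2.
Proof.
move=> ok k0; have ok1 : jet_ok z (mone j) by apply: ok => //; rewrite mdeg1.
exists (2 * c * (c * (cmod a ^+ 2))).
  by do ?[apply: mulr_ge0]; rewrite ?sqr_ge0 ?cmod_ge0 //; exact: ltW.
move=> t cl; set v := ray z j a t in cl *; set u := _ - _ - _.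
have [Ov _] := cl.
have ub p : inner u (b z p) = 0.
  have [_ jb] := ok1 q; rewrite !innerBl innerZl jb ?mone_neq0 // mulr0 subr0.
  by rewrite inner_frame0 // (b_onb Oz) [p == q]eq_sym subrr.
have du : defect T z u <= `|t| * cmod a * (2 * c * (`|t| * cmod a)).
  have su i : nr (sub_op T z i u) <=
      if i == j then `|t| * cmod a * (2 * c * (`|t| * cmod a)) else 0.
    have [js _] := ok1 q.
    rewrite !sub_opB sub_opZ js sub_op_b // subr0 (sub_op_shift _ z v).
    rewrite sub_op_frame; last exact: jet_ok0.
    rewrite ffunE eqxx add0r ray_coord ffunE.
    case: (eqVneq i j) => [->|_]; last by rewrite mulr0 scale0r scaler0 subr0 nr0.
    rewrite /= mulr1 msubb jet0 -scalerBr nrZ cmodM cmodr.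
    rewrite ler_wpM2l ?mulr_ge0 ?cmod_ge0 //.
    by rewrite -(dist_ray j a t); exact: frame0_near.
  by apply: le_trans (defect_le su) _; rewrite -big_mkcond big_pred1_eq.
apply: le_trans (hc u) _; rewrite big1 => [|p _]; last by rewrite ub cmod0.
rewrite addr0; apply: le_trans (ler_wpM2l (ltW c_gt0) du) _.
rewrite -[t ^+ 2]real_normK ?num_real // le_eqVlt; apply/orP; left; apply/eqP.
by move: `|t| => s; ring.
Qed.

(** The defect of the error involves derivatives of lower coefficients only. So the estimate holds
    even in degree [k], where the derivative itself would involve jets of degree [k.+1] that are not
    yet available; [jets_exist] depends on this. *)
Lemma frame_defect_step k a j I q : jets_up_to k -> (mdeg I <= k)%N ->
  (forall i, I i != 0%N -> exists2 B : R, 0 <= B & forall t, nearby (ray z j a t) ->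
    nr (frame z (ray z j a t) (msub I (mone i)) q - jet z (msub I (mone i)) q
      - t%:C%C *: frame_der a j (msub I (mone i)) q) <= B * t ^+ 2) ->
  exists2 B : R, 0 <= B & forall t : R, nearby (ray z j a t) -> forall i,
    nr (sub_op T z i (frame z (ray z j a t) I q - jet z I q) - t%:C%C *:
        ((if I i == 0%N then 0 else frame_der a j (msub I (mone i)) q)
         + (a * (i == j)%:R) *: jet z I q)) <= B * t ^+ 2.
Proof.
move=> ok Ik lower.
have /choice[B hB] : forall i, exists B : R, 0 <= B /\ forall t, nearby (ray z j a t) ->
    nr (if I i == 0%N then 0 else
      frame z (ray z j a t) (msub I (mone i)) q - jet z (msub I (mone i)) q
        - t%:C%C *: frame_der a j (msub I (mone i)) q) <= B * t ^+ 2.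
  move=> i; case: eqP => [_|/eqP Ii].
    by exists 0; split=> // t _; rewrite nr0 mul0r.
  by have [B B0 hB] := lower i Ii; exists B.
have [F F0 hF] := frame_near q ok Ik.
have a0 := cmod_ge0 a.
pose A2 := cmod a ^+ 2; have A20 : 0 <= A2 by rewrite sqr_ge0.
have B0 i : 0 <= B i by have [] := hB i.
exists (\sum_i B i + A2 * F) => [|t cl i].
  by rewrite addr_ge0 ?mulr_ge0 // sumr_ge0.
set v := ray z j a t in cl *; have [Ov _] := cl.
have okv : jet_ok v I by exact: ok.
have okz : jet_ok z I by exact: ok.
have tt : t ^+ 2 = `|t| * `|t| by rewrite -[LHS]real_normK ?num_real.
have near_F : nr (frame z v I q - jet z I q) <= F * (`|t| * cmod a).
  by rewrite -(dist_ray j a t); exact: hF.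
have [jz _] := okz q.
rewrite sub_opB jz (sub_op_shift _ z v) sub_op_frame // ray_coord.
have -> : (if I i == 0%N then 0 else frame z v (msub I (mone i)) q) +
   (t%:C%C * a * (i == j)%:R) *: frame z v I q -
   (if I i == 0%N then 0 else jet z (msub I (mone i)) q) -
   t%:C%C *: ((if I i == 0%N then 0 else frame_der a j (msub I (mone i)) q) +
     (a * (i == j)%:R) *: jet z I q) =
   (if I i == 0%N then 0 else frame z v (msub I (mone i)) q
      - jet z (msub I (mone i)) q - t%:C%C *: frame_der a j (msub I (mone i)) q) +
   (t%:C%C * a * (i == j)%:R) *: (frame z v I q - jet z I q).
  have reorg (A X A' D Y : H) : A + X - A' - (D + Y) = A - A' - D + (X - Y).
    by rewrite opprD [A + X - A']addrAC addrACA.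
  rewrite scalerDr scalerA mulrA reorg -scalerBr.
  by case: eqP => _; rewrite ?scaler0 ?subr0.
apply: le_trans (nrD _ _) _; rewrite mulrDl; apply: lerD.
  have [_ /(_ t cl) h] := hB i; apply: le_trans h _; rewrite ler_wpM2r ?sqr_ge0 //.
  by rewrite (bigD1 i) //= lerDl sumr_ge0.
rewrite nrZ !cmodM cmodr; apply: (@le_trans _ _ (`|t| * cmod a * (F * (`|t| * cmod a)))).
  apply: ler_pM => //; rewrite ?nr_ge0 // ?mulr_ge0 ?cmod_ge0 //.
  by case: (i == j); rewrite ?cmod1 ?cmod0 ?mulr1 ?mulr0 ?mulr_ge0.
by rewrite tt /A2 le_eqVlt; apply/orP; left; apply/eqP; ring.
Qed.

Lemma frame_der_near k a j I q : jets_up_to k -> (mdeg I < k)%N ->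
  exists2 B : R, 0 <= B & forall t : R, nearby (ray z j a t) ->
    nr (frame z (ray z j a t) I q - jet z I q - t%:C%C *: frame_der a j I q) <= B * t ^+ 2.
Proof.
move=> ok; move: {2}(mdeg I) (erefl (mdeg I)) => d; elim: d I q => [|d IH] I q Id Ik.
  have -> : I = midx0 by apply/eqP; rewrite -mdeg_eq0 Id.
  have k0 : (0 < k)%N by exact: leq_ltn_trans Ik.
  have [B B0 hB] := frame0_der_near a j q ok k0; exists B => // t /hB.
  suff -> : frame_der a j midx0 q = a *: jet z (mone j) q by rewrite scalerA jet0.
  rewrite /frame_der ffunE mulr1 big_seq big1 ?scaler0 ?subr0 => [|K].
    by congr (_ *: jet z _ q); apply/ffunP => l; rewrite !ffunE.
  rewrite mem_mbelow => /andP[K1 /eqP[]]; apply/eqP; rewrite -mdeg_eq0 -leqn0.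
  by rewrite -[X in (_ <= X)%N](@mdeg0 m); exact: mle_deg.
have I0 : I != midx0 by rewrite -mdeg_eq0 Id.
have Ik' := ltnW Ik.
have [|s s0 hs] := frame_defect_step (a := a) (j := j) (q := q) ok Ik'.
  move=> i Ii; have dI := mdeg_msub1 Ii; rewrite Id in dI; move: dI => [dI].
  by apply: (IH (msub I (mone i)) q dI); rewrite dI; apply: leq_trans Ik; rewrite Id.
have [F F0 hF] := frame_near q ok Ik'.
have [G G0 hG] := frame_bounded q ok Ik'.
have k0 : (0 < k)%N by exact: leq_ltn_trans Ik.
have /choice[B' hB'] : forall p, exists B : R, 0 <= B /\ forall t, nearby (ray z j a t) ->
    nr (frame z (ray z j a t) midx0 p - b z p - (t%:C%C * a) *: jet z (mone j) p)
      <= B * t ^+ 2.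
  by move=> p; have [B0 B00 hB0] := frame0_der_near a j p ok k0; exists B0.
have a0 := cmod_ge0 a.
pose A2 := cmod a ^+ 2; have A20 : 0 <= A2 by rewrite sqr_ge0.
pose s' := \sum_p (G * B' p + A2 * F * nr (jet z (mone j) p)).
have s'0 : 0 <= s'.
  apply: sumr_ge0 => p _; have [B'0 _] := hB' p.
  by rewrite addr_ge0 // !mulr_ge0 // ?nr_ge0.
exists (c * (m%:R * s) + s') => [|t cl].
  by rewrite addr_ge0 // !mulr_ge0 // ltW.
set v := ray z j a t in cl *; set u := _ - _ - _; have [Ov _] := cl.
have okv : jet_ok v I by exact: ok.
have okz : jet_ok z I by exact: ok.
have tt : t ^+ 2 = `|t| * `|t| by rewrite -[LHS]real_normK ?num_real.
have near_F : nr (frame z v I q - jet z I q) <= F * (`|t| * cmod a).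
  by rewrite -(dist_ray j a t); exact: hF.
have du : defect T z u <= m%:R * s * t ^+ 2.
  have -> : m%:R * s * t ^+ 2 = \sum_(i < m) s * t ^+ 2.
    by rewrite sumr_const card_ord -[RHS]mulr_natl mulrA.
  apply: defect_le => i; have := hs t cl i.
  by rewrite /u [X in _ -> nr X <= _]sub_opB sub_opZ (sub_op_frame_der _ _ _ _ ok Ik).
have ub p : cmod (inner u (b z p)) <= (G * B' p + A2 * F * nr (jet z (mone j) p)) * t ^+ 2.
  (* By orthogonality to [frame z v midx0] the pairing splits into a term that [frame0_der_near]
     bounds to second order and [t] times a first-order error. *)
  have -> : inner u (b z p) =
     - inner (frame z v I q) (frame z v midx0 p - b z p - (t%:C%C * a) *: jet z (mone j) p)
     - (t%:C%C * a^*) * inner (frame z v I q - jet z I q) (jet z (mone j) p).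
    have [_ /(_ I0 p) jb] := okz q.
    rewrite !innerBr innerZr frame_orth // !innerBl innerZl jb.
    rewrite (frame_der_orth _ _ _ _ ok Ik) (negPf I0) mxE.
    have -> : (t%:C%C * a)^* = t%:C%C * a^*.
      by rewrite rmorphM; congr (_ * _); exact: conjc_real.
    ring.
  apply: le_trans (cmodD _ _) _; rewrite !cmodN !cmodM cmodr cmodJ mulrDl.
  apply: lerD.
    apply: le_trans (Cauchy_Schwarz _ _) _; rewrite -mulrA.
    by apply: ler_pM; rewrite ?nr_ge0 ?hG //; have [_ /(_ t cl)] := hB' p.
  apply: le_trans (ler_wpM2l _ (Cauchy_Schwarz _ _)) _; first by rewrite mulr_ge0.
  rewrite mulrA tt /A2.
  apply: (@le_trans _ _ (`|t| * cmod a * (F * (`|t| * cmod a)) * nr (jet z (mone j) p))).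
    by rewrite ler_wpM2r ?nr_ge0 // ler_wpM2l // mulr_ge0.
  by rewrite le_eqVlt; apply/orP; left; apply/eqP; ring.
have su : \sum_p cmod (inner u (b z p)) <= s' * t ^+ 2.
  by rewrite mulr_suml; apply: ler_sum => p _; exact: ub.
apply: le_trans (hc u) _; rewrite mulrDl; apply: lerD => //.
by rewrite -mulrA ler_wpM2l // ltW.
Qed.

Lemma frame_defect_der k a j I q : jets_up_to k -> (mdeg I <= k)%N ->
  exists2 B : R, 0 <= B & forall t : R, nearby (ray z j a t) -> forall i,
    nr (sub_op T z i (frame z (ray z j a t) I q - jet z I q) - t%:C%C *:
        ((if I i == 0%N then 0 else frame_der a j (msub I (mone i)) q)
         + (a * (i == j)%:R) *: jet z I q)) <= B * t ^+ 2.
Proof.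
move=> ok Ik; apply: (frame_defect_step ok Ik) => i Ii.
by apply: (frame_der_near a j q ok); rewrite mdeg_msub1.
Qed.

End AtPoint.

Hypothesis oO : open O.

Lemma near_dist z (e : R) : 0 < e -> \forall v \near z, dist z v < e.
Proof.
move=> e0; have e1 : 0 < e / m.+1%:R by rewrite divr_gt0 // ltr0n.
apply/nbhs_ballP; exists (e / m.+1%:R)%:C%C; first by rewrite /= ltcR.
move=> v [_ zv]; apply: (@le_lt_trans _ _ (\sum_(i < m) e / m.+1%:R)).
  apply: ler_sum => i _; rewrite -cmodN opprB ltW // -ltcR -cmodE.
  by have := zv 0 i; rewrite -ball_normE.
rewrite sumr_const card_ord -[_ *+ m]mulr_natr -mulrA gtr_pMr // mulrC.
by rewrite ltr_pdivrMr ?ltr0n // mul1r ltr_nat.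
Qed.

Lemma near_nearby z (c : R) : O z -> 0 < c -> \forall v \near z, nearby z c v.
Proof.
move=> Oz c0; have k0 : 0 < 2 * c + 4 * c * n%:R + 1.
  have : 0 <= 4 * c * n%:R by rewrite !mulr_ge0 // ltW.
  by lra.
have nO : \forall v \near z, O v by exact: open_nbhs_nbhs.
have nd : \forall v \near z, dist z v < (2 * c + 4 * c * n%:R + 1)^-1.
  by apply: near_dist; rewrite invr_gt0.
apply: filterS2 nO nd => v Ov dv; split=> //.
have := dist_ge0 z v; move: dv; rewrite -[_^-1]mul1r ltr_pdivlMr // => dv d0; nra.
Qed.

Lemma near_nearby_ray z (c : R) j a : O z -> 0 < c ->
  \forall t \near (0 : R)^', nearby z c (ray z j a t).
Proof. by move=> Oz c0; exact: (@ray_cvg _ _ z j a _ (near_nearby Oz c0)). Qed.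

(* The Taylor coefficients are produced one order at a time: difference
   quotients of the coefficients of lower order solve the equations for the next
   one up to a small error, and the operator tuple has closed range. *)
Lemma jets_exist k : jets_up_to k.
Proof.
elim: k => [|k IH] z I Oz.
  by rewrite leqn0 mdeg_eq0 => /eqP ->; exact: jet_ok0.
rewrite leq_eqVlt => /orP[/eqP Ik|]; last by rewrite ltnS; exact: IH.
have I0 : I != midx0 by rewrite -mdeg_eq0 Ik.
apply: jet_okI => // q; have [j Ij] := mdeg_gt0P I0.
pose J := msub I (mone j).
have IJ : madd J (mone j) = I by rewrite msubK.
have Jk : mdeg J = k by have := mdeg_msub1 Ij; rewrite Ik => -[].
apply: (closed_range_limit BT Oz) => e e0.
have [c c0 hc] := norm_control Oz.
(* The index [J] is one degree below [I]. [target] is the value of the operators on the expected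
   limit of [quot]; it involves jets of degree at most [k] only. *)
pose quot a t := t^-1%:C%C *: (frame z (ray z j a t) J q - jet z J q).
pose target a i := (if J i == 0%N then 0 else frame_der z a j (msub J (mone i)) q)
  + (a * (i == j)%:R) *: jet z J q.
have claim a : exists2 B : R, 0 <= B & forall t : R, t != 0 -> nearby z c (ray z j a t) ->
    forall i, nr (sub_op T z i (quot a t) - target a i) <= B * `|t|.
  have [|B B0 hB] := @frame_defect_der z c Oz c0 hc k a j J q IH; first by rewrite Jk.
  exists B => // t t0 cl i.
  have tC : t%:C%C != 0 :> C by apply: contra t0 => /eqP/complexI ->.
  have -> : sub_op T z i (quot a t) - target a i = t^-1%:C%C *:
     (sub_op T z i (frame z (ray z j a t) J q - jet z J q) - t%:C%C *: target a i).
    have tt : t^-1%:C%C * t%:C%C = 1 :> C by rewrite -rmorphM mulVf.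
    by rewrite sub_opZ [RHS]scalerBr [X in _ = _ - X]scalerA tt scale1r.
  rewrite nrZ cmodr normfV ler_pdivrMl ?normr_gt0 //.
  by rewrite mulrCA -expr2 real_normK ?num_real //; exact: hB.
have [B1 B10 h1] := claim 1; have [B2 B20 h2] := claim 'i.
have [t [t0 t1 t2 te]] : exists t : R, [/\ t != 0, nearby z c (ray z j 1 t),
    nearby z c (ray z j 'i t) & (B1 + B2 + 1) * `|t| < e].
  have ed : 0 < e / (B1 + B2 + 1) by rewrite divr_gt0 //; lra.
  have f1 := near_nearby_ray j 1 Oz c0; have f2 := near_nearby_ray j 'i Oz c0.
  have f3 : \forall t \near (0 : R)^', `|t| < e / (B1 + B2 + 1) := @dnbhs0_lt R R^o _ ed.
  have f4 : \forall t \near (0 : R)^', t != 0 by exact: nbhs_dnbhs_neq.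
  have [t [[[t0 cl1] cl2] te]] := filter_ex (filterI (filterI (filterI f4 f1) f2) f3).
  exists t; split=> //; rewrite mulrC -ltr_pdivlMr //.
  by rewrite ltr_wpDl // addr_ge0.
have jn : (J j).+1%:R != 0 :> C by rewrite pnatr_eq0.
(* The directions 1 and ['i] cancel the conjugate linear part; dividing by [(J j).+1] turns the
   derivative of the coefficient [J] into the coefficient [I]. *)
exists ((J j).+1%:R^-1 *: (2^-1 *: (quot 1 t - 'i *: quot 'i t))) => i.
have tgt : 2^-1 *: (target 1 i - 'i *: target 'i i) = (J j).+1%:R *:
    (if I i == 0%N then 0 else jet z (msub I (mone i)) q).
  have comb (s : C) (A D X : H) (d : C) (f : bool) :
      2^-1 *: ((if f then 0 else (1 * s) *: A - 1^* *: D) + (1 * d) *: X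
        - 'i *: ((if f then 0 else ('i * s) *: A - 'i^* *: D) + ('i * d) *: X)) =
      (if f then 0 else s *: A) + d *: X.
    have two (Y : H) : 2^-1 *: (Y + Y) = Y.
      by rewrite -mulr2n -[Y *+ 2]scaler_nat scalerA mulVf ?scale1r // pnatr_eq0.
    have ii : 'i * 'i = -1 :> C by rewrite -expr2 sqrCi.
    case: f; first by rewrite !add0r mul1r scalerA mulrA ii mulN1r scaleNr opprK two.
    have -> : 'i *: (('i * s) *: A - 'i^* *: D + ('i * d) *: X) = - (s *: A) - D - d *: X.
      rewrite scalerDr scalerBr !scalerA !mulrA ii conjCi mulrN ii opprK !mulN1r scale1r.
      by rewrite !scaleNr.
    rewrite conjC1 !mul1r scale1r -[RHS]two; congr (_ *: _).
    rewrite !opprD !opprK addrACA [RHS]addrACA; congr (_ + _).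
    by rewrite addrACA addNr addr0.
  rewrite /target /frame_der comb.
  have Ii : I i = (J i + (i == j))%N by rewrite -IJ !ffunE.
  have [ij|ij] := eqVneq i j.
    rewrite Ii ij eqxx addn1 /= scale1r -/J.
    case: eqP => [->|/eqP Jj]; first by rewrite add0r scale1r.
    rewrite (msubK Jj) [msub J (mone j) j]ffunE [mone j j]ffunE eqxx subn1 prednK ?lt0n //.
    by rewrite -[in RHS]natr1 scalerDl scale1r.
  rewrite Ii (negPf ij) addn0 scale0r addr0; case: eqP => [_|/eqP Ji].
    by rewrite scaler0.
  rewrite [msub J (mone i) j]ffunE [mone i j]ffunE [j == i]eq_sym (negPf ij) subn0; congr (_ *: jet z _ q).
  apply/ffunP => l; rewrite -IJ !ffunE.
  have [->|li] := eqVneq l i; last by rewrite !subn0.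
  by rewrite (negPf ij) !addn0.
have yE : (if I i == 0%N then 0 else jet z (msub I (mone i)) q) =
    (J j).+1%:R^-1 *: (2^-1 *: (target 1 i - 'i *: target 'i i)).
  by rewrite tgt scalerA mulVf // scale1r.
have reorg (A X D Y : H) (x : C) : A - x *: D - (X - x *: Y) = A - X - x *: (D - Y).
  by rewrite scalerBr !opprB addrACA [RHS]addrACA [- X + _]addrC.
rewrite yE 2!sub_opZ sub_opB [sub_op T z i ('i *: _)]sub_opZ -scalerBr -scalerBr reorg.
rewrite !nrZ; have n1 : cmod ((J j).+1%:R^-1 : C) <= 1.
  rewrite -(rmorph_nat (real_complex R)) -fmorphV cmodr ger0_norm ?invr_ge0 ?ler0n //.
  by rewrite invf_le1 ?ltr0n // ler1n.
have n2 : cmod (2^-1 : C) <= 1.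
  rewrite -(rmorph_nat (real_complex R)) -fmorphV cmodr ger0_norm ?invr_ge0 ?ler0n //.
  by rewrite invf_le1 // ler1n.
set u := _ - 'i *: _.
have hu : nr u <= (B1 + B2) * `|t|.
  apply: le_trans (nrB _ _) _; rewrite nrZ cmod_i mul1r mulrDl.
  by apply: lerD; [exact: h1|exact: h2].
have shrink (x N : R) : 0 <= x -> x <= 1 -> 0 <= N -> x * N <= N.
  by move=> *; exact: ler_piMl.
apply: (@le_lt_trans _ _ (nr u)).
  apply: le_trans (shrink _ _ (cmod_ge0 _) n1 _) _.
    by rewrite mulr_ge0 ?cmod_ge0 ?nr_ge0.
  exact: shrink (cmod_ge0 _) n2 (nr_ge0 _).
apply: le_lt_trans hu _; apply: le_lt_trans te.
by rewrite ler_wpM2r // lerDl.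
Qed.

End Jets.

Section HilbertLimits.
Context {R : realType} {H : hilbertType R} {A : Type} (F : set_system A) {FF : Filter F}.
Local Notation C := R[i].

Definition nr_lim (f : A -> H) (l : H) : Prop :=
  forall e : R, 0 < e -> \forall x \near F, nr (f x - l) < e.

Lemma nr_lim_cst l : nr_lim (fun=> l) l.
Proof. by move=> e e0; near=> x; rewrite subrr nr0.
Unshelve. all: by end_near. Qed.

Lemma inner_lim (f g : A -> H) k l : nr_lim f k -> nr_lim g l ->
  (fun x => inner (f x) (g x) : C^o) @ F --> (inner k l : C^o).
Proof.
move=> hf hg; apply/cvgrPdist_lt => e e0.
have eE : e = (complex.Re e)%:C%C by rewrite RRe_real // gtr0_real.
have r0 : 0 < complex.Re e by rewrite -ltcR -eE.
have := nr_ge0 k; have := nr_ge0 l => l0 k0.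
pose d : R := complex.Re e / (nr k + nr l + 2).
have d0 : 0 < d by rewrite divr_gt0 //; lra.
have h1 := hf _ d0; have h2 := hg _ d0; have h3 := hg 1 ltr01.
near=> x.
have e1 : nr (f x - k) < d by near: x.
have e2 : nr (g x - l) < d by near: x.
have e3 : nr (g x - l) < 1 by near: x.
rewrite eE -normrN opprB cmodE ltcR.
have -> : inner (f x) (g x) - inner k l = inner (f x - k) (g x) + inner k (g x - l).
  by rewrite innerBl innerBr addrA subrK.
apply: le_lt_trans (cmodD _ _) _.
have := Cauchy_Schwarz (f x - k) (g x); have := Cauchy_Schwarz k (g x - l).
have : nr (g x) <= nr l + 1.
  by have := nrD (g x - l) l; rewrite subrK => /le_trans; apply; rewrite addrC lerD2l ltW.
have dE : d * (nr k + nr l + 2) = complex.Re e by rewrite divfK // gt_eqF //; lra.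
have := nr_ge0 (f x - k); have := nr_ge0 (g x - l); have := nr_ge0 (g x).
move: (cmod _) (cmod _) (nr (f x - k)) (nr (g x - l)) (nr (g x)) e1 e2 e3 =>
  P Q X Y Z e1 e2 e3 Z0 Y0 X0 ZL hQ hP.
rewrite -dE; have : X * Z <= d * (nr l + 1) by apply: ler_pM => //; exact: ltW.
have : nr k * Y <= nr k * d by rewrite ler_wpM2l // ltW.
lra.
Unshelve. all: by end_near. Qed.

End HilbertLimits.

Lemma mx_lim_inv (K : numFieldType) (A : Type) (F : set_system A) {FF : Filter F} a
    (f : A -> 'M[K]_a) l :
  mx_lim F f l -> l \in unitmx -> mx_lim F (fun x => invmx (f x)) (invmx l).
Proof.
move=> hf lu; have dl := lu; rewrite unitmxE unitfE in dl.
have hd := mx_lim_det hf.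
have nz : \forall x \near F, \det (f x) != 0.
  have /cvgrPdist_lt/(_ `|\det l|) : (fun x => \det (f x) : K^o) @ F --> (\det l : K^o).
    exact: hd.
  rewrite normr_gt0 => /(_ dl); apply: filterS => x /=.
  by apply: contraTneq => ->; rewrite subr0 ltxx.
rewrite {2}/invmx lu.
have h : mx_lim F (fun x => (\det (f x))^-1 *: \adj (f x)) ((\det l)^-1 *: \adj l).
  apply: mx_limZ; last exact: mx_lim_adj.
  by apply: (@cvgV K) => //; exact: hd.
apply: mx_lim_eq h; apply: filterS nz => x fx.
by rewrite /invmx unitmxE unitfE fx.
Qed.

(** * Gram matrices of jets and their covariant derivatives *)

Section GramFrames.
Context {R : realType} {H : hilbertType R} {m n : nat}.
Local Notation C := R[i].
Local Notation space := 'rV[C^o]_m.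
Local Notation letter := (multi_index m * multi_index m)%type.
Variables (O : set space) (T : 'I_m -> {linear H -> H}) (b : space -> 'I_n.+1 -> H).
Hypothesis BT : class_B n.+1 O T.
Hypothesis b_onb : forall z, O z -> onb (b z).
Hypothesis b_ker : forall z, O z -> joint_ker T z = range (lincomb (b z)).
Hypothesis oO : open O.
Implicit Types (z v : space) (I J K : multi_index m) (p q r : 'I_n.+1).

Local Notation jet := (jet T b).
Local Notation frame := (frame T b).
Local Notation gram := (gram T b).
Local Notation frame_der := (frame_der T b).

Lemma jet_okP z I : O z -> jet_ok T b z I.
Proof. by move=> Oz; exact: (jets_exist BT b_onb b_ker oO Oz (leqnn (mdeg I))). Qed.

Lemma frame_cvg z I q : O z -> nr_lim (nbhs z) (fun v => frame z v I q) (jet z I q).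
Proof.
move=> Oz e e0; have [c c0 hc] := norm_control BT b_onb b_ker Oz.
have ok := jets_exist BT b_onb b_ker oO (k := mdeg I).
have [B B0 hB] := frame_near b_onb b_ker Oz c0 hc q ok (leqnn _).
have h1 : \forall v \near z, dist z v < e / (B + 1).
  by apply: near_dist; rewrite divr_gt0 //; lra.
apply: filterS2 h1 (near_nearby n.+1 oO Oz c0) => v dv cl.
apply: le_lt_trans (hB v cl) _; move: dv; rewrite ltr_pdivlMr; last by lra.
by have := dist_ge0 z v; nra.
Qed.

Lemma frame_ray_cvg z a j I q : O z ->
  nr_lim ((0 : R)^') (fun t => frame z (ray z j a t) I q) (jet z I q).
Proof.
by move=> Oz e e0; exact: (@ray_cvg _ _ z j a _ (frame_cvg I q Oz e0)).
Qed.

Lemma frame_der_cvg z a j I q : O z ->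
  nr_lim ((0 : R)^') (fun t => t^-1%:C%C *: (frame z (ray z j a t) I q - jet z I q))
    (frame_der z a j I q).
Proof.
move=> Oz e e0; have [c c0 hc] := norm_control BT b_onb b_ker Oz.
have ok := jets_exist BT b_onb b_ker oO (k := (mdeg I).+1).
have [B B0 hB] := frame_der_near b_onb b_ker Oz c0 hc a j q ok (ltnSn _).
have h1 : \forall t \near (0 : R)^', `|t| < e / (B + 1).
  by apply: (@dnbhs0_lt R R^o); rewrite divr_gt0 //; lra.
have h2 : \forall t \near (0 : R)^', t != 0 by exact: nbhs_dnbhs_neq.
have h3 := near_nearby_ray n.+1 oO j a Oz c0.
apply: filterS3 h1 h2 h3 => t te t0 cl.
have tt : t^-1%:C%C * t%:C%C = 1 :> C by rewrite -rmorphM mulVf.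
rewrite -[frame_der z a j I q]scale1r -tt -scalerA -scalerBr nrZ cmodr normfV.
rewrite ltr_pdivrMl ?normr_gt0 //; apply: le_lt_trans (hB t cl) _.
rewrite -real_normK ?num_real // expr2 mulrCA ltr_pM2l ?normr_gt0 //.
by move: te; rewrite ltr_pdivlMr; [have := normr_ge0 t; nra|lra].
Qed.

Definition local_gram z v (l : letter) : 'M[C]_n.+1 :=
  \matrix_(p, q) inner (frame z v l.1 q) (frame z v l.2 p).

Lemma local_gramE z v l : local_gram z v l =
  (invmx (overlap b z v)) ^t* *m gram v l.1 l.2 *m invmx (overlap b z v).
Proof.
apply/matrixP => p q; rewrite !mxE /frame /lincomb inner_suml; apply: eq_bigr => r _.
rewrite innerZl inner_sumr mulrC mxE; congr (_ * _); apply: eq_bigr => s _.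
by rewrite innerZr !mxE.
Qed.

Lemma gram_adj v I J : gram v J I = (gram v I J) ^t*.
Proof. by apply/matrixP => p q; rewrite !mxE innerC. Qed.

Lemma gram0 z J : O z -> gram z midx0 J = (J == midx0)%:R%:M.
Proof.
move=> Oz; apply/matrixP => p q; rewrite !mxE jet0.
have [->|J0] := eqVneq J midx0; first by rewrite jet0 (b_onb Oz) eq_sym.
by have [_ h] := jet_okP J Oz p; rewrite innerC h // rmorph0 mul0rn.
Qed.

Lemma gram00 z : O z -> gram z midx0 midx0 = 1%:M.
Proof. by move=> Oz; rewrite gram0 // eqxx. Qed.

(** With [S] the inverse overlap, [local_gram z v l] is [S ^t* *m gram v l.1 l.2 *m S], and dividing
    by the metric [S ^t* *m S] leaves a conjugate of the Gram matrix at [v]. The derivative of the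
    metric vanishes at [z], since the frame is normal there. *)
Lemma gram_frame z : O z -> holomorphic_frame (fun v l => gram v l.1 l.2) z
  (fun v l => invmx (local_gram z v (midx0, midx0)) *m local_gram z v l).
Proof.
move=> Oz; have [c c0 hc] := norm_control BT b_onb b_ker Oz.
have lim_g l : mx_lim (nbhs z) (fun v => local_gram z v l) (gram z l.1 l.2).
  move=> p q; under eq_fun do rewrite mxE; rewrite mxE.
  by apply: inner_lim; exact: frame_cvg.
have lim_g0 : mx_lim (nbhs z) (fun v => local_gram z v (midx0, midx0)) 1%:M.
  by rewrite -(gram00 Oz); exact: (lim_g (midx0, midx0)).
have lim_i : mx_lim (nbhs z) (fun v => invmx (local_gram z v (midx0, midx0))) 1%:M.
  by rewrite -(invmx1 C n.+1); apply: mx_lim_inv lim_g0 _; exact: unitmx1.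
split.
- apply: filterS (near_nearby n.+1 oO Oz c0) => v cl; have [Ov _] := cl.
  have Su : invmx (overlap b z v) \in unitmx.
    by rewrite unitmx_inv; exact: (overlap_unit b_onb b_ker c0 hc cl).
  exists (invmx (overlap b z v)); split=> // l.
  rewrite !local_gramE /= gram00 // mulmx1.
  set S := invmx _ in Su *.
  have Sa : S ^t* \in unitmx by rewrite map_unitmx unitmx_tr.
  have e : S *m invmx (S ^t* *m S) = invmx (S ^t*).
    by rewrite -[LHS](mulKmx Sa) (mulmxA (S ^t*)) mulmxV ?mulmx1 // unitmx_mul Sa.
  by rewrite mulmxA e -!mulmxA mulKmx.
- move=> l; rewrite -[gram z l.1 l.2]mul1mx; apply: mx_limM; first exact: lim_i.
  exact: lim_g.
- move=> j [I J].
  (* [M] is the contribution of the first factor of the inner product; that of the second is its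
     adjoint with the indices exchanged. *)
  pose M a I J : 'M[C]_n.+1 := \matrix_(p, q) inner (frame_der z a j I q) (jet z J p).
  have ME a I' J' : M a I' J' = (a * (I' j).+1%:R) *: gram z (madd I' (mone j)) J'
     - a^* *: \sum_(K <- mbelow I') gram z (msub I' K) J' *m gram z K (mone j).
    apply/matrixP => p q; rewrite !mxE /frame_der innerBl !innerZl; congr (_ - _ * _).
    rewrite inner_suml summxE; apply: eq_bigr => K _; rewrite inner_suml mxE.
    by apply: eq_bigr => r _; rewrite innerZl !mxE mulrC.
  have der_g a (l : letter) : mx_lim ((0 : R)^')
      (fun t : R => t^-1%:C%C *: (local_gram z (ray z j a t) l - gram z l.1 l.2))
      (M a l.1 l.2 + (M a l.2 l.1) ^t*).
    move=> p q.
    have -> : (M a l.1 l.2 + (M a l.2 l.1) ^t*) p q =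
       inner (frame_der z a j l.1 q) (jet z l.2 p) +
       inner (jet z l.1 q) (frame_der z a j l.2 p) by rewrite !mxE -innerC.
    have e (s : R) (F G F' G' : H) : s%:C%C * (inner F G - inner F' G') =
        inner (s%:C%C *: (F - F')) G + inner F' (s%:C%C *: (G - G')).
      rewrite innerZl innerZr (_ : (s%:C%C : C)^* = s%:C%C); last exact: conjc_real.
      by rewrite -mulrDr innerBl innerBr addrA subrK.
    under eq_fun do rewrite !mxE e.
    apply: (@cvgD C C^o); apply: inner_lim.
    + exact: frame_der_cvg.
    + exact: frame_ray_cvg.
    + exact: nr_lim_cst.
    + exact: frame_der_cvg.
  have M00 a : M a midx0 midx0 = 0.
    rewrite ME big_seq big1 => [|K]; last first.
      rewrite mem_mbelow => /andP[/mleP h /eqP[]]; apply/ffunP => i.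
      by have := h i; rewrite ffunE leqn0 => /eqP.
    rewrite scaler0 subr0 gram_adj gram0 //.
    have -> : (madd midx0 (mone j) == midx0) = false.
      by apply/negP => /eqP /(congr1 (@mdeg m)); rewrite mdegD mdeg1 mdeg0.
    by rewrite [false%:R]mulr0n raddf0 adjmx0 scaler0.
  (* The conjugate linear part: the second factor contributes its raised coefficient, the first its
     change of normalization. *)
  exists ((J j).+1%:R *: gram z I (madd J (mone j))
     - \sum_(K <- mbelow I) gram z (msub I K) J *m gram z K (mone j)) => a.
  have -> : a *: ev (fun l : letter => gram z l.1 l.2) (dletter j (I, J)) +
     a^* *: ((J j).+1%:R *: gram z I (madd J (mone j))
     - \sum_(K <- mbelow I) gram z (msub I K) J *m gram z K (mone j)) =
     1%:M *m ((M a I J + (M a J I) ^t*) - (M a midx0 midx0 + (M a midx0 midx0) ^t*) *m gram z I J).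
    rewrite M00 adjmx0 addr0 mul0mx subr0 mul1mx !ME ev_dletter adjmxB !adjmxZ.
    rewrite rmorphM /= rmorph_nat conjCK adjmx_sum -gram_adj.
    under [X in _ = _ + (_ - _ *: X)]eq_bigr do rewrite adjmxM -!gram_adj.
    rewrite /=. move: (gram z _ _) (gram z _ _) => G1 G2; move: (\sum_(_ <- _) _) (\sum_(_ <- _) _) => S1 S2.
    rewrite [a *: (_ - _)]scalerBr [_^* *: (_ - _)]scalerBr !scalerA addrACA.
    by rewrite [RHS]addrACA; congr (_ + _); exact: addrC.
  have lim_r l : mx_lim ((0 : R)^') (fun t => local_gram z (ray z j a t) l) (gram z l.1 l.2).
    move=> p q; have h := lim_g l p q.
    exact: (cvg_comp (ray z j a) (fun v => local_gram z v l p q : C^o) (@ray_cvg _ _ z j a)).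
  have lim_ri : mx_lim ((0 : R)^')
      (fun t => invmx (local_gram z (ray z j a t) (midx0, midx0))) 1%:M.
    move=> p q; have h := lim_i p q.
    exact: (cvg_comp (ray z j a) (fun v => invmx (local_gram z v (midx0, midx0)) p q : C^o)
      (@ray_cvg _ _ z j a)).
  have h : mx_lim ((0 : R)^') (fun t => invmx (local_gram z (ray z j a t) (midx0, midx0)) *m
      (t^-1%:C%C *: (local_gram z (ray z j a t) (I, J) - gram z I J) +
       (-1) *: ((t^-1%:C%C *: (local_gram z (ray z j a t) (midx0, midx0) - gram z midx0 midx0))
        *m gram z I J)))
     (1%:M *m ((M a I J + (M a J I) ^t*) +
        (-1) *: ((M a midx0 midx0 + (M a midx0 midx0) ^t*) *m gram z I J))).
    apply: (mx_limM lim_ri); apply: mx_limD; first exact: (der_g a (I, J)).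
    apply: mx_limZ; first exact: cvg_cst.
    apply: mx_limM; first exact: (der_g a (midx0, midx0)).
    exact: mx_lim_cst.
  rewrite scaleN1r in h; apply: mx_lim_eq h.
  have h3 := near_nearby_ray n.+1 oO j a Oz c0.
  apply: filterS h3 => t cl; have [Ov _] := cl.
  have Su := overlap_unit b_onb b_ker c0 hc cl.
  have gu : local_gram z (ray z j a t) (midx0, midx0) \in unitmx.
    rewrite local_gramE /= gram00 // mulmx1 unitmx_mul.
    by rewrite map_unitmx unitmx_tr unitmx_inv Su.
  rewrite scaleN1r -scalemxAl -scalerBr -scalemxAr; congr (_ *: _).
  rewrite (gram00 Oz) mulmxBl mul1mx opprB addrA subrK mulmxBr.
  by rewrite mulmxA mulVmx // mul1mx.
Qed.

End GramFrames.

(** * Localizations *)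

Section Powers.
Context {R : realType} {H : hilbertType R} {m : nat}.
Local Notation C := R[i].
Local Notation space := 'rV[C^o]_m.
Variable T : 'I_m -> {linear H -> H}.
Hypothesis T_commute : forall i j h, T i (T j h) = T j (T i h).
Implicit Types (z : space) (I J K : multi_index m) (i j : 'I_m) (h x y : H).

Lemma sub_op_commute z i j h :
  sub_op T z i (sub_op T z j h) = sub_op T z j (sub_op T z i h).
Proof.
rewrite /sub_op (linearB (T i)) (linearB (T j)) (linearZ_LR (T i)) (linearZ_LR (T j)) T_commute.
move: (T j (T i h)) (T i h) (T j h) => w x y.
rewrite [_ *: (y - _)]scalerBr [_ *: (x - _)]scalerBr !scalerA (mulrC (z 0 j : C)) !opprB !addrA.
by rewrite -!addrA; congr (_ + _); rewrite addrCA [RHS]addrCA; congr (_ + _); exact: addrC.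
Qed.

Let powS z I (s : seq 'I_m) : H -> H :=
  \big[(fun f g : H -> H => f \o g)/idfun]_(i <- s) iter (I i) (sub_op T z i).

Let iter_commute z i j k h :
  sub_op T z i (iter k (sub_op T z j) h) = iter k (sub_op T z j) (sub_op T z i h).
Proof. by elim: k => //= k <-; exact: sub_op_commute. Qed.

Let powS_commute z I s i h : sub_op T z i (powS z I s h) = powS z I s (sub_op T z i h).
Proof.
elim: s => [|j s IH]; first by rewrite /powS !big_nil.
by rewrite /powS !big_cons /= iter_commute IH.
Qed.

Let powS_mone z I s i h : uniq s ->
  powS z (madd I (mone i)) s h = if i \in s then sub_op T z i (powS z I s h) else powS z I s h.
Proof.
elim: s => [|j s IH]; first by rewrite /powS !big_nil.
rewrite /powS !big_cons /= inE => /andP[js us].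
rewrite -/(powS z (madd I (mone i)) s) -/(powS z I s) IH // !ffunE [j == i]eq_sym.
have [ij|_] := eqVneq i j; last first.
  by rewrite addn0; case: ifP => // _; rewrite iter_commute.
by rewrite -{1}ij in js; rewrite (negPf js) addn1 /= ij.
Qed.

Lemma sub_op_powS z I i h :
  sub_op_pow T z (madd I (mone i)) h = sub_op T z i (sub_op_pow T z I h).
Proof. by have := powS_mone z I i h (index_enum_uniq 'I_m); rewrite mem_index_enum. Qed.

Lemma sub_op_powSr z I i h :
  sub_op_pow T z (madd I (mone i)) h = sub_op_pow T z I (sub_op T z i h).
Proof. by rewrite sub_op_powS; exact: powS_commute. Qed.

Lemma sub_op_pow0 z h : sub_op_pow T z midx0 h = h.
Proof.
rewrite /sub_op_pow; elim: (index_enum _) => [|i s IH]; first by rewrite big_nil.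
by rewrite big_cons ffunE.
Qed.

Lemma sub_op_pow_lin z I : linear_on (sub_op_pow T z I).
Proof.
move: {2}(mdeg I) (erefl (mdeg I)) => d; elim: d I => [|d IH] I Id c x y.
  have -> : I = midx0 by apply/eqP; rewrite -mdeg_eq0 Id.
  by rewrite !sub_op_pow0.
have [i Ii] : exists i, I i != 0%N by apply: mdeg_gt0P; rewrite -mdeg_eq0 Id.
rewrite -(msubK Ii) !sub_op_powS IH ?sub_op_lin //.
by apply: succn_inj; rewrite mdeg_msub1.
Qed.

Lemma sub_op_pow_eq0 z I : sub_op_pow T z I 0 = 0.
Proof. by have := sub_op_pow_lin z I (-1) 0 0; rewrite scaler0 addr0 scaleN1r addNr. Qed.

Lemma sub_op_powD z I x y : sub_op_pow T z I (x + y) = sub_op_pow T z I x + sub_op_pow T z I y.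
Proof. by have := sub_op_pow_lin z I 1 x y; rewrite !scale1r. Qed.

Lemma sub_op_pow_sum z I A (s : seq A) (P : pred A) (F : A -> H) :
  sub_op_pow T z I (\sum_(a <- s | P a) F a) = \sum_(a <- s | P a) sub_op_pow T z I (F a).
Proof. exact: (big_morph _ (sub_op_powD z I) (sub_op_pow_eq0 z I)). Qed.

Lemma gen_ker_lin z k c x y : gen_ker T z k x -> gen_ker T z k y -> gen_ker T z k (c *: x + y).
Proof. by move=> hx hy I Ik; rewrite sub_op_pow_lin hx // hy // scaler0 addr0. Qed.

Lemma gen_ker0 z k : gen_ker T z k 0.
Proof. by move=> I _; exact: sub_op_pow_eq0. Qed.

Lemma gen_ker_lincomb z k N (e : 'I_N -> H) c :
  (forall a, gen_ker T z k (e a)) -> gen_ker T z k (lincomb e c).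
Proof.
move=> he; rewrite /lincomb; elim/big_ind: _ => [|x y hx hy|i _]; first exact: gen_ker0.
  by rewrite -[x]scale1r; exact: gen_ker_lin.
by rewrite -[_ *: _]addr0; apply: gen_ker_lin => //; exact: gen_ker0.
Qed.

End Powers.

Lemma sum_mupto_recr (V : nmodType) m k (F : multi_index m -> V) :
  \sum_(K <- mupto k.+1) F K =
  \sum_(K <- mupto k) F K + \sum_(K <- mupto k.+1 | mdeg K == k.+1) F K.
Proof.
rewrite (bigID (fun K => mdeg K == k.+1)) /= addrC; congr (_ + _).
rewrite -big_filter; apply: perm_big; apply: uniq_perm; [exact/filter_uniq/mupto_uniq|exact: mupto_uniq|move=> K].
by rewrite mem_filter !mem_mupto -ltn_neqAle ltnS.
Qed.

Section LocalOperators.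
Context {R : realType} {H : hilbertType R} {m n : nat}.
Local Notation C := R[i].
Local Notation space := 'rV[C^o]_m.
Variables (O : set space) (T : 'I_m -> {linear H -> H}) (b : space -> 'I_n.+1 -> H).
Hypothesis BT : class_B n.+1 O T.
Hypothesis b_onb : forall z, O z -> onb (b z).
Hypothesis b_ker : forall z, O z -> joint_ker T z = range (lincomb (b z)).
Hypothesis oO : open O.
Variables (z : space) (Oz : O z).
Implicit Types (I J K L : multi_index m) (p q r : 'I_n.+1) (x y : H).

Local Notation jet := (jet T b z).
Local Notation gram := (gram T b z).

Let commT := class_B_commute BT.

Lemma sub_op_pow_jet I K q :
  sub_op_pow T z I (jet K q) = if mle I K then jet (msub K I) q else 0.
Proof.
move: {2}(mdeg I) (erefl (mdeg I)) => d; elim: d I K => [|d IH] I K Id.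
  have -> : I = midx0 by apply/eqP; rewrite -mdeg_eq0 Id.
  by rewrite sub_op_pow0 mle0 msub0.
have [i Ii] : exists i, I i != 0%N by apply: mdeg_gt0P; rewrite -mdeg_eq0 Id.
pose J := msub I (mone i).
have Jd : mdeg J = d by apply: succn_inj; rewrite mdeg_msub1.
have -> : I = madd J (mone i) by rewrite msubK.
rewrite (sub_op_powSr commT); have [-> _] := jet_okP BT b_onb b_ker oO K Oz q.
have [Ki|/eqP Ki] := eqVneq (K i) 0%N.
  rewrite (sub_op_pow_eq0 commT); case: ifP => // /mleP/(_ i).
  by rewrite !ffunE eqxx addn1 Ki.
rewrite IH //; have -> : mle J (msub K (mone i)) = mle (madd J (mone i)) K.
  apply/mleP/mleP => h j; have := h j; rewrite !ffunE; case: eqP => [->|_] /=;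
  by move: Ki; lia.
case: ifP => // _; congr jet; apply/ffunP => j; rewrite !ffunE.
by rewrite subnDA subnAC.
Qed.

Lemma gen_ker_jet k K q : (mdeg K <= k)%N -> gen_ker T z k.+1 (jet K q).
Proof.
move=> Kk I Ik; rewrite sub_op_pow_jet; case: ifP => // /mle_deg.
by rewrite Ik leqNgt ltnS Kk.
Qed.

(** In the inductive step, the powers of degree [k.+1] map [x] into the joint kernel. Subtracting
    the jets of that degree with the same images leaves a vector of the next smaller generalized
    kernel. *)
Lemma gen_ker_jets k x : gen_ker T z k.+1 x ->
  exists c : multi_index m -> 'I_n.+1 -> C, x = \sum_(K <- mupto k) lincomb (jet K) (c K).
Proof.
elim: k x => [|k IH] x hx.
  move: hx; rewrite gen_ker1 (b_ker Oz) => -[c _ <-]; exists (fun=> c).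
  have -> : mupto 0 = [:: midx0] :> seq (multi_index m).
    apply: perm_small_eq => //; apply: uniq_perm; rewrite ?mupto_uniq // => I.
    by rewrite mem_mupto leqn0 mdeg_eq0 inE.
  by rewrite big_seq1; congr lincomb; apply/funext => p; rewrite jet0.
have hk I : mdeg I = k.+1 -> exists c, sub_op_pow T z I x = lincomb (b z) c.
  move=> Ik; have : joint_ker T z (sub_op_pow T z I x).
    by move=> i; rewrite -(sub_op_powS commT); apply: hx; rewrite mdegD mdeg1 Ik addn1.
  by rewrite (b_ker Oz) => -[c _ <-]; exists c.
have /choice[c hc] : forall I, exists c, mdeg I = k.+1 -> sub_op_pow T z I x = lincomb (b z) c.
  move=> I; have [/hk[c hc]|h] := eqVneq (mdeg I) k.+1; first by exists c.
  by exists (fun=> 0) => e; rewrite e eqxx in h.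
pose x' := \sum_(K <- mupto k.+1 | mdeg K == k.+1) lincomb (jet K) (c K).
have : gen_ker T z k.+1 (x - x').
  move=> I Ik; rewrite -[x - x']addrC -scaleN1r (sub_op_pow_lin commT) scaleN1r hc //.
  rewrite (sub_op_pow_sum commT).
  rewrite (eq_bigr (fun K => if K == I then lincomb (b z) (c K) else 0)); last first.
    move=> K /eqP Kk; rewrite (linear_on_lincomb _ _ (sub_op_pow_lin commT z I)).
    case: eqP => [->|KI].
      by congr lincomb; apply/funext => p; rewrite sub_op_pow_jet mle_refl msubb jet0.
    rewrite /lincomb big1 // => p _; rewrite sub_op_pow_jet; case: ifP => [h|]; last by rewrite scaler0.
    by case: KI; rewrite (mle_deg_eq h) ?Ik.
  rewrite -big_mkcondr /= (eq_bigl (fun K => K == I)) => [|K]; last first.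
    by have [->|_] := eqVneq K I; rewrite ?Ik ?eqxx ?andbF.
  by rewrite sum_pred1_seq ?mupto_uniq ?mem_mupto ?Ik // addNr.
move=> /IH[c' hc']; exists (fun K => if mdeg K == k.+1 then c K else c' K).
rewrite sum_mupto_recr -[x](subrK x') hc'; congr (_ + _).
  rewrite big_seq [RHS]big_seq; apply: eq_bigr => K; rewrite mem_mupto => Kk.
  by rewrite ltn_eqF.
by apply: eq_bigr => K ->.
Qed.

Lemma gen_ker_onb k : exists N (e : 'I_N -> H), onb e /\ gen_ker T z k.+1 = range (lincomb e).
Proof.
pose s := [seq (K, p) | K <- mupto k, p <- index_enum 'I_n.+1].
pose f (i : 'I_(size s)) := jet (tnth (in_tuple s) i).1 (tnth (in_tuple s) i).2.
have [N [e [oe re _]]] := gram_schmidt f; exists N, e; split=> //; rewrite re.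
apply/seteqP; split=> x.
  move=> /gen_ker_jets[c ->]; exists (fun i => c (tnth (in_tuple s) i).1 (tnth (in_tuple s) i).2) => //.
  rewrite /lincomb -(big_tnth _ _ s xpredT (fun Kp => c Kp.1 Kp.2 *: jet Kp.1 Kp.2)).
  by rewrite big_allpairs.
move=> [c _ <-]; apply: (gen_ker_lincomb commT) => i; apply: gen_ker_jet.
have /allpairsP[[K p] /= [Kk _ ->]] := mem_tnth i (in_tuple s).
by rewrite -mem_mupto.
Qed.

Variable k : nat.

(** The power of index [J] takes the jet of index [J] to the basis, so these vectors are dual to the
    jets of degree at most [k]; their Gram matrices are the matrices of the local operators. *)
Definition dual_jet J q : H := adjoint_on (gen_ker T z k.+1) (sub_op_pow T z J) (b z q).

Definition dual_gram I J : 'M[C]_n.+1 :=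
  \matrix_(p, q) inner (dual_jet J q) (dual_jet I p).

Lemma gen_ker_adjoint J y : let X := gen_ker T z k.+1 in
  X (adjoint_on X (sub_op_pow T z J) y) /\ forall x, X x ->
    inner (sub_op_pow T z J x) y = inner x (adjoint_on X (sub_op_pow T z J) y).
Proof.
by move=> X; rewrite /X; have [N [e [oe ->]]] := gen_ker_onb k;
  apply: adjoint_onP => //; exact: (sub_op_pow_lin commT).
Qed.

Lemma dual_gram_adj I J : dual_gram J I = (dual_gram I J) ^t*.
Proof. by apply/matrixP => p q; rewrite !mxE innerC. Qed.

Lemma local_op_lincomb I J d : local_op k T z I J (lincomb (b z) d) =
  lincomb (b z) (fun p => \sum_q dual_gram I J p q * d q).
Proof.
rewrite /local_op gen_ker1 (b_ker Oz) (orth_projE _ (b_onb Oz)); congr lincomb; apply/funext => p.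
set y := lincomb (b z) d; have [Xw hw] := gen_ker_adjoint J y.
have [Xp hp] := gen_ker_adjoint I (b z p).
rewrite hp // innerC -hw // -innerC /y /lincomb inner_suml; apply: eq_bigr => q _.
have [Xq hq] := gen_ker_adjoint J (b z q).
by rewrite innerZl mulrC mxE innerC hq // -innerC.
Qed.

Lemma inner_jet_dual J L p q : (mdeg L <= k)%N ->
  inner (jet L p) (dual_jet J q) = ((L == J) && (p == q))%:R.
Proof.
move=> Lk; have [_ <-] := gen_ker_adjoint J (b z q); last exact: gen_ker_jet.
rewrite sub_op_pow_jet; have [->|LJ] := eqVneq L J.
  by rewrite mle_refl msubb jet0 b_onb.
case: ifP => [JL|_]; last by rewrite inner0l.
have [_ -> //] := jet_okP BT b_onb b_ker oO (msub L J) Oz p.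
apply: contraNneq LJ => h; apply/eqP/ffunP => i; apply/eqP; rewrite eqn_leq.
rewrite (mleP _ _ JL) andbT -subn_eq0; move/ffunP/(_ i): h.
by rewrite !ffunE => ->.
Qed.

Lemma dual_jetE J q : dual_jet J q = \sum_(K <- mupto k) lincomb (jet K) (fun r => dual_gram K J r q).
Proof.
have [/gen_ker_jets[c hc] _] := gen_ker_adjoint J (b z q).
rewrite -/(dual_jet J q) in hc; rewrite {1}hc big_seq [RHS]big_seq; apply: eq_bigr => K KK.
congr lincomb; apply/funext => r; rewrite mxE hc inner_suml.
rewrite (bigD1_seq K) ?mupto_uniq //= big_seq_cond big1 ?addr0; last first.
  move=> L /andP[LL /negPf LK]; rewrite /lincomb inner_suml big1 // => p _.
  by rewrite innerZl inner_jet_dual ?LK ?mulr0 // -mem_mupto.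
rewrite /lincomb inner_suml (bigD1 r) //= innerZl inner_jet_dual -?mem_mupto // !eqxx mulr1.
by rewrite big1 ?addr0 // => p /negPf pr; rewrite innerZl inner_jet_dual -?mem_mupto // pr andbF mulr0.
Qed.

(** [dual_jetE] expands a dual jet in jets with coefficients [dual_gram]; pairing with [jet L] gives
    the relation. The index [midx0] drops out because [gram midx0 L = 0], which matches the
    restriction to degrees at least one. *)
Lemma gram_dual J L : (mdeg L <= k)%N -> L != midx0 ->
  \sum_(K <- mupto k | K != midx0) gram K L *m dual_gram K J = (L == J)%:R%:M.
Proof.
move=> Lk L0; have -> : \sum_(K <- mupto k | K != midx0) gram K L *m dual_gram K J =
    \sum_(K <- mupto k) gram K L *m dual_gram K J.
  rewrite [RHS](bigD1_seq midx0) ?mupto_uniq ?mem_mupto ?mdeg0 //=.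
  by rewrite (gram0 BT b_onb b_ker oO) // (negPf L0) raddf0 mul0mx add0r.
apply/matrixP => p q; rewrite [RHS]mxE -mulrnA mulnb.
have -> : ((L == J) && (p == q))%:R = inner (dual_jet J q) (jet L p) :> C.
  by rewrite innerC inner_jet_dual // rmorph_nat.
rewrite dual_jetE inner_suml summxE; apply: eq_bigr => K _.
rewrite /lincomb inner_suml mxE; apply: eq_bigr => r _.
by rewrite innerZl mxE mulrC.
Qed.

End LocalOperators.

(* The two relations say that [G] and [G'], transposed as block matrices, are
   the inverses of [A] and [A']. *)
Lemma block_inverse_intertwine (K : numClosedFieldType) N (Idx : eqType) (s : seq Idx) (P : pred Idx)
    (G A G' A' : Idx -> Idx -> 'M[K]_N.+1) (u : 'M[K]_N.+1) :
  uniq s ->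
  (forall k l, G l k = (G k l) ^t*) -> (forall k l, A l k = (A k l) ^t*) ->
  (forall l j, l \in s -> P l -> \sum_(k <- s | P k) G k l *m A k j = (l == j)%:R%:M) ->
  (forall l j, l \in s -> P l -> \sum_(k <- s | P k) G' k l *m A' k j = (l == j)%:R%:M) ->
  (forall k l, k \in s -> P k -> l \in s -> P l -> u *m A k l = A' k l *m u) ->
  forall k l, k \in s -> P k -> l \in s -> P l -> u *m G k l = G' k l *m u.
Proof.
move=> us Gs As GA GA' uA a l sa Pa sl Pl.
have AG k : k \in s -> P k -> \sum_(j <- s | P j) A k j *m G a j = (a == k)%:R%:M.
  move=> sk Pk; have := congr1 (fun M => M ^t*) (GA a k sa Pa).
  rewrite adjmx_sum adjmxC rmorph_nat => <-.
  by apply: eq_bigr => j _; rewrite adjmxM -Gs -As.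
have delta (F : Idx -> 'M[K]_N.+1) i : i \in s -> P i ->
    \sum_(j <- s | P j) (i == j)%:R%:M *m F j = F i.
  move=> si Pi; rewrite -big_filter (bigD1_seq i) ?filter_uniq ?mem_filter ?Pi //= eqxx mul1mx.
  by rewrite big1 ?addr0 // => j /negPf ji; rewrite eq_sym ji raddf0 mul0mx.
(* The relation between [G'] and [A'] is inserted on the left; then [u] crosses to [A], and [A]
   contracts with [G]. *)
have -> : u *m G a l = \sum_(j <- s | P j) \sum_(k <- s | P k)
    G' k l *m (A' k j *m u) *m G a j.
  rewrite -(delta (fun j => u *m G a j) l) //; apply: eq_bigr => j _.
  rewrite -GA' // !mulmx_suml; apply: eq_bigr => k _.
  by rewrite !mulmxA.
rewrite exchange_big /=.
rewrite -(delta (fun k => G' k l *m u) a) //.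
rewrite big_seq_cond [RHS]big_seq_cond; apply: eq_bigr => k /andP[sk Pk].
rewrite mul_scalar_mx -mul_mx_scalar -AG // mulmx_sumr.
rewrite big_seq_cond [RHS]big_seq_cond; apply: eq_bigr => j /andP[sj Pj].
by rewrite -uA // !mulmxA.
Qed.

(** * Density *)

Section Taylor.
Context {R : realType} {H : hilbertType R} {m n : nat}.
Local Notation C := R[i].
Local Notation space := 'rV[C^o]_m.
Variables (O : set space) (T : 'I_m -> {linear H -> H}) (b : space -> 'I_n.+1 -> H).
Hypothesis BT : class_B n.+1 O T.
Hypothesis b_onb : forall z, O z -> onb (b z).
Hypothesis b_ker : forall z, O z -> joint_ker T z = range (lincomb (b z)).
Hypothesis oO : open O.
Implicit Types (z v : space) (I J K : multi_index m) (p q r : 'I_n.+1) (y : H).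

Local Notation jet := (jet T b).
Local Notation frame := (frame T b).

Definition monomial z v I : C := \prod_i ((v 0 i : C) - z 0 i) ^+ I i.

Lemma monomial0 z v : monomial z v midx0 = 1.
Proof. by rewrite /monomial big1 // => i _; rewrite ffunE. Qed.

Lemma monomial_mone z v I i :
  monomial z v (madd I (mone i)) = ((v 0 i : C) - z 0 i) * monomial z v I.
Proof.
rewrite /monomial (bigD1 i) //= [in RHS](bigD1 i) //= mulrA; congr (_ * _).
  by rewrite !ffunE eqxx addn1 exprS.
by apply: eq_bigr => j /negPf ji; rewrite !ffunE ji addn0.
Qed.

Definition taylor z v k q : H := \sum_(I <- mupto k) monomial z v I *: jet z I q.

Lemma sub_op_taylor z v k q i : O z ->
  sub_op T z i (taylor z v k.+1 q) = ((v 0 i : C) - z 0 i) *: taylor z v k q.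
Proof.
move=> Oz; rewrite sub_op_sum.
rewrite (eq_bigr (fun I : multi_index m => if I i != 0%N then
    monomial z v I *: jet z (msub I (mone i)) q else 0)); last first.
  move=> I _; rewrite sub_opZ; have [-> _] := jet_okP BT b_onb b_ker oO I Oz q.
  by case: eqP => // _; rewrite scaler0.
rewrite -big_mkcond -big_filter (perm_big _ (mupto_msub1 k i)) big_map scaler_sumr.
by apply: eq_bigr => J _; rewrite maddK monomial_mone scalerA.
Qed.

Lemma inner_taylor z v k q p : O z -> inner (taylor z v k q) (b z p) = (q == p)%:R.
Proof.
move=> Oz; rewrite inner_suml.
rewrite (bigD1_seq midx0) ?mupto_uniq ?mem_mupto ?mdeg0 //= monomial0 scale1r jet0 b_onb //.
rewrite big1 ?addr0 // => I I0; rewrite innerZl.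
by have [_ ->] := jet_okP BT b_onb b_ker oO I Oz q; rewrite ?mulr0.
Qed.

(** On the frame the operators at [z] act as the scalars [v_i - z_i], and they take the Taylor
    polynomial of order [k.+1] to that of order [k] times the same scalars. So each order multiplies
    the error by at most [c * dist z v], which is at most one half. *)
Lemma frame_taylor z q : O z -> \forall v \near z, forall k,
  nr (frame z v midx0 q - taylor z v k q) <= 2^-1 ^+ k.
Proof.
move=> Oz; have [c c0 hc] := norm_control BT b_onb b_ker Oz.
have h1 := frame_cvg BT b_onb b_ker oO midx0 q Oz ltr01.
apply: filterS2 h1 (near_nearby n.+1 oO Oz c0) => v near1 cl k.
have [Ov _] := cl; have cd := nearby_dist c0 cl.
set g := frame _ _ _ _ in near1 *.
have sub_g i : sub_op T z i g = ((v 0 i : C) - z 0 i) *: g.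
  rewrite (sub_op_shift T z v) /g (sub_op_frame z q i (jet_okP BT b_onb b_ker oO midx0 Ov)).
  by rewrite ffunE add0r.
elim: k => [|k IH].
  rewrite expr0 /taylor (_ : mupto 0 = [:: midx0]); last first.
    apply: perm_small_eq => //; apply: uniq_perm; rewrite ?mupto_uniq // => I.
    by rewrite mem_mupto leqn0 mdeg_eq0 inE.
  by rewrite big_seq1 monomial0 scale1r ltW.
apply: le_trans (hc _) _.
rewrite [X in _ + X]big1 ?addr0; last first.
  by move=> p _; rewrite innerBl inner_taylor // (inner_frame0 b_onb b_ker c0 hc _ _ cl) eq_sym subrr cmod0.
have -> : defect T z (g - taylor z v k.+1 q) = dist z v * nr (g - taylor z v k q).
  rewrite /defect /dist mulr_suml; apply: eq_bigr => i _.
  by rewrite sub_opB sub_g sub_op_taylor // -scalerBr nrZ.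
rewrite mulrA exprS; apply: ler_pM => //; last exact: nr_ge0.
by rewrite mulr_ge0 ?dist_ge0 // ltW.
Qed.

Lemma orth_frame z v q y : O z -> (forall I q, inner (jet z I q) y = 0) ->
  (forall k, nr (frame z v midx0 q - taylor z v k q) <= (2^-1) ^+ k) ->
  inner (frame z v midx0 q) y = 0.
Proof.
move=> Oz jy h; apply: cmod_eq0; apply/eqP; rewrite eq_le cmod_ge0 andbT.
have hk k : cmod (inner (frame z v midx0 q) y) <= (2^-1) ^+ k * nr y.
  have <- : inner (frame z v midx0 q - taylor z v k q) y = inner (frame z v midx0 q) y.
    rewrite innerBl [X in _ - X]inner_suml big1 ?subr0 // => I _.
    by rewrite innerZl jy mulr0.
  by apply: le_trans (Cauchy_Schwarz _ _) _; rewrite ler_wpM2r ?nr_ge0.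
have lim0 : (fun k => (2^-1 : R) ^+ k * nr y) @ \oo --> (0 : R).
  rewrite -[X in _ --> X](mul0r (nr y)); apply: cvgMl; apply: cvg_expr.
  by rewrite ger0_norm ?invr_ge0 // invf_lt1 // ltr1n.
by apply: (cvgr_to_ge lim0); apply: nearW.
Qed.

Lemma orth_joint_ker_near z y : O z -> (forall I q, inner (jet z I q) y = 0) ->
  \forall v \near z, forall x, joint_ker T v x -> inner x y = 0.
Proof.
move=> Oz jy; have [c c0 hc] := norm_control BT b_onb b_ker Oz.
have h1 : \forall v \near z, forall q k,
    nr (frame z v midx0 q - taylor z v k q) <= 2^-1 ^+ k.
  exact: (filter_forall (I := 'I_n.+1) _ (fun q => frame_taylor q Oz)).
apply: filterS2 h1 (near_nearby n.+1 oO Oz c0) => v near_v cl x; have [Ov _] := cl.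
have fy q : inner (frame z v midx0 q) y = 0 by apply: orth_frame.
have by0 p : inner (b v p) y = 0.
  pose u : 'rV[C]_n.+1 := \row_p inner (b v p) y.
  suff : u = 0 by move=> /rowP/(_ p); rewrite !mxE.
  have Su := overlap_unit b_onb b_ker c0 hc cl.
  have Si : invmx (overlap b z v) \in unitmx by rewrite unitmx_inv.
  rewrite -[u](mulmxK Si).
  suff -> : u *m invmx (overlap b z v) = 0 by rewrite mul0mx.
  apply/rowP => q; rewrite [RHS]mxE -[RHS](fy q) mxE frame0E inner_suml; apply: eq_bigr => r _.
  by rewrite mxE innerZl mulrC.
rewrite (b_ker Ov) => -[a _ <-]; rewrite inner_suml big1 // => p _.
by rewrite innerZl by0 mulr0.
Qed.

(** Induction on the degree: a coefficient of the next degree is a limit of difference quotients of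
    coefficients over [W], up to lower coefficients at the same point. *)
Lemma orth_jets_open (W : set space) y : open W -> W `<=` O ->
  (forall v x, W v -> joint_ker T v x -> inner x y = 0) ->
  forall v I q, W v -> inner (jet v I q) y = 0.
Proof.
move=> oW WO ky v I; move: {2}(mdeg I) (leqnn (mdeg I)) => d; elim: d I v => [|d IH] I v Id q Wv.
  have -> : I = midx0 by apply/eqP; rewrite -mdeg_eq0 -leqn0.
  rewrite jet0; apply: (ky v) => // i; exact: (sub_op_b b_ker i q (WO _ Wv)).
have [I0|/mdeg_gt0P[j Ij]] := eqVneq I midx0; first by rewrite I0; apply: IH; rewrite ?mdeg0.
pose J := msub I (mone j).
have Jd : (mdeg J <= d)%N by rewrite -ltnS mdeg_msub1.
have Ov := WO _ Wv.
have fy : \forall t \near (0 : R)^',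
    inner (t^-1%:C%C *: (frame v (ray v j 1 t) J q - jet v J q)) y = 0.
  have : \forall t \near (0 : R)^', W (ray v j 1 t).
    by apply: (@ray_cvg _ _ v j 1); exact: open_nbhs_nbhs.
  apply: filterS => t Wt; rewrite innerZl innerBl IH // subr0 inner_suml big1 ?mulr0 // => p _.
  by rewrite innerZl IH // mulr0.
have lim_y := inner_lim (frame_der_cvg BT b_onb b_ker oO 1 j J q Ov) (@nr_lim_cst _ _ _ _ _ y).
have : inner (frame_der T b v 1 j J q) y = 0.
  have lim0 : (fun t : R => inner (t^-1%:C%C *: (frame v (ray v j 1 t) J q - jet v J q)) y : C^o)
      @ (0 : R)^' --> (0 : C^o).
    by apply: cvg_near_cst; exact: fy.
  exact: (cvg_unique _ (lim_y _ _) lim0).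
rewrite /frame_der innerBl !innerZl inner_suml [X in _ - _ * X]big1.
  rewrite mulr0 subr0 mul1r msubK // => /eqP; rewrite mulf_eq0 pnatr_eq0 /= => /eqP //.
move=> K _; rewrite inner_suml big1 // => p _; rewrite innerZl IH ?mulr0 //.
exact: leq_trans (mdeg_msub _ _) Jd.
Qed.

Hypothesis O_connected : connected O.

(** The points whose jets are all orthogonal to [y] form a set that is open by Taylor expansion,
    closed in [O] by continuity of the frame coefficients, and so equal to [O]. Then [y] is
    orthogonal to all joint kernels, whose span is dense. *)
Theorem jets_total z y : O z -> (forall I q, inner (jet z I q) y = 0) -> y = 0.
Proof.
move=> Oz jy; pose A := O `&` [set v | forall I q, inner (jet v I q) y = 0].
have nbhs_A v : A v -> nbhs v A.
  move=> [Ov hv].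
  have hk := orth_joint_ker_near Ov hv.
  have hO : nbhs v O by exact: open_nbhs_nbhs.
  have : nbhs v ([set w | forall x, joint_ker T w x -> inner x y = 0] `&` O) by exact: filterI.
  rewrite {1}nbhsE => -[W [oW Wv] hW].
  have WO : W `<=` O by move=> w /hW[].
  have nW : nbhs v W by exact: open_nbhs_nbhs.
  apply: filterS nW => w Ww; split; first exact: WO.
  by move=> I q; apply: (orth_jets_open oW WO) => // w' x /hW[h _]; exact: h.
have AO : A = O.
  apply: O_connected.
  - by exists z.
  - exists A; last by rewrite /A setIA setIid.
    by rewrite openE => v Av; exact: nbhs_A.
  - exists (closure A); first exact: closed_closure.
    apply/seteqP; split => v [Ov hv]; first by split=> //; apply: subset_closure; split.
    split=> // I q; have lim_v := inner_lim (frame_cvg BT b_onb b_ker oO I q Ov) (@nr_lim_cst _ _ _ _ _ y).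
    apply: cmod_eq0; apply/eqP; rewrite eq_le cmod_ge0 andbT; apply/ler_addgt0Pr => e e0.
    have e0' : 0 < e%:C%C :> C by rewrite ltcR.
    have near_v := (cvgrPdist_lt _ _).1 (lim_v _ _) _ e0'.
    rewrite add0r; have [w [[Ow wy] hw]] := hv _ (near_v _ _ _).
    move: hw => /=; rewrite [inner (frame _ _ _ _) _]inner_suml big1 => [|p _].
      by rewrite subr0 cmodE ltcR => /ltW.
    by rewrite innerZl wy mulr0.
have ky v x : O v -> joint_ker T v x -> inner x y = 0.
  by rewrite -AO => -[Ov hv] kx; exact: (nbhs_singleton (orth_joint_ker_near Ov hv)).
have sy x : linear_span (\bigcup_(v in O) joint_ker T v) x -> inner x y = 0.
  move=> [k [e [a [he ->]]]]; rewrite inner_suml big1 // => i _; rewrite innerZl.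
  by have [v Ov kv] := he i; rewrite (ky v) // mulr0.
have cy : closure (linear_span (\bigcup_(v in O) joint_ker T v)) y.
  by rewrite (class_B_span BT).
have small (e : R) : 0 < e -> nr y <= e.
  move=> e0; have [x [/sy xy]] := cy [set x | nr (y - x) < e] ltac:(by apply/nbhs_nrP; exists e).
  move=> /= xe; have : cmod (inner (y - x) y) <= nr (y - x) * nr y by exact: Cauchy_Schwarz.
  rewrite innerBl xy subr0 inner_nr cmodr ger0_norm ?sqr_ge0 // expr2.
  have [->|y0] := eqVneq (nr y) 0; first by move=> _; exact: ltW.
  by rewrite ler_pM2r ?lt_def ?y0 ?nr_ge0 // => /le_lt_trans/(_ xe)/ltW.
apply: nr_eq0; apply/eqP; rewrite eq_le nr_ge0 andbT; apply/ler_addgt0Pr => e e0.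
by rewrite add0r; exact: small.
Qed.

End Taylor.

Lemma spanning_orth (R : realType) (H : hilbertType R) (K : Type) (a : K -> H) :
  (forall y, (forall k, inner (a k) y = 0) -> y = 0) -> spanning a.
Proof.
move=> ha h e e0.
have [||| _ [n [k [c [-> _]]]] hv] := @subspace_dense R H (fun v => span_graph a a v v) _ _ _ h e e0.
- by exists 0%N, (fun i : 'I_0 => False_rect K (notF (ltn_ord i))), (fun=> 0); rewrite /lincomb big_ord0.
- by move=> c x y; exact: span_graph_lin.
- move=> y hy; apply: ha => k; rewrite innerC hy ?rmorph0 //.
  by exists 1%N, (fun=> k), (fun=> 1); rewrite /lincomb big_ord1 scale1r.
by exists n, k, c.
Qed.

(** * Unitary equivalence *)

Section UnitaryTransport.
Context {R : realType} {H H' : hilbertType R} {m : nat}.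
Local Notation C := R[i].
Local Notation space := 'rV[C^o]_m.
Variables (T : 'I_m -> {linear H -> H}) (T' : 'I_m -> {linear H' -> H'}) (U : H -> H').
Hypothesis T_commute : forall i j h, T i (T j h) = T j (T i h).
Hypothesis U_unitary : unitary_between setT setT U.
Hypothesis U_intertwines : forall i h, U (T i h) = T' i (U h).
Implicit Types (z : space) (I J : multi_index m) (h x y w : H).

Let U_lin c x y : U (c *: x + y) = c *: U x + U y.
Proof. by case: U_unitary => + _ _; exact. Qed.

Let U_inner x y : inner (U x) (U y) = inner x y.
Proof. by case: U_unitary => _ + _; exact. Qed.

Let U_surj (y : H') : exists x, U x = y.
Proof.
by case: U_unitary => _ _ e; have : [set: H'] y by []; rewrite -e => -[x _ <-]; exists x.
Qed.

Let U0 : U 0 = 0.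
Proof. by have := U_lin (-1) 0 0; rewrite scaler0 addr0 scaleN1r addNr. Qed.

Let UB x y : U (x - y) = U x - U y.
Proof. by rewrite addrC -scaleN1r U_lin scaleN1r addrC. Qed.

Let U_eq0 x : U x = 0 -> x = 0.
Proof. by move=> h; apply: inner_eq0; rewrite -U_inner h inner0l. Qed.

Lemma transport_sub_op z i h : U (sub_op T z i h) = sub_op T' z i (U h).
Proof.
by rewrite /sub_op UB U_intertwines; congr (_ - _); rewrite -[_ *: h]addr0 U_lin U0 addr0.
Qed.

Lemma transport_sub_op_pow z I h : U (sub_op_pow T z I h) = sub_op_pow T' z I (U h).
Proof.
rewrite /sub_op_pow; elim: (index_enum _) => [|i s IH]; first by rewrite !big_nil.
rewrite !big_cons /= -IH; elim: (I i) => //= k <-; exact: transport_sub_op.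
Qed.

Lemma transport_gen_ker z k h : gen_ker T' z k (U h) <-> gen_ker T z k h.
Proof.
split=> hh I Ik; last by rewrite -transport_sub_op_pow hh // U0.
by apply: U_eq0; rewrite transport_sub_op_pow hh.
Qed.

(** A choice by [xget] commutes with [U] when the chosen element is unique; if there is none, both
    sides are the default 0, which [U] fixes. *)
Let transport_xget (P : set H) (P' : set H') :
  (forall w w', P w -> P w' -> w = w') -> (forall w, P' (U w) <-> P w) ->
  U (xget 0 P) = xget 0 P'.
Proof.
move=> uP UP; have [[w Pw]|h] := pselect (exists w, P w).
  have P'w : P' (xget 0 P') by apply: xgetPex; exists (U w); apply/UP.
  have [w' e] := U_surj (xget 0 P'); rewrite -e; congr U; apply: uP; last by apply/UP; rewrite e.
  by apply: xgetPex; exists w.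
rewrite !xgetPN ?U0 // => w; last by move=> Pw; apply: h; exists w.
by have [w' <-] := U_surj w => /UP Pw; apply: h; exists w'.
Qed.

Let gen_kerB z k x y : gen_ker T z k x -> gen_ker T z k y -> gen_ker T z k (x - y).
Proof. by move=> hx hy; rewrite addrC -scaleN1r; exact: gen_ker_lin. Qed.

Lemma transport_orth_proj z k h :
  U (orth_proj (gen_ker T z k) h) = orth_proj (gen_ker T' z k) (U h).
Proof.
apply: transport_xget => [w w' [Xw hw] [Xw' hw']|w].
  apply/eqP; rewrite -subr_eq0; apply/eqP/inner_eq0.
  have := hw _ (gen_kerB Xw Xw'); have := hw' _ (gen_kerB Xw Xw').
  rewrite !innerBl => /eqP; rewrite subr_eq0 => /eqP <- /eqP; rewrite subr_eq0 => /eqP ->.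
  by rewrite subrr.
split=> -[Xw hw]; split; try exact/transport_gen_ker.
  by move=> x Xx; rewrite -U_inner UB; apply: hw; exact/transport_gen_ker.
move=> y; have [x <-] := U_surj y => /transport_gen_ker Xx.
by rewrite -UB U_inner; exact: hw.
Qed.

Lemma transport_adjoint z k J y :
  U (adjoint_on (gen_ker T z k) (sub_op_pow T z J) y) =
  adjoint_on (gen_ker T' z k) (sub_op_pow T' z J) (U y).
Proof.
apply: transport_xget => [w w' [Xw hw] [Xw' hw']|w].
  apply/eqP; rewrite -subr_eq0; apply/eqP/inner_eq0.
  by rewrite innerBr -(hw _ (gen_kerB Xw Xw')) -(hw' _ (gen_kerB Xw Xw')) subrr.
split=> -[Xw hw]; split; try exact/transport_gen_ker.
  move=> x Xx; rewrite -[RHS]U_inner -hw; last exact/transport_gen_ker.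
  by rewrite -transport_sub_op_pow U_inner.
move=> x'; have [x <-] := U_surj x' => /transport_gen_ker Xx.
by rewrite -transport_sub_op_pow !U_inner; exact: hw.
Qed.

Lemma transport_local_op k z I J h : U (local_op k T z I J h) = local_op k T' z I J (U h).
Proof.
by rewrite /local_op transport_orth_proj transport_sub_op_pow transport_adjoint.
Qed.

Lemma transport_unitary z k : unitary_between (gen_ker T z k) (gen_ker T' z k) U.
Proof.
split=> [c x y _ _|x y _ _|]; [exact: U_lin|exact: U_inner|].
apply/seteqP; split=> [_ [x Xx <-]|y]; first exact/transport_gen_ker.
by have [x <-] := U_surj y => /transport_gen_ker Xx; exists x.
Qed.

End UnitaryTransport.

Section Reconstruction.
Context {R : realType} {H H' : hilbertType R} {m n : nat}.
Local Notation C := R[i].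
Local Notation space := 'rV[C^o]_m.
Variables (O : set space) (T : 'I_m -> {linear H -> H}) (T' : 'I_m -> {linear H' -> H'}).
Variables (b : space -> 'I_n.+1 -> H) (b' : space -> 'I_n.+1 -> H').
Hypothesis BT : class_B n.+1 O T.
Hypothesis BT' : class_B n.+1 O T'.
Hypothesis b_onb : forall z, O z -> onb (b z).
Hypothesis b_onb' : forall z, O z -> onb (b' z).
Hypothesis b_ker : forall z, O z -> joint_ker T z = range (lincomb (b z)).
Hypothesis b_ker' : forall z, O z -> joint_ker T' z = range (lincomb (b' z)).
Hypothesis oO : open O.
Implicit Types (z : space) (I J K L : multi_index m) (p q r : 'I_n.+1) (u : 'M[C]_n.+1).

Local Notation gram' := (gram T' b').
Local Notation gram := (gram T b).

(** [u] is the matrix of [U] in the bases [b z] and [b' z]. It intertwines the matrices [dual_gram]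
    of the local operators, hence their block inverses; letters with a zero index are scalar. *)
Lemma local_gram_intertwine z : O z ->
  unitarily_equivalent
    [set IJ : multi_index m * multi_index m |
       (1 <= mdeg IJ.1 <= n.+1)%N /\ (1 <= mdeg IJ.2 <= n.+1)%N]
    (gen_ker T z 1) (fun IJ => local_op n.+1 T z IJ.1 IJ.2)
    (gen_ker T' z 1) (fun IJ => local_op n.+1 T' z IJ.1 IJ.2) ->
  exists u, u ^t* *m u = 1%:M /\ forall l, box n.+1 l ->
    u *m gram z l.1 l.2 = gram' z l.1 l.2 *m u.
Proof.
move=> Oz [U [[Ulin Uinner Uimg] Uloc]].
have Eb d : gen_ker T z 1 (lincomb (b z) d) by rewrite gen_ker1 b_ker //; exists d.
have b_lin q : b z q = lincomb (b z) (fun p => (p == q)%:R).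
  by rewrite /lincomb (bigD1 q) //= eqxx scale1r big1 ?addr0 // => p /negPf ->; rewrite scale0r.
have U0 : U 0 = 0.
  have E0 : gen_ker T z 1 0 by exact: gen_ker0 (class_B_commute BT) z 1.
  by have := Ulin (-1) 0 0 E0 E0; rewrite scaler0 addr0 scaleN1r addNr.
pose u : 'M[C]_n.+1 := \matrix_(p, q) inner (U (b z q)) (b' z p).
have Ub q : U (b z q) = lincomb (b' z) (fun p => u p q).
  have : gen_ker T' z 1 (U (b z q)) by rewrite -Uimg; exists (b z q) => //; rewrite b_lin.
  rewrite gen_ker1 b_ker' // => /(onb_lincombE (b_onb' Oz)) ->.
  by congr lincomb; apply/funext => p; rewrite mxE.
have U_lincomb d : U (lincomb (b z) d) = lincomb (b' z) (fun p => \sum_q u p q * d q).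
  have -> : U (lincomb (b z) d) = \sum_q d q *: U (b z q).
    suff h (s : seq 'I_n.+1) : gen_ker T z 1 (\sum_(q <- s) d q *: b z q) /\
        U (\sum_(q <- s) d q *: b z q) = \sum_(q <- s) d q *: U (b z q) by exact: (h (index_enum 'I_n.+1)).2.
    have Eq q : gen_ker T z 1 (b z q) by rewrite b_lin.
    elim: s => [|q s [IH1 IH2]].
      by rewrite !big_nil U0; split=> //; exact: gen_ker0 (class_B_commute BT) z 1.
    rewrite !big_cons Ulin // IH2; split=> //.
    exact: (gen_ker_lin (class_B_commute BT) _ (Eq q) IH1).
  under eq_bigr do rewrite Ub lincombZ.
  rewrite /lincomb exchange_big; apply: eq_bigr => p _; rewrite scaler_suml.
  by apply: eq_bigr => q _; rewrite mulrC.
have uu : u ^t* *m u = 1%:M.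
  apply/matrixP => p q; rewrite !mxE [p == q]eq_sym -(b_onb Oz).
  have <- : inner (U (b z q)) (U (b z p)) = inner (b z q) (b z p) by apply: Uinner; rewrite b_lin.
  rewrite [in RHS]Ub inner_suml; apply: eq_bigr => r _.
  by rewrite innerZl [RHS]mulrC; congr (_ * _); rewrite !mxE -innerC.
exists u; split=> // -[I J] /andP[/= In Jn].
have [->|I0] := eqVneq I midx0.
  rewrite (gram0 BT b_onb b_ker oO) // (gram0 BT' b_onb' b_ker' oO) //.
  by rewrite mul_mx_scalar mul_scalar_mx.
have [->|J0] := eqVneq J midx0.
  rewrite (gram_adj T b z midx0) (gram_adj T' b' z midx0) (gram0 BT b_onb b_ker oO) // (gram0 BT' b_onb' b_ker' oO) //.
  by rewrite !adjmxC mul_mx_scalar mul_scalar_mx.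
apply: (block_inverse_intertwine (s := mupto n.+1) (P := predC1 midx0)
  (G := gram z) (G' := gram' z) (A := dual_gram T b z n.+1) (A' := dual_gram T' b' z n.+1)).
- exact: mupto_uniq.
- by move=> K L; rewrite gram_adj.
- by move=> K L; rewrite dual_gram_adj.
- by move=> L K; rewrite mem_mupto; exact: (gram_dual BT b_onb b_ker oO Oz).
- by move=> L K; rewrite mem_mupto; exact: (gram_dual BT' b_onb' b_ker' oO Oz).
- move=> K L; rewrite !mem_mupto => Kn K0 Ln L0.
  apply/matrixP => p q.
  have := Uloc (K, L) _ (lincomb (b z) (fun p => (p == q)%:R)) (Eb _).
  rewrite /= !lt0n !mdeg_eq0 Kn Ln (negPf K0) (negPf L0) => /(_ (conj isT isT)).
  rewrite U_lincomb (local_op_lincomb BT b_onb b_ker oO Oz) U_lincomb.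
  rewrite (local_op_lincomb BT' b_onb' b_ker' oO Oz).
  move=> /(congr1 (fun x => inner x (b' z p))); rewrite !onb_coord //; try exact: b_onb'.
  have delta (F : 'I_n.+1 -> C) : \sum_r F r * (r == q)%:R = F q.
    by rewrite (bigD1 q) //= eqxx mulr1 big1 ?addr0 // => r /negPf ->; rewrite mulr0.
  under eq_bigr do rewrite delta.
  under [X in _ = X -> _]eq_bigr do rewrite delta.
  by rewrite !mxE.
- by rewrite mem_mupto.
- exact: I0.
- by rewrite mem_mupto.
- exact: J0.
Qed.

Hypothesis O_connected : connected O.

(** Recombined by [u], the jets of [T'] have the same Gram matrix as those of [T], and both families
    span. The resulting unitary intertwines the operators because each acts on both families by the
    same shift of the index plus the scalar [z_i]. *)
Lemma unitary_of_gram z u : O z -> u ^t* *m u = 1%:M ->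
  (forall I J, u *m gram z I J = gram' z I J *m u) ->
  unitarily_equivalent (K := 'I_m) setT setT (fun i => T i) setT (fun i => T' i).
Proof.
move=> Oz uu ug.
pose a (Iq : multi_index m * 'I_n.+1) := jet T b z Iq.1 Iq.2.
pose a' (Iq : multi_index m * 'I_n.+1) := lincomb (jet T' b' z Iq.1) (fun p => u p Iq.2).
have aa' k l : inner (a k) (a l) = inner (a' k) (a' l).
  case: k l => [I q] [J p].
  have -> : inner (a (I, q)) (a (J, p)) = (u ^t* *m gram' z I J *m u) p q.
    by rewrite -mulmxA -ug mulmxA uu mul1mx mxE.
  rewrite /a' /lincomb inner_suml mxE; apply: eq_bigr => r _.
  rewrite innerZl inner_sumr mulrC mxE; congr (_ * _); apply: eq_bigr => s _.
  by rewrite innerZr !mxE.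
have sp : spanning a.
  apply: spanning_orth => y hy; apply: (jets_total BT b_onb b_ker oO O_connected Oz) => I q.
  exact: (hy (I, q)).
have sp' : spanning a'.
  apply: spanning_orth => y hy; apply: (jets_total BT' b_onb' b_ker' oO O_connected Oz) => I q.
  pose w : 'rV[C]_n.+1 := \row_p inner (jet T' b' z I p) y.
  have wu : w *m u = 0.
    apply/rowP => p; rewrite [RHS]mxE -[RHS](hy (I, p)) mxE /a' /lincomb inner_suml.
    by apply: eq_bigr => r _; rewrite innerZl mxE mulrC.
  have Uu : u \in unitmx by have [] := mulmx1_unit uu.
  by have := congr1 (fun M => (M *m invmx u) 0 q) wu; rewrite mulmxK // mul0mx !mxE.
have [U [U_unitary Ua]] := isometry_extension aa' sp sp'.
have [Ulin _ _] := U_unitary.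
exists U; split=> // i _ h _.
apply: (intertwine_spanning U_unitary sp (class_B_bounded BT i) (class_B_bounded BT' i)).
move=> [I q].
have U0 : U 0 = 0 by have := Ulin (-1) 0 0 Logic.I Logic.I; rewrite scaler0 addr0 scaleN1r addNr.
have Tsub : T i (a (I, q)) = (z 0 i : C) *: a (I, q) + sub_op T z i (a (I, q)).
  by rewrite /sub_op addrC subrK.
have Tsub' : T' i (a' (I, q)) = (z 0 i : C) *: a' (I, q) + sub_op T' z i (a' (I, q)).
  by rewrite /sub_op addrC subrK.
rewrite Tsub Ulin // Ua Tsub'; congr (_ + _).
rewrite /a' (linear_on_lincomb _ _ (sub_op_lin T' z i)) /a /=.
have [-> _] := jet_okP BT b_onb b_ker oO I Oz q.
have e p : sub_op T' z i (jet T' b' z I p) =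
    if I i == 0%N then 0 else jet T' b' z (msub I (mone i)) p.
  by have [-> _] := jet_okP BT' b_onb' b_ker' oO I Oz p.
under [X in _ = lincomb X _]eq_fun do rewrite e.
case: eqP => _; last exact: (Ua (msub I (mone i), q)).
by rewrite U0 /lincomb big1 // => p _; rewrite scaler0.
Qed.

End Reconstruction.

Lemma class_B_frame (R : realType) (H : hilbertType R) m n (O : set 'rV[R[i]^o]_m)
    (T : 'I_m -> {linear H -> H}) : class_B n O T ->
  exists b : 'rV[R[i]^o]_m -> 'I_n -> H, (forall z, O z -> onb (b z)) /\
    forall z, O z -> joint_ker T z = range (lincomb (b z)).
Proof.
move=> BT; have /choice[b hb] : forall z, exists b : 'I_n -> H,
    O z -> onb b /\ joint_ker T z = range (lincomb b).
  move=> z; have [Oz|nOz] := pselect (O z); last by exists (fun=> 0).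
  by have [b hb] := has_dim_onb (class_B_dim BT Oz); exists b.
by exists b; split=> z /hb[].
Qed.

Theorem theorem3p2 (R : realType) (m n : nat) (m_gt0 : (0 < m)%N)
    (n_gt0 : (0 < n)%N) (Omega : set 'rV[R[i]^o]_m)
    (Omega_domain : bounded_domain Omega)
    (H H' : hilbertType R) (sepH : separable H) (sepH' : separable H')
    (T : 'I_m -> {linear H -> H}) (T' : 'I_m -> {linear H' -> H'})
    (BT : class_B n Omega T) (BT' : class_B n Omega T') :
  unitarily_equivalent (K := 'I_m) setT setT (fun i => T i) setT (fun i => T' i)
  <->
  forall z, Omega z ->
    unitarily_equivalent
      [set IJ : multi_index m * multi_index m |
         (1 <= mdeg IJ.1 <= n)%N /\ (1 <= mdeg IJ.2 <= n)%N]
      (gen_ker T z 1) (fun IJ => local_op n T z IJ.1 IJ.2)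
      (gen_ker T' z 1) (fun IJ => local_op n T' z IJ.1 IJ.2).
Proof.
split=> [[U [U_unitary UT]] z _|hloc].
  have commT := class_B_commute BT.
  have U_intertwines i h : U (T i h) = T' i (U h) by exact: UT.
  exists U; split=> [|IJ _ x _]; first exact: transport_unitary.
  exact: transport_local_op.
case: n n_gt0 BT BT' hloc => // n _ BT BT' hloc.
have [nO oO cO _] := Omega_domain.
have [b [b_onb b_ker]] := class_B_frame BT.
have [b' [b_onb' b_ker']] := class_B_frame BT'.
have hu z (Oz : Omega z) := local_gram_intertwine BT BT' b_onb b_onb' b_ker b_ker' oO Oz (hloc z Oz).
have [||||||| z Oz hz] := @intertwine_all_letters R m n Omega
    (fun v l => gram T b v l.1 l.2) (fun v l => gram T' b' v l.1 l.2) oO nO.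
- by move=> z l _; exact: gram_adj.
- by move=> z l _; exact: gram_adj.
- by move=> z J Oz; exact: (gram0 BT b_onb b_ker oO).
- by move=> z J Oz; exact: (gram0 BT' b_onb' b_ker' oO).
- by move=> z Oz; eexists; exact: (gram_frame BT b_onb b_ker oO).
- by move=> z Oz; eexists; exact: (gram_frame BT' b_onb' b_ker' oO).
- move=> z Oz; have [u [uu ug]] := hu z Oz; exists u; split=> //.
  by have [] := mulmx1_unit uu.
have [u [uu ug]] := hu z Oz.
apply: (unitary_of_gram BT BT' b_onb b_onb' b_ker b_ker' oO cO Oz uu) => I J.
exact: (hz u ug (I, J)).
Qed.
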